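(* Let $\sigma\colon(\mathcal M,L)\to(\mathcal B,\tilde L)$ be a pseudo-Finsler submersion such that for every $v\in\mathcal A$ the vertical space at $\pi(v)$ is $g_v$-non-degenerate. (Generalised Gauss equation) For each vertical admissible $v$ and vertical vectors $s,u,w$ at $p$, \begin{align*} (R_v(w,u)s)^\top_v={}&\hat R_v(w,u)s+\mathbf T^v_w\mathbf T^v_us-\mathbf T^v_u\mathbf T^v_ws\\ &+(\hat\nabla_w\hat Q)^v_us-(\hat\nabla_u\hat Q)^v_ws+\hat Q^v_w\hat Q^v_us-\hat Q^v_u\hat Q^v_ws\\ &-P_v(u,s,\hat Q^v_wv+\mathbf T^v_wv)^\top_v+P_v(w,s,\hat Q^v_uv+\mathbf T^v_uv)^\top_v\\ &-2C^\sharp_v(\mathbf T^v_us,\hat Q^v_wv+\mathbf T^v_wv)^\top_v+2C^\sharp_v(\mathbf T^v_ws,\hat Q^v_uv+\mathbf T^v_uv)^\top_v . \end{align*} (Dual Gauss equation) For each horizontal $v$ and $g_v$-horizontal vectors $x,y,z$ at $p$, with $\tilde x=d\sigma(x)$ etc., \begin{align*} (R_v(x,y)z)^\bot_v={}&\tilde R^\ast_v(\tilde x,\tilde y)\tilde z+\mathbf A^v_x\mathbf A^v_yz-\mathbf A^v_y\mathbf A^v_xz+\mathbf A^v_z\mathbf A^v_yx-\mathbf A^v_z\mathbf A^v_xy\\ &+2\mathbf A^v_zC^\sharp_v(y,\mathbf A^v_xv)^\top_v+2\mathbf A^v_yC^\sharp_v(z,\mathbf A^v_xv)^\top_v-2\mathbf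 A^v_zC^\sharp_v(x,\mathbf A^v_yv)^\top_v-2\mathbf A^v_xC^\sharp_v(z,\mathbf A^v_yv)^\top_v\\ &+((\nabla_x\tilde Q)^v_yz-(\nabla_y\tilde Q)^v_xz)^\bot_v+\tilde Q^v_y\tilde Q^v_xz-\tilde Q^v_x\tilde Q^v_yz\\ &+((\dot\partial\tilde Q)^v_yz(\mathbf A^v_xv))^\bot_v-((\dot\partial\tilde Q)^v_xz(\mathbf A^v_yv))^\bot_v\\ &-P_v(y,z,\mathbf A^v_xv)^\bot_v+P_v(x,z,\mathbf A^v_yv)^\bot_v . \end{align*}
   Context: **Metrics.** A pseudo-Finsler metric on $\mathcal M$ (with projection $\pi\colon T\mathcal M\to\mathcal M$) is a smooth $L\colon\mathcal A\to\mathbb R$, $\mathcal A\subset T\mathcal M\setminus\mathbf 0$ open and invariant under positive scalar multiplication, with $L(\lambda v)=\lambda^2L(v)$ for $\lambda>0$ and with non-degenerate fundamental tensor $g_v(e,h)=\frac12\frac{\partial^2}{\partial s\partial t}L(v+se+th)|_{s=t=0}$. Elements of $\mathcal A$ are admissible. Cartan tensor: $C_v(b,e,h)=\frac14\frac{\partial^3}{\partial r\partial s\partial t}L(v+rb+se+th)|_{r=s=t=0}$; $C^\sharp_v$ is defined by $g_v(b,C^\sharp_v(e,h))=C_v(b,e,h)$. **Anisotropic calculus.** An anisotropic tensor $T$ assigns smoothly to $v\in\mathcal A$ a tensor $T_v$ (or $T^v$) on $T_{\pi(v)}\mathcal M$; an anisotropic vector field $\mathcal X$ assigns $\mathcal X_v\in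 T_{\pi(v)}\mathcal M$. $T_V$ is the ordinary tensor $(T_V)_q=T_{V_q}$ for an admissible local vector field $V$. Fiber derivative: $(\dot\partial T)_v(e)=\frac{d}{dt}T_{v+te}|_{t=0}$; thus $(\dot\partial\tilde Q)^v_yz(b)=\frac{d}{dt}\tilde Q^{v+tb}_yz|_{t=0}$. An anisotropic connection assigns to vector fields $E,H$ an anisotropic vector field $\nabla_EH$, $v\mapsto\nabla^v_EH$, $C^\infty$-linear in $E$, additive and satisfying the Leibniz rule in $H$. For anisotropic vector fields $\nabla^v_e\mathcal X=\nabla^v_e(\mathcal X_V)-(\dot\partial\mathcal X)_v(\nabla^v_eV)$, and for functions $f$ on $\mathcal A$, $(\nabla_ef)(v)=e(f(V))-(\dot\partial f)_v(\nabla^v_eV)$, for any admissible local extension $V$ of $v$ (independent of the choice); covariant derivatives of other anisotropic tensors are defined by the product rule. The Levi-Civita–Chern connection $\nabla$ of $(\mathcal M,L)$ is the unique anisotropic connection with $\nabla^v_EH-\nabla^v_HE=[E,H]_{\pi(v)}$ and $\nabla g=0$. Its curvature is $R_v(E,H)B=\nabla^v_E\nabla_HB-\nabla^v_H\nabla_EB-\nabla^v_{[E,H]}B$, and its fiber derivative is the tensor $P_v(E,H,B)=\frac{d}{dt}\nabla^{v+tB}_EH|_{t=0}$. **Submersions.** Let $\sigma\colon\mathcal M\to\mathcal B$ be a surjective map with surjective differential, $\mathcal V_p=\ker d\sigma_p$ (vertical vectors). An admissible $v\in T_p\mathcal M$ is horizontal if $g_v(v,w)=0$ for all $w\in\mathcal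 V_p$. $\sigma\colon(\mathcal M,L)\to(\mathcal B,\tilde L)$ is a pseudo-Finsler submersion if the restriction of $L$ to the tangent spaces of the fibers is a pseudo-Finsler metric on each fiber, and $L(v)=\tilde L(d\sigma(v))$ for every horizontal $v$. A vector is $g_v$-horizontal if it is $g_v$-orthogonal to $\mathcal V_p$. $\hat\nabla,\hat R$ denote the Levi-Civita–Chern connection and curvature of the fibers with the induced metric (so $\hat\nabla\hat Q$ is computed on the fiber, for $\hat Q$ restricted to vertical vectors), and $\tilde R$ the curvature of $(\mathcal B,\tilde L)$; for horizontal $v$, $\tilde R^\ast_v(\tilde x,\tilde y)\tilde z$ is the $g_v$-horizontal vector projecting by $d\sigma$ onto $\tilde R_{\tilde v}(\tilde x,\tilde y)\tilde z$, $\tilde v=d\sigma(v)$. **O'Neill tensors.** For admissible $v\in T_p\mathcal M$, write $e=e^\top_v+e^\bot_v$ with $e^\top_v\in\mathcal V_p$ and $e^\bot_v$ $g_v$-horizontal; $E^\top,E^\bot$ are the anisotropic vector fields $v\mapsto(E_v)^\top_v$, $v\mapsto(E_v)^\bot_v$. Put $\chi^v_he=(\nabla^v_hE^\bot)^\top_v+(\nabla^v_hE^\top)^\bot_v$ for any extension $E$ of $e$ (tensorial), and $\mathbf T^v_be=\chi^v_{b^\top_v}e$, $\mathbf A^v_be=\chi^v_{b^\bot_v}e$. **The tensors $\hat Q,\tilde Q$.** $\hat Q^v_xe=\hat Q^v_ex=0$ for $x$ $g_v$-horizontal and $e$ arbitrary, and for vertical $u,w$: $\hat Q^v_uw=-\big(\mathbf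 T^v_vC^\sharp_v(u,w)+C^\sharp_v(\mathbf T^v_vu,w)+C^\sharp_v(u,\mathbf T^v_vw)+C^\sharp_v(C^\sharp_v(u,w)^\top_v,\mathbf T^v_vv)-C^\sharp_v(C^\sharp_v(u,\mathbf T^v_vv)^\top_v,w)-C^\sharp_v(u,C^\sharp_v(w,\mathbf T^v_vv)^\top_v)\big)^\top_v$. $\tilde Q^v_we=\tilde Q^v_ew=0$ for $w$ vertical and $e$ arbitrary, and for $g_v$-horizontal $x,y$: $\tilde Q^v_xy=\big(\mathbf A^v_vC^\sharp_v(x,y)+C^\sharp_v(\mathbf A^v_vx,y)+C^\sharp_v(x,\mathbf A^v_vy)\big)^\bot_v$. *)

(* Defs.v *)
From HB Require Import structures.
From mathcomp Require Import all_boot all_order all_algebra.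
From mathcomp Require Import all_classical all_reals all_analysis.
Set Implicit Arguments.
Unset Strict Implicit.
Unset Printing Implicit Defensive.
Import Order.TTheory GRing.Theory Num.Theory.
Import numFieldNormedType.Exports.
Local Open Scope classical_set_scope.
Local Open Scope ring_scope.

(* Meant for U open and V finite-dimensional: f is C^k on U iff it is
   differentiable with all directional derivatives of class C^(k-1). *)
Fixpoint Ck (R : realType) (V W : normedModType R) (k : nat) (U : set V)
    (f : V -> W) : Prop :=
  if k is j.+1 then
    (forall x, U x -> differentiable f x) /\ (forall v, Ck j U ('D_v f))
  else forall x, U x -> {for x, continuous f}.

Definition smooth_on (R : realType) (V W : normedModType R) (U : set V)
  (f : V -> W) : Prop := forall k, Ck k U f.

(* Smooth n-manifolds without boundary. The smooth structure is given by a
   compatible atlas indexed by the points of the manifold, the chart [cmap p] :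
   [cdom p] -> [ccod p], with inverse [cinv p], being defined around p; any atlas
   contains such a family. Values outside [cdom p] and [ccod p] are junk. *)
Record manifold (R : realType) (n : nat) := Manifold {
  mcarrier :> topologicalType;
  mhausdorff : hausdorff_space mcarrier;
  msecond_countable : @second_countable mcarrier;
  cdom : mcarrier -> set mcarrier;
  ccod : mcarrier -> set 'rV[R]_n;
  cmap : mcarrier -> mcarrier -> 'rV[R]_n;
  cinv : mcarrier -> 'rV[R]_n -> mcarrier;
  cdom_open : forall p, open (cdom p);
  ccod_open : forall p, open (ccod p);
  cdom_center : forall p, cdom p p;
  cmap_ccod : forall p q, cdom p q -> ccod p (cmap p q);
  cinv_cdom : forall p x, ccod p x -> cdom p (cinv p x);
  cmapK : forall p q, cdom p q -> cinv p (cmap p q) = q;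
  cinvK : forall p x, ccod p x -> cmap p (cinv p x) = x;
  cmap_continuous : forall p q, cdom p q -> {for q, continuous (cmap p)};
  cinv_continuous : forall p x, ccod p x -> {for x, continuous (cinv p)};
  ctrans_smooth : forall p q,
    smooth_on [set x | ccod p x /\ cdom q (cinv p x)] (cmap q \o cinv p)
}.

(* T_pM is identified with R^n by means of the chart [cmap p]; a tangent vector
   of M is thus a pair (base point, components in the chart of that point). *)
Definition TM (R : realType) (n : nat) (M : manifold R n) : Type :=
  (M * 'rV[R]_n)%type.

Section Manifolds.
Context {R : realType}.

(* Components of w in the chart of p; w itself holds those in the chart of its
   own base point. *)
Definition tcoord {n} {M : manifold R n} (p : M) (w : TM M) : 'rV[R]_n :=
  'D_(w.2) (cmap p \o cinv w.1) (cmap w.1 w.1).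

(* The local vector field, defined on [cdom p], which has constant components e
   in the chart of p; its value at p is e. It serves as the local extension of
   tangent vectors wherever the result does not depend on the extension. *)
Definition ext {n} {M : manifold R n} (p : M) (e : 'rV[R]_n) : M -> 'rV[R]_n :=
  fun q => 'D_e (cmap q \o cinv p) (cmap p q).

(* The inverse of the chart of TM induced by [cmap p]; it defines the topology
   and the smooth structure of TM below. *)
Definition tinv {n} {M : manifold R n} (p : M) (z : 'rV[R]_n * 'rV[R]_n) :
  TM M := (cinv p z.1, ext p z.2 (cinv p z.1)).

Definition tdom {n} {M : manifold R n} (O : set (TM M)) (p : M) :
  set ('rV[R]_n * 'rV[R]_n) := [set z | ccod p z.1 /\ O (tinv p z)].

Definition topen {n} {M : manifold R n} (O : set (TM M)) : Prop :=
  forall p, open (tdom O p).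

Definition fun_smooth {n} {M : manifold R n} (U : set M) (f : M -> R) : Prop :=
  forall p, smooth_on [set x | ccod p x /\ U (cinv p x)] (f \o cinv p).

Definition tfun_smooth {n} {M : manifold R n} (O : set (TM M)) (f : TM M -> R)
  : Prop := forall p, smooth_on (tdom O p) (f \o tinv p).

Definition vfield {n} (M : manifold R n) : Type := M -> 'rV[R]_n.

Definition vcoord {n} {M : manifold R n} (p : M) (E : vfield M)
  (x : 'rV[R]_n) : 'rV[R]_n := tcoord p (cinv p x, E (cinv p x)).

Definition vf_smooth {n} {M : manifold R n} (U : set M) (E : vfield M) : Prop :=
  forall p, smooth_on [set x | ccod p x /\ U (cinv p x)] (vcoord p E).

(* Anisotropic vector fields: X v belongs to the tangent space at v.1. *)
Definition afield {n} (M : manifold R n) : Type := TM M -> 'rV[R]_n.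

Definition af_smooth {n} {M : manifold R n} (O : set (TM M)) (X : afield M)
  : Prop :=
  forall p, smooth_on (tdom O p)
    (fun z => tcoord p (cinv p z.1, X (tinv p z))).

Definition fdiff {n} {M : manifold R n} (f : M -> R) (p : M) (e : 'rV[R]_n)
  : R := 'D_e (f \o cinv p) (cmap p p).

Definition lie {n} {M : manifold R n} (E H : vfield M) : vfield M := fun p =>
  'D_(E p) (vcoord p H) (cmap p p) - 'D_(H p) (vcoord p E) (cmap p p).

Definition smooth_map {m n} {M : manifold R m} {N : manifold R n} (f : M -> N)
  : Prop :=
  continuous f /\
  forall p q, smooth_on [set x | ccod p x /\ cdom q (f (cinv p x))]
                        (cmap q \o f \o cinv p).

Definition mdiff {m n} {M : manifold R m} {N : manifold R n} (f : M -> N)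
  (p : M) (e : 'rV[R]_m) : 'rV[R]_n :=
  'D_e (cmap (f p) \o f \o cinv p) (cmap p p).

Definition tmap {m n} {M : manifold R m} {N : manifold R n} (f : M -> N)
  (v : TM M) : TM N := (f v.1, mdiff f v.1 v.2).

(* i identifies the manifold F with the subset S of M, as an embedded
   submanifold: an injective immersion that is a homeomorphism onto S. *)
Definition fiber_embedding {m k} {M : manifold R m} {F : manifold R k}
  (S : set M) (i : F -> M) : Prop :=
  [/\ smooth_map i, injective i, range i = S,
      forall f e, mdiff i f e = 0 -> e = 0
    & forall O : set F, open O -> exists2 O' : set M, open O' & O = i @^-1` O'].

End Manifolds.

Section Finsler.
Context {R : realType} {n : nat} {M : manifold R n}.
Implicit Types (A : set (TM M)) (L : TM M -> R) (v : TM M) (b e h : 'rV[R]_n).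

Definition vshift v e : TM M := (v.1, v.2 + e).

Definition fundamental L v e h : R :=
  2%:R^-1 * derive1 (fun s : R => derive1 (fun t : R =>
    L (vshift v (s *: e + t *: h))) 0) 0.

Definition cartan L v b e h : R :=
  4%:R^-1 * derive1 (fun r : R => derive1 (fun s : R => derive1 (fun t : R =>
    L (vshift v (r *: b + s *: e + t *: h))) 0) 0) 0.

(* L is only meaningful on the open set A of admissible vectors. In
   [cartan_sharp], and in [vtop], [hlift] and [pullv] below, [xget] selects the
   unique element of a set (uniqueness comes from nondegeneracy, respectively
   from injectivity of the differential). *)
Definition cartan_sharp L v e h : 'rV[R]_n :=
  xget 0 [set c | forall b, fundamental L v b c = cartan L v b e h].

Record pseudo_finsler A L : Prop := PseudoFinsler {
  pf_open : topen A;
  pf_slit : forall v, A v -> v.2 <> 0;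
  pf_cone : forall v (l : R), A v -> 0 < l -> A (v.1, l *: v.2);
  pf_smooth : tfun_smooth A L;
  pf_homogeneous : forall v (l : R), A v -> 0 < l ->
    L (v.1, l *: v.2) = l ^+ 2 * L v;
  pf_nondegenerate : forall v, A v ->
    forall e, (forall h, fundamental L v e h = 0) -> e = 0
}.

(* The fibre derivative of an anisotropic tensor T at v, in the direction e. *)
Definition vdot (W : normedModType R) (T : TM M -> W) v e : W :=
  derive1 (fun t : R => T (vshift v (t *: e))) 0.

(* [nb E H v] is nabla^v_E H. The axioms of [aniso_connection] are imposed over
   every open U: nb acts on locally defined fields, extended by junk, and its
   locality follows from the Leibniz rule and linearity. *)
Definition operator : Type := vfield M -> vfield M -> afield M.

Implicit Types (nb : operator) (U : set M) (E H B C : vfield M).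

Record aniso_connection A nb : Prop := AnisoConnection {
  ac_smooth : forall U E H, open U -> vf_smooth U E -> vf_smooth U H ->
    af_smooth [set v | A v /\ U v.1] (nb E H);
  ac_linear : forall U (f : M -> R) E E' H, open U -> fun_smooth U f ->
    vf_smooth U E -> vf_smooth U E' -> vf_smooth U H ->
    forall v, A v -> U v.1 ->
    nb (fun q => f q *: E q + E' q) H v = f v.1 *: nb E H v + nb E' H v;
  ac_additive : forall U E H H', open U ->
    vf_smooth U E -> vf_smooth U H -> vf_smooth U H' ->
    forall v, A v -> U v.1 ->
    nb E (fun q => H q + H' q) v = nb E H v + nb E H' v;
  ac_leibniz : forall U (f : M -> R) E H, open U -> fun_smooth U f ->
    vf_smooth U E -> vf_smooth U H ->
    forall v, A v -> U v.1 ->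
    nb E (fun q => f q *: H q) v
    = fdiff f v.1 (E v.1) *: H v.1 + f v.1 *: nb E H v
}.

(* The admissible local extension V of v used here is [ext v.1 v.2]; the results
   do not depend on it. [nabla_form] and [nabla_tensor] are the product rule. *)
Definition nabla_fun nb E (f : TM M -> R) v : R :=
  let V := ext v.1 v.2 in
  fdiff (fun q => f (q, V q)) v.1 (E v.1) - vdot f v (nb E V v).

Definition nabla_field nb E (X : afield M) : afield M := fun v =>
  let V := ext v.1 v.2 in
  nb E (fun q => X (q, V q)) v - vdot X v (nb E V v).

Definition nabla_form nb E (T : TM M -> 'rV[R]_n -> 'rV[R]_n -> R) B C v : R :=
  nabla_fun nb E (fun v' => T v' (B v'.1) (C v'.1)) v
  - T v (nb E B v) (C v.1) - T v (B v.1) (nb E C v).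

Definition nabla_tensor nb (Q : TM M -> 'rV[R]_n -> 'rV[R]_n -> 'rV[R]_n)
  v (x y z : 'rV[R]_n) : 'rV[R]_n :=
  let X := ext v.1 x in let Y := ext v.1 y in let Z := ext v.1 z in
  nabla_field nb X (fun v' => Q v' (Y v'.1) (Z v'.1)) v
  - Q v (nb X Y v) z - Q v y (nb X Z v).

Record levi_civita_chern A L nb : Prop := LeviCivitaChern {
  lcc_connection : aniso_connection A nb;
  lcc_torsion_free : forall U E H, open U -> vf_smooth U E -> vf_smooth U H ->
    forall v, A v -> U v.1 -> nb E H v - nb H E v = lie E H v.1;
  lcc_metric : forall U E B C, open U ->
    vf_smooth U E -> vf_smooth U B -> vf_smooth U C ->
    forall v, A v -> U v.1 -> nabla_form nb E (fundamental L) B C v = 0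
}.

Definition curvature_field nb E H B : afield M := fun v =>
  nabla_field nb E (nb H B) v - nabla_field nb H (nb E B) v
  - nb (lie E H) B v.

(* R_v(e,h)b *)
Definition curvature nb v e h b : 'rV[R]_n :=
  curvature_field nb (ext v.1 e) (ext v.1 h) (ext v.1 b) v.

(* P_v(e,h,b) *)
Definition Ptensor nb v e h b : 'rV[R]_n :=
  vdot (nb (ext v.1 e) (ext v.1 h)) v b.

End Finsler.

Arguments operator {R n} M.

Section Submersion.
Context {R : realType} {m n : nat} {M : manifold R m} {B : manifold R n}.
Implicit Types (sigma : M -> B) (A : set (TM M)) (L : TM M -> R) (v : TM M)
  (p : M) (b e h u w x y : 'rV[R]_m) (nb : operator M).

Definition vertical sigma p : set 'rV[R]_m := [set w | mdiff sigma p w = 0].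

Definition ghorizontal sigma L v : set 'rV[R]_m :=
  [set x | forall w, vertical sigma v.1 w -> fundamental L v x w = 0].

Definition horizontal sigma A L : set (TM M) :=
  [set v | A v /\ ghorizontal sigma L v v.2].

Definition vertical_nondegenerate sigma A L : Prop :=
  forall v, A v -> forall w, vertical sigma v.1 w ->
    (forall u, vertical sigma v.1 u -> fundamental L v w u = 0) -> w = 0.

(* The family i : F b -> M exhibits the fibres of sigma as embedded
   submanifolds. The induced metric on F b is the pullback of L. *)
Record pseudo_finsler_submersion sigma (F : B -> manifold R (m - n)%N)
    (i : forall b : B, F b -> M) A L (At : set (TM B)) (Lt : TM B -> R)
    : Prop := PseudoFinslerSubmersion {
  pfs_total : pseudo_finsler A L;
  pfs_base : pseudo_finsler At Lt;
  pfs_smooth : smooth_map sigma;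
  pfs_surjective : forall b : B, exists p, sigma p = b;
  pfs_submersive : forall p (y : 'rV[R]_n), exists x, mdiff sigma p x = y;
  pfs_fiber : forall b : B, fiber_embedding (sigma @^-1` [set b]) (i b);
  pfs_fiber_metric : forall b : B,
    pseudo_finsler (tmap (i b) @^-1` A) (L \o tmap (i b));
  pfs_isometric : forall v, horizontal sigma A L v ->
    At (tmap sigma v) /\ L v = Lt (tmap sigma v)
}.

Definition vtop sigma L v e : 'rV[R]_m :=
  xget 0 [set w | vertical sigma v.1 w /\ ghorizontal sigma L v (e - w)].

Definition vbot sigma L v e : 'rV[R]_m := e - vtop sigma L v e.

(* The g_v-horizontal vector that projects onto y. *)
Definition hlift sigma L v (y : 'rV[R]_n) : 'rV[R]_m :=
  xget 0 [set x | ghorizontal sigma L v x /\ mdiff sigma v.1 x = y].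

(* Tensorial in h and e, so their extensions are immaterial. *)
Definition chi sigma L nb v h e : 'rV[R]_m :=
  let H := ext v.1 h in let E := ext v.1 e in
  vtop sigma L v (nabla_field nb H (fun v' => vbot sigma L v' (E v'.1)) v)
  + vbot sigma L v (nabla_field nb H (fun v' => vtop sigma L v' (E v'.1)) v).

Definition oneillT sigma L nb v b e : 'rV[R]_m :=
  chi sigma L nb v (vtop sigma L v b) e.

Definition oneillA sigma L nb v b e : 'rV[R]_m :=
  chi sigma L nb v (vbot sigma L v b) e.

Definition Qhat sigma L nb v u w : 'rV[R]_m :=
  let top := vtop sigma L v in
  let T := oneillT sigma L nb v v.2 in
  let C := cartan_sharp L v in
  let Q u w :=
    - top (T (C u w) + C (T u) w + C u (T w) + C (top (C u w)) (T v.2)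
           - C (top (C u (T v.2))) w - C u (top (C w (T v.2)))) in
  Q (top u) (top w).

Definition Qtilde sigma L nb v x y : 'rV[R]_m :=
  let bot := vbot sigma L v in
  let A := oneillA sigma L nb v v.2 in
  let C := cartan_sharp L v in
  let Q x y := bot (A (C x y) + C (A x) y + C x (A y)) in
  Q (bot x) (bot y).

End Submersion.

Section Fiber.
Context {R : realType} {m k : nat} {M : manifold R m} {F : manifold R k}.
Context (i : F -> M).

Definition pullv (f : F) (e : 'rV[R]_m) : 'rV[R]_k :=
  xget 0 [set c | mdiff i f c = e].

(* The restriction to F of a vertical-valued tensor Q on M. *)
Definition pull_tensor (Q : TM M -> 'rV[R]_m -> 'rV[R]_m -> 'rV[R]_m)
  (v : TM F) (u w : 'rV[R]_k) : 'rV[R]_k :=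
  pullv v.1 (Q (tmap i v) (mdiff i v.1 u) (mdiff i v.1 w)).

(* For f : F, the arguments v w u s are vertical vectors at i f, in T M; they are
   moved to F by [pullv] and the result is pushed back to M. *)
Definition fiber_curvature (nb : operator F) (f : F) (v w u s : 'rV[R]_m)
  : 'rV[R]_m :=
  mdiff i f
    (curvature nb (f, pullv f v) (pullv f w) (pullv f u) (pullv f s)).

Definition fiber_nabla (nb : operator F)
  (Q : TM M -> 'rV[R]_m -> 'rV[R]_m -> 'rV[R]_m)
  (f : F) (v w u s : 'rV[R]_m) : 'rV[R]_m :=
  mdiff i f (nabla_tensor nb (pull_tensor Q) (f, pullv f v)
    (pullv f w) (pullv f u) (pullv f s)).

End Fiber.

(* Main.v *)
(* In a chart, a tangent vector is a pair z = (x, v), an anisotropic connection is a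
   field of bilinear maps Ga z, and the covariant derivative in the direction h is
   the derivative along the horizontal lift (h, - Ga z h v).

   For a fibre with inclusion j and intrinsic connection GaF, the Koszul argument
   identifies D^2 j + Ga - dj GaF with Qhat + T. Differentiating this identity along
   (c, - GaF c v), which dj maps to (c, Qhat_c v + T_c v - Ga c v) with dj c = c, and
   antisymmetrising yields the Gauss equation; the vertical correction
   Qhat_c v + T_c v is the origin of the terms in P and in the Cartan tensor.

   The relation L = Lt o dsigma holds only on the set of horizontal vectors, which
   is not open. It is a level set, however, and the directions (h, A_h v - Ga h v)
   are tangent to it, so that identities between functions may be differentiated
   along them. Differentiating L = Lt o dsigma shows successively that dsigma is
   isometric on horizontal vectors, that A_v v = 0 and A_x v = - A_v x, and, by the
   Koszul argument, that the two connections differ by Qtilde on horizontal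
   vectors. Differentiating this last identity and antisymmetrising yields the dual
   Gauss equation. *)
Require Import Defs.
From HB Require Import structures.
From mathcomp Require Import all_boot all_order all_algebra.
From mathcomp Require Import all_classical all_reals all_analysis.
From mathcomp Require Import ring lra.
Set Implicit Arguments.
Unset Strict Implicit.
Unset Printing Implicit Defensive.
Import Order.TTheory GRing.Theory Num.Theory.
Import numFieldNormedType.Exports.
Local Open Scope classical_set_scope.
Local Open Scope ring_scope.

(** * Smooth maps between normed spaces *)

(** The vertical projection and C^sharp are defined by choice, with no visible regularity. In a
    chart each solves an invertible linear system, which makes it smooth. In both Koszul arguments
    the unknown difference S of the connections reappears inside the Cartan terms as S(., v). As
    C_v(v, ., .) = 0, the system is triangular and yields S(v, v), then S(a, v), then S(a, b). The
    nested terms of Qhat are traces of these substitutions; on the horizontal side S(a, v) = 0,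
    which leaves only three terms in Qtilde. Neither Ga nor the second derivatives of the inclusion
    and of sigma are tensors. They disappear only on antisymmetrising, by the symmetry of second
    derivatives and of the connections; what remains is linear arithmetic in each coordinate. The
    coefficients 2 have one source: the fibre derivative of g is 2 C, so that of the vertical
    projection, at a horizontal vector, is 2 top C. To differentiate along the horizontal set, one
    curve with prescribed velocity suffices. It is the straight line corrected by a fixed point of a
    contraction, of order o(t). *)

Section Differentials.
Context {R : realType}.
Implicit Types U V W : normedModType R.

Lemma diff_epsP V W (f : V -> W) (df : {linear V -> W}) x : continuous df ->
  (forall e : R, 0 < e -> \forall h \near (0 : V),
     `|f (h + x) - f x - df h| <= e * `|h|) ->
  differentiable f x /\ 'd f x = df :> (V -> W).
Proof.
move=> dfc H.
have K : f \o shift x = cst (f x) + df +o_ 0 id.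
  apply/eqaddoP => _/posnumP[e]; have := H _ [gt0 of e%:num]; apply: filterS => h.
  by rewrite /= opprD addrA.
have E := diff_unique dfc K; split=> //.
by apply/diff_locallyP; rewrite E.
Qed.

Lemma diff_eps V W (f : V -> W) x : differentiable f x ->
  forall e : R, 0 < e -> \forall h \near (0 : V),
     `|f (h + x) - f x - 'd f x h| <= e * `|h|.
Proof.
move=> /diff_locallyP[_ /eqaddoP H] e e0; have := H e e0.
by apply: filterS => h /=; rewrite opprD addrA.
Qed.

Lemma near_eq_diff V W (f g : V -> W) x : (\near x, f x = g x) ->
  differentiable f x -> differentiable g x /\ 'd g x = 'd f x :> (V -> W).
Proof.
move=> fg df; apply: diff_epsP; first exact: diff_continuous.
move=> e e0; have fgx : f x = g x by apply: nbhs_singleton fg.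
have fg' : \forall h \near (0 : V), f (h + x) = g (h + x).
  by move: fg; rewrite (near_shift 0 x) /= subr0.
have := diff_eps df e0; apply: filterS2 fg' => h <-.
by rewrite fgx.
Qed.

Lemma derive_comp U V W (f : U -> V) (g : V -> W) x u : differentiable f x ->
  differentiable g (f x) -> 'D_u (g \o f) x = 'D_('D_u f x) g (f x).
Proof.
move=> df dg; rewrite (deriveE u (differentiable_comp df dg)) (deriveE u df).
by rewrite (deriveE _ dg) (diff_comp df dg).
Qed.

Lemma differentiable_lin V W (f : {linear V -> W}) x : continuous f ->
  differentiable f x.
Proof. by move=> c; apply: linear_differentiable; exact: c. Qed.

Lemma derive_lin V W (f : {linear V -> W}) x u : continuous f ->
  'D_u f x = f u.
Proof.
move=> c; rewrite (deriveE _ (@differentiable_lin _ _ f x c)).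
by rewrite (diff_lin x c).
Qed.

Lemma deriveDr V W (f : V -> W) x u v : differentiable f x ->
  'D_(u + v) f x = 'D_u f x + 'D_v f x.
Proof. by move=> df; rewrite !(deriveE _ df) linearD. Qed.

Lemma deriveZr V W (f : V -> W) x (k : R) v : differentiable f x ->
  'D_(k *: v) f x = k *: 'D_v f x.
Proof. by move=> df; rewrite !(deriveE _ df) linearZ. Qed.

Lemma derive_sumr V W (f : V -> W) x (I : Type) (r : seq I) (P : pred I) (F : I -> V) :
  differentiable f x ->
  'D_(\sum_(i <- r | P i) F i) f x = \sum_(i <- r | P i) 'D_(F i) f x.
Proof. by move=> df; rewrite (deriveE _ df) linear_sum; apply: eq_bigr => i _; rewrite (deriveE _ df). Qed.

(** Scalar multiplication is a continuous bilinear map on [R * W]; composing it with the pair (a, f)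
    gives the product rule. *)
Lemma dscaleM V W (a : V -> R) (f : V -> W) x :
  differentiable a x -> differentiable f x ->
  differentiable (fun x => a x *: f x) x /\
  forall u, 'D_u (fun x => a x *: f x) x = 'D_u a x *: f x + a x *: 'D_u f x.
Proof.
move=> da df.
pose d u : W := 'd a x u *: f x + a x *: 'd f x u.
have lind : linear d.
  move=> k u v; rewrite /d (linearP ('d a x)) (linearP ('d f x)) scalerDl.
  by rewrite !scalerDr !scalerA (mulrC k (a x)) addrACA.
pose dM := GRing.isLinear.Build _ _ _ _ _ lind.
pose dL : {linear V -> W} := HB.pack d dM.
have dLc : continuous dL.
  move=> u; apply: (@continuousD _ _ _ (fun u => 'd a x u *: f x)
      (fun u => a x *: 'd f x u)).
    by apply: continuousZr_tmp; exact: diff_continuous.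
  by apply: continuousZl_tmp; exact: diff_continuous.
suff [dif E] : differentiable (fun x => a x *: f x) x
    /\ 'd (fun x => a x *: f x) x = dL :> (V -> W).
  by split=> // u; rewrite (deriveE _ dif) E (deriveE _ da) (deriveE _ df).
have bl : bilinear_for (GRing.Scale.Law.clone _ _ *:%R _)
    (GRing.Scale.Law.clone _ _ *:%R _) (@GRing.scale R W).
  split=> [u'|u] k y z /=.
  - by rewrite scalerDl scalerA.
  - rewrite -[LHS]/(u *: (k *: y + z)) scalerDr !scalerA mulrC.
    done.
pose bM := bilinear_isBilinear.Build R R W W _ _ (@GRing.scale R W) bl.
pose b : {bilinear R -> W -> W} := HB.pack (@GRing.scale R W) bM.
have bc : continuous (fun p : R * W => b p.1 p.2) by exact: scale_continuous.
have dp := differentiable_pair da df.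
have db := differentiable_bilin (a x, f x) bc.
have E : (fun x => a x *: f x) = (fun p => b p.1 p.2) \o (fun y => (a y, f y)) by [].
rewrite E; split; first exact: differentiable_comp.
by rewrite (diff_comp dp db) (diff_bilin _ bc) (diff_pair da df) funeqE => u /=; rewrite addrC.
Qed.

Lemma near_eq_deriv V W (U : set V) (f g : V -> W) x v : open U -> U x ->
  (forall y, U y -> f y = g y) -> 'D_v f x = 'D_v g x.
Proof.
move=> oU Ux fg; apply: near_eq_derive; have := open_nbhs_nbhs (conj oU Ux).
exact: filterS.
Qed.

Lemma near_eq_differentiable V W (U : set V) (f g : V -> W) x : open U -> U x ->
  (forall y, U y -> f y = g y) -> differentiable f x -> differentiable g x.
Proof.
move=> oU Ux fg df; apply: (proj1 (near_eq_diff _ df)).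
by have := open_nbhs_nbhs (conj oU Ux); apply: filterS.
Qed.

End Differentials.

Section Smooth.
Context {R : realType}.
Implicit Types U V W : normedModType R.

Lemma Ck_ext V W k (U : set V) (f g : V -> W) : open U ->
  (forall x, U x -> f x = g x) -> Ck k U f -> Ck k U g.
Proof.
move=> oU; elim: k f g => [|k IH] f g fg /=.
  move=> cf x Ux; have := cf x Ux; rewrite /prop_for /continuous_at -fg //.
  move=> c; apply: cvg_trans c; apply: near_eq_cvg.
  by have := open_nbhs_nbhs (conj oU Ux); apply: filterS => y /fg.
move=> [df cf]; split=> [x Ux|v].
  exact: near_eq_differentiable oU Ux fg (df x Ux).
apply: IH (cf v) => x Ux; exact: near_eq_deriv oU Ux fg.
Qed.

Lemma Ck_sub V W k (U U' : set V) (f : V -> W) : U' `<=` U -> Ck k U f -> Ck k U' f.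
Proof.
move=> s; elim: k f => [|k IH] f /=; first by move=> c x /s /c.
by move=> [df cf]; split=> [x /s /df //|v]; apply: IH.
Qed.

Lemma CkS V W k (U : set V) (f : V -> W) : Ck k.+1 U f -> Ck k U f.
Proof.
elim: k f => [|k IH] f.
  by move=> [df _] x Ux; apply: differentiable_continuous; exact: df.
by move=> [df cf]; split=> // v; apply: IH.
Qed.

Lemma Ck_cst V W k (U : set V) (c : W) : Ck k U (fun _ : V => c).
Proof.
elim: k c => [|k IH] c /=; first by move=> x _; exact: cst_continuous.
split=> [x _|v]; first exact: differentiable_cst.
have -> : 'D_v (fun _ : V => c) = (fun _ => 0) by apply/funext => x; rewrite derive_cst.
exact: IH.
Qed.

Lemma Ck_lin V W k (U : set V) (f : {linear V -> W}) : continuous f -> Ck k U f.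
Proof.
move=> cf; case: k => [|k] /=; first by move=> x _; exact: cf.
split=> [x _|v]; first exact: differentiable_lin.
have -> : 'D_v f = (fun _ => f v) by apply/funext => x; rewrite derive_lin.
exact: Ck_cst.
Qed.

Lemma Ck_linpost V W W' k (U : set V) (f : V -> W) (phi : {linear W -> W'}) :
  open U -> continuous phi -> Ck k U f -> Ck k U (phi \o f).
Proof.
move=> oU cphi; elim: k f => [|k IH] f /=.
  by move=> cf x Ux; apply: continuous_comp; [exact: cf|exact: cphi].
move=> [df cf]; split=> [x Ux|v].
  by apply: differentiable_comp; [exact: df|exact: differentiable_lin].
apply: Ck_ext (IH _ (cf v)) => // x Ux /=.
by rewrite derive_comp ?derive_lin//; [exact: df|exact: differentiable_lin].
Qed.

Lemma Ck_add V W k (U : set V) (f g : V -> W) : open U ->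
  Ck k U f -> Ck k U g -> Ck k U (fun x => f x + g x).
Proof.
move=> oU; elim: k f g => [|k IH] f g /=.
  by move=> cf cg x Ux; apply: continuousD; [exact: cf|exact: cg].
move=> [df cf] [dg cg]; split=> [x Ux|v].
  by apply: differentiableD; [exact: df|exact: dg].
apply: Ck_ext (IH _ _ (cf v) (cg v)) => // x Ux /=.
by rewrite deriveD//; apply: diff_derivable; [exact: df|exact: dg].
Qed.

Lemma Ck_sum V W k (U : set V) (I : Type) (r : seq I) (P : pred I) (f : I -> V -> W) :
  open U -> (forall i, P i -> Ck k U (f i)) -> Ck k U (fun x => \sum_(i <- r | P i) f i x).
Proof.
move=> oU cf; elim: r => [|i r IH].
  by under eq_fun do rewrite big_nil; exact: Ck_cst.
under eq_fun do rewrite big_cons.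
by case Pi : (P i) => //; apply: Ck_add => //; exact: cf.
Qed.

Lemma Ck_scale V W k (U : set V) (a : V -> R) (f : V -> W) : open U ->
  Ck k U a -> Ck k U f -> Ck k U (fun x => a x *: f x).
Proof.
move=> oU; elim: k a f => [|k IH] a f.
  move=> ca cf x Ux; have ca' := ca x Ux; have cf' := cf x Ux.
  exact: (continuousZ ca' cf').
move=> Ca Cf; have [da ca] := Ca; have [df cf] := Cf; split=> [x Ux|v].
  by have [] := dscaleM (da x Ux) (df x Ux).
apply: (@Ck_ext _ _ _ _ (fun x => 'D_v a x *: f x + a x *: 'D_v f x)) => //.
  by move=> x Ux; have [_ ->] := dscaleM (da x Ux) (df x Ux).
apply: Ck_add => //; first exact: (IH _ _ (ca v) (CkS Cf)).
exact: (IH _ _ (CkS Ca) (cf v)).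
Qed.

(** Phrased with continuous coordinate functionals, so that [Ck_comp] can expand a moving direction
    over fixed ones. *)
Definition finite_dim (W : normedModType R) := exists (N : nat) (e : 'I_N -> W)
  (phi : 'I_N -> {linear W -> R}), (forall i, continuous (phi i)) /\
  forall w, w = \sum_(i < N) phi i w *: e i.

(** [Ck] speaks of derivatives in fixed directions, whereas the chain rule differentiates f in the
    moving direction ['D_v g x]. Expanding that direction over a basis leaves a sum of products, to
    which the induction hypothesis applies. *)
Lemma Ck_comp U V W k (A : set U) (B : set V) (g : U -> V) (f : V -> W) :
  finite_dim V -> open A -> open B -> (forall x, A x -> B (g x)) ->
  Ck k B f -> Ck k A g -> Ck k A (f \o g).
Proof.
move=> [N [e [phi [cphi ephi]]]] oA oB AB; elim: k f => [|k IH] f.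
  move=> cf cg x Ax; apply: continuous_comp; first exact: cg.
  by apply: cf; exact: AB.
move=> [df cf] Cg; have [dg cg] := Cg; split=> [x Ax|v].
  by apply: differentiable_comp; [exact: dg|apply: df; exact: AB].
apply: (@Ck_ext _ _ _ _ (fun x => \sum_i phi i ('D_v g x) *: 'D_(e i) f (g x))) => //.
  move=> x Ax; have dfx := df _ (AB _ Ax).
  rewrite derive_comp//; last exact: dg.
  rewrite [in RHS](ephi ('D_v g x)) derive_sumr//.
  by apply: eq_bigr => i _; rewrite deriveZr.
apply: Ck_sum => // i _; apply: Ck_scale => //.
  exact: (Ck_linpost oA (cphi i) (cg v)).
exact: (IH _ (cf (e i)) (CkS Cg)).
Qed.

(** The derivative - a' / a^2 contains 1 / a again, but with one order of regularity less to
    prove. *)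
Lemma Ck_inv V k (U : set V) (a : V -> R) : open U -> (forall x, U x -> a x != 0) ->
  Ck k U a -> Ck k U (fun x => (a x)^-1).
Proof.
move=> oU a0; elim: k => [|k IH].
  by move=> ca x Ux; apply: continuousV; [exact: a0|exact: ca].
move=> Ca; have [da ca] := Ca; split=> [x Ux|v].
  by apply: differentiableV; [exact: da|exact: a0].
apply: (@Ck_ext _ _ _ _ (fun x => (- ((a x)^-1 *: (a x)^-1)) *: 'D_v a x)) => //.
  move=> x Ux; rewrite deriveV; [|exact: a0|exact/diff_derivable/da].
  by rewrite expr2 invfM.
apply: Ck_scale => //; last exact: ca.
have IH' := IH (CkS Ca).
apply: (@Ck_ext _ _ _ _ (fun x => (-1) *: ((a x)^-1 *: (a x)^-1))) => //.
  by move=> x _; rewrite scaleN1r.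
by apply: Ck_scale => //; [exact: Ck_cst|apply: Ck_scale].
Qed.

Lemma sm_ext V W (U : set V) (f g : V -> W) : open U ->
  (forall x, U x -> f x = g x) -> smooth_on U f -> smooth_on U g.
Proof. by move=> oU fg sf k; apply: Ck_ext fg (sf k). Qed.

Lemma sm_sub V W (U U' : set V) (f : V -> W) : U' `<=` U -> smooth_on U f -> smooth_on U' f.
Proof. by move=> s sf k; apply: Ck_sub s (sf k). Qed.

Lemma sm_cst V W (U : set V) (c : W) : smooth_on U (fun _ : V => c).
Proof. by move=> k; exact: Ck_cst. Qed.

Lemma sm_lin V W (U : set V) (f : {linear V -> W}) : continuous f -> smooth_on U f.
Proof. by move=> cf k; exact: Ck_lin. Qed.

Lemma sm_linpost V W W' (U : set V) (f : V -> W) (phi : {linear W -> W'}) :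
  open U -> continuous phi -> smooth_on U f -> smooth_on U (fun x => phi (f x)).
Proof. by move=> oU cf sf k; exact: Ck_linpost oU cf (sf k). Qed.

Lemma sm_add V W (U : set V) (f g : V -> W) : open U ->
  smooth_on U f -> smooth_on U g -> smooth_on U (fun x => f x + g x).
Proof. by move=> oU sf sg k; exact: Ck_add oU (sf k) (sg k). Qed.

Lemma sm_sum V W (U : set V) (I : Type) (r : seq I) (P : pred I) (f : I -> V -> W) :
  open U -> (forall i, P i -> smooth_on U (f i)) ->
  smooth_on U (fun x => \sum_(i <- r | P i) f i x).
Proof. by move=> oU sf k; apply: Ck_sum => // i Pi; exact: sf. Qed.

Lemma sm_scale V W (U : set V) (a : V -> R) (f : V -> W) : open U ->
  smooth_on U a -> smooth_on U f -> smooth_on U (fun x => a x *: f x).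
Proof. by move=> oU sa sf k; exact: Ck_scale oU (sa k) (sf k). Qed.

Lemma sm_scalec V W (U : set V) (a : R) (f : V -> W) : open U ->
  smooth_on U f -> smooth_on U (fun x => a *: f x).
Proof. by move=> oU sf; apply: sm_scale => //; exact: sm_cst. Qed.

Lemma sm_opp V W (U : set V) (f : V -> W) : open U ->
  smooth_on U f -> smooth_on U (fun x => - f x).
Proof.
move=> oU sf; apply: sm_ext (sm_scalec (-1) oU sf) => // x _; exact: scaleN1r.
Qed.

Lemma sm_sub2 V W (U : set V) (f g : V -> W) : open U ->
  smooth_on U f -> smooth_on U g -> smooth_on U (fun x => f x - g x).
Proof. by move=> oU sf sg; apply: sm_add => //; exact: sm_opp. Qed.

Lemma sm_mul V (U : set V) (a b : V -> R) : open U ->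
  smooth_on U a -> smooth_on U b -> smooth_on U (fun x => a x * b x).
Proof. by move=> oU sa sf k; exact: (Ck_scale oU (sa k) (sf k)). Qed.

Lemma sm_inv V (U : set V) (a : V -> R) : open U -> (forall x, U x -> a x != 0) ->
  smooth_on U a -> smooth_on U (fun x => (a x)^-1).
Proof. by move=> oU a0 sa k; exact: Ck_inv (sa k). Qed.

Lemma sm_prod V (U : set V) (I : Type) (r : seq I) (P : pred I) (f : I -> V -> R) :
  open U -> (forall i, P i -> smooth_on U (f i)) ->
  smooth_on U (fun x => \prod_(i <- r | P i) f i x).
Proof.
move=> oU cf; elim: r => [|i r IH].
  by under eq_fun do rewrite big_nil; exact: sm_cst.
under eq_fun do rewrite big_cons.
by case Pi : (P i) => //; apply: sm_mul => //; exact: cf.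
Qed.

Lemma sm_comp U V W (A : set U) (B : set V) (g : U -> V) (f : V -> W) :
  finite_dim V -> open A -> open B -> (forall x, A x -> B (g x)) ->
  smooth_on B f -> smooth_on A g -> smooth_on A (fun x => f (g x)).
Proof. by move=> fV oA oB AB sf sg k; exact: (Ck_comp fV oA oB AB (sf k) (sg k)). Qed.

Lemma sm_derive V W (U : set V) (f : V -> W) v : smooth_on U f -> smooth_on U ('D_v f).
Proof. by move=> sf k; have [_] := sf k.+1; apply. Qed.

Lemma sm_differentiable V W (U : set V) (f : V -> W) x : smooth_on U f -> U x ->
  differentiable f x.
Proof. by move=> sf Ux; have [df _] := sf 1; exact: df. Qed.

Section Coord.
Variables m n : nat.
Definition mxcoord (i : 'I_m) (j : 'I_n) (M : 'M[R]_(m, n)) : R := M i j.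
Lemma mxcoord_linear i j : linear (mxcoord i j).
Proof. by move=> a u v; rewrite /mxcoord !mxE. Qed.
HB.instance Definition _ i j :=
  GRing.isLinear.Build R 'M[R]_(m, n) R _ (mxcoord i j) (mxcoord_linear i j).
Lemma mxcoord_continuous i j : continuous (mxcoord i j).
Proof. exact: coord_continuous. Qed.
End Coord.

Lemma fd_rV n : finite_dim 'rV[R]_n.
Proof.
exists n, (fun j => delta_mx 0 j), (fun j => mxcoord 0 j); split.
  by move=> i; exact: mxcoord_continuous.
by move=> w; rewrite {1}[w]row_sum_delta.
Qed.

Lemma fst_continuous V W : continuous (fst : V * W -> V).
Proof. by move=> x; exact: cvg_fst. Qed.
Lemma snd_continuous V W : continuous (snd : V * W -> W).
Proof. by move=> x; exact: cvg_snd. Qed.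

Lemma fd_prod V W : finite_dim V -> finite_dim W -> finite_dim (V * W)%type.
Proof.
move=> [N [e [phi [cphi ephi]]]] [N' [e' [phi' [cphi' ephi']]]].
exists (N + N')%N.
pose E (i : 'I_N + 'I_N') : (V * W)%type := match i with inl j => (e j, 0) | inr j => (0, e' j) end.
pose F (i : 'I_N + 'I_N') : {linear (V * W)%type -> R} := match i with
  inl j => (phi j \o fst : {linear (V * W)%type -> R}) | inr j => (phi' j \o snd : {linear (V * W)%type -> R}) end.
exists (fun i => E (fintype.split i)), (fun i => F (fintype.split i)); split.
  move=> i; case: (fintype.split i) => j x.
    by apply: continuous_comp; [exact: fst_continuous|exact: cphi].
  by apply: continuous_comp; [exact: snd_continuous|exact: cphi'].
move=> [v w]; rewrite big_split_ord /=.
under eq_bigr do rewrite (unsplitK (inl _)) /=.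
under [X in _ + X]eq_bigr do rewrite (unsplitK (inr _)) /=.
apply: injective_projections => /=.
  rewrite !(linear_sum fst) /= [X in _ + X]big1 ?addr0 => [|i _]; last exact: scaler0.
  exact: ephi.
rewrite !(linear_sum snd) /= [X in X + _]big1 ?add0r => [|i _]; last exact: scaler0.
exact: ephi'.
Qed.

Lemma sm_pair U V W (A : set U) (f : U -> V) (g : U -> W) : open A ->
  smooth_on A f -> smooth_on A g -> smooth_on A (fun x => (f x, g x)).
Proof.
move=> oA sf sg k; have := sf k; have := sg k; clear sf sg.
elim: k f g => [|k IH] f g.
  by move=> cg cf x Ax; apply: cvg_pair; [exact: cf|exact: cg].
move=> [dg cg] [df cf]; split=> [x Ax|v].
  by apply: differentiable_pair; [exact: df|exact: dg].
apply: (@Ck_ext _ _ _ _ (fun x => ('D_v f x, 'D_v g x))) => //.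
  move=> x Ax; have dfx := df x Ax; have dgx := dg x Ax.
  rewrite (deriveE _ (differentiable_pair dfx dgx)) (diff_pair dfx dgx).
  by rewrite (deriveE _ dfx) (deriveE _ dgx).
exact: (IH _ _ (cg v) (cf v)).
Qed.

Lemma derive_pair U V W (f : U -> V) (g : U -> W) x v : differentiable f x ->
  differentiable g x -> 'D_v (fun x => (f x, g x)) x = ('D_v f x, 'D_v g x).
Proof.
move=> dfx dgx; rewrite (deriveE _ (differentiable_pair dfx dgx)) (diff_pair dfx dgx).
by rewrite (deriveE _ dfx) (deriveE _ dgx).
Qed.

Lemma sm_fst V W (A : set (V * W)) : smooth_on A fst.
Proof. exact: (sm_lin A (@fst_continuous V W)). Qed.
Lemma sm_snd V W (A : set (V * W)) : smooth_on A snd.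
Proof. exact: (sm_lin A (@snd_continuous V W)). Qed.
Lemma sm_id V (A : set V) : smooth_on A id.
Proof. by apply: (@sm_lin V V A idfun) => x; exact: cvg_id. Qed.

Lemma sm_entry V m n (A : set V) (f : V -> 'M[R]_(m, n)) i j : open A ->
  smooth_on A f -> smooth_on A (fun x => f x i j).
Proof. by move=> oA sf; exact: (sm_linpost oA (@mxcoord_continuous m n i j) sf). Qed.

Lemma sm_mx V m n (A : set V) (f : V -> 'M[R]_(m, n)) : open A ->
  (forall i j, smooth_on A (fun x => f x i j)) -> smooth_on A f.
Proof.
move=> oA sf.
apply: (@sm_ext _ _ _ (fun x => \sum_i \sum_j f x i j *: delta_mx i j)) => //.
  by move=> x _; rewrite [RHS]matrix_sum_delta.
apply: sm_sum => // i _; apply: sm_sum => // j _; apply: sm_scale => //.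
exact: sm_cst.
Qed.

Lemma sm_mulmx V m n p (A : set V) (f : V -> 'M[R]_(m, n)) (g : V -> 'M[R]_(n, p)) :
  open A -> smooth_on A f -> smooth_on A g -> smooth_on A (fun x => f x *m g x).
Proof.
move=> oA sf sg; apply: sm_mx => // i j.
under eq_fun do rewrite mxE.
by apply: sm_sum => // k _; apply: sm_mul => //; exact: sm_entry.
Qed.

Lemma sm_trmx V m n (A : set V) (f : V -> 'M[R]_(m, n)) :
  open A -> smooth_on A f -> smooth_on A (fun x => (f x)^T).
Proof.
by move=> oA sf; apply: sm_mx => // i j; under eq_fun do rewrite mxE; exact: sm_entry.
Qed.

Lemma sm_det V n (A : set V) (f : V -> 'M[R]_n) :
  open A -> smooth_on A f -> smooth_on A (fun x => \det (f x)).
Proof.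
move=> oA sf; apply: sm_sum => // s _; apply: sm_mul => //; first exact: sm_cst.
by apply: sm_prod => // i _; exact: sm_entry.
Qed.

(** By Cramer's formula the inverse is the adjugate, polynomial in the entries, divided by the
    determinant. *)
Lemma sm_invmx V n (A : set V) (f : V -> 'M[R]_n) : open A ->
  (forall x, A x -> f x \in unitmx) -> smooth_on A f ->
  smooth_on A (fun x => invmx (f x)).
Proof.
move=> oA uf sf.
apply: (@sm_ext _ _ _ (fun x => (\det (f x))^-1 *: \adj (f x))) => //.
  by move=> x Ax; rewrite /invmx uf.
apply: sm_scale => //.
  apply: sm_inv => //; last exact: sm_det.
  by move=> x /uf; rewrite unitmxE unitfE.
apply: sm_mx => // i j; under eq_fun do rewrite mxE /cofactor.
apply: sm_mul => //; first exact: sm_cst.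
apply: sm_det => //; apply: sm_mx => // k l; under eq_fun do rewrite !mxE.
exact: sm_entry.
Qed.

Lemma sm_block V m1 m2 n1 n2 (A : set V) (a : V -> 'M[R]_(m1, n1))
    (b : V -> 'M[R]_(m1, n2)) (c : V -> 'M[R]_(m2, n1)) (d : V -> 'M[R]_(m2, n2)) :
  open A -> smooth_on A a -> smooth_on A b -> smooth_on A c -> smooth_on A d ->
  smooth_on A (fun x => block_mx (a x) (b x) (c x) (d x)).
Proof.
move=> oA sa sb sc sd; apply: sm_mx => // i j.
case: (split_ordP i) => i' ->; case: (split_ordP j) => j' ->.
- by under eq_fun do rewrite block_mxEul; exact: sm_entry.
- by under eq_fun do rewrite block_mxEur; exact: sm_entry.
- by under eq_fun do rewrite block_mxEdl; exact: sm_entry.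
- by under eq_fun do rewrite block_mxEdr; exact: sm_entry.
Qed.

Lemma sm_lsubmx V m n1 n2 (A : set V) (f : V -> 'M[R]_(m, n1 + n2)) : open A ->
  smooth_on A f -> smooth_on A (fun x => lsubmx (f x)).
Proof.
by move=> oA sf; apply: sm_mx => // i j; under eq_fun do rewrite mxE; exact: sm_entry.
Qed.

Lemma sm_row0 V m n1 n2 (A : set V) (f : V -> 'M[R]_(m, n1)) : open A ->
  smooth_on A f -> smooth_on A (fun x => row_mx (f x) (0 : 'M[R]_(m, n2))).
Proof.
move=> oA sf; apply: sm_mx => // i j; case: (split_ordP j) => j' ->.
- by under eq_fun do rewrite row_mxEl; exact: sm_entry.
- by under eq_fun do rewrite row_mxEr mxE; exact: sm_cst.
Qed.

Lemma derive_entry V m n (f : V -> 'M[R]_(m, n)) x v i j : differentiable f x ->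
  'D_v (fun x => f x i j) x = ('D_v f x) i j.
Proof.
move=> df; have c := @mxcoord_continuous m n i j.
have := derive_comp v df (@differentiable_lin _ _ _ (mxcoord i j) (f x) c).
by rewrite derive_lin.
Qed.

End Smooth.

(** * Symmetry of second derivatives *)

Section Schwarz.
Context {R : realType} {V : normedModType R}.
Variables (f : V -> R) (x : V).

Lemma derive_line (g : V -> R) (y u : V) (s : R) : differentiable g (y + s *: u) ->
  is_derive s (1 : R) (fun s => g (y + s *: u)) ('D_u g (y + s *: u)).
Proof.
move=> dg.
have dl : differentiable (fun s : R => y + s *: u) s.
  apply: differentiableD; first exact: differentiable_cst.
  by apply: differentiableZl.
have E : 'D_1 (fun s : R => y + s *: u) s = u.
  rewrite deriveD//; last by apply: diff_derivable; apply: differentiableZl.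
  rewrite derive_cst add0r.
  have [|_ ->] := @dscaleM R R V (fun s => s) (fun _ => u) s _ (differentiable_cst u s) => //.
  by rewrite derive_id derive_cst scaler0 addr0 scale1r.
have D := differentiable_comp dl dg.
have X : derivable (g \o (fun s : R => y + s *: u)) s 1 := diff_derivable D.
have /derivableP := X.
by rewrite (derive_comp _ dl dg) E.
Qed.

(** The mean value theorem for s |-> f (x + t v + s u) - f (x + s u) turns the second difference
    into t times a difference of two values of ['D_u f]. Differentiability of ['D_u f] at x alone
    then controls both values up to o(t). *)
Lemma second_difference (u v : V) :
  (\forall y \near x, differentiable f y) -> differentiable ('D_u f) x ->
  forall e : R, 0 < e -> exists2 d : R, 0 < d & forall t : R, 0 < t < d ->
  `|f (x + t *: u + t *: v) - f (x + t *: u) - f (x + t *: v) + f x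
     - t ^+ 2 * 'D_v ('D_u f) x| <= e * t ^+ 2.
Proof.
move=> df dDf e e0.
(* For 0 <= s, r <= t the vector s u + r v has norm at most t N / 2, so an error e / N per unit of
   length costs at most e t / 2; the summand 1 keeps N positive. *)
pose N := 2 * (`|u| + `|v| + 1).
have N0 : 0 < N by rewrite /N mulr_gt0 // ltr_wpDl // addr_ge0.
have /nbhs_normP[d0 /= d00 Hd0] := df.
have /nbhs_normP[d1 /= d10 Hd1] := diff_eps dDf (divr_gt0 e0 N0).
exists (Num.min d0 d1 / N); first by rewrite divr_gt0 // lt_min d00.
move=> t /andP[t0]; rewrite ltr_pdivlMr // lt_min => /andP[tN0 tN1].
have small s r : 0 <= s <= t -> 0 <= r <= t -> `|s *: u + r *: v| <= t * (N / 2).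
  move=> /andP[s0 st] /andP[r0 rt]; rewrite (le_trans (ler_normD _ _)) // !normrZ.
  rewrite !ger0_norm //.
  have : s * `|u| <= t * `|u| by rewrite ler_wpM2r.
  have : r * `|v| <= t * `|v| by rewrite ler_wpM2r.
  rewrite /N; move: (normr_ge0 u) (normr_ge0 v); nra.
have small' s r : 0 <= s <= t -> 0 <= r <= t -> `|s *: u + r *: v| < t * N.
  move=> hs hr; apply: le_lt_trans (small _ _ hs hr) _; nra.
have dfl s r : 0 <= s <= t -> 0 <= r <= t -> differentiable f (x + s *: u + r *: v).
  move=> hs hr; apply: Hd0; rewrite /= -addrA opprD addNKr normrN.
  exact: lt_trans (small' _ _ hs hr) tN0.
have D2 s r : 0 <= s <= t -> 0 <= r <= t ->
   `|'D_u f (x + s *: u + r *: v) - 'D_u f x - 'd ('D_u f) x (s *: u + r *: v)| <= e / 2 * t.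
  move=> hs hr; have := Hd1 (s *: u + r *: v).
  rewrite /= sub0r normrN => /(_ (lt_trans (small' _ _ hs hr) tN1)).
  rewrite (addrC _ x) addrA => /le_trans; apply.
  have -> : e / 2 * t = e / N * (t * (N / 2)).
    by field; rewrite gt_eqF.
  by rewrite ler_wpM2l ?small// divr_ge0 // ltW.
pose phi (s : R) : R := f (x + t *: v + s *: u) - f (x + s *: u).
have tt : 0 <= t <= t by rewrite lexx ltW.
have zt : 0 <= (0 : R) <= t by rewrite lexx ltW.
have dphi s : 0 <= s <= t -> is_derive s (1 : R) phi
    ('D_u f (x + t *: v + s *: u) - 'D_u f (x + s *: u)).
  move=> hs; apply: is_deriveB; apply: derive_line.
    by rewrite addrAC; apply: dfl.
  by have := dfl s 0 hs zt; rewrite scale0r addr0.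
have hd s : s \in `]0, t[ -> is_derive s (1 : R) phi
    ('D_u f (x + t *: v + s *: u) - 'D_u f (x + s *: u)).
  by rewrite in_itv /= => /andP[/ltW s0 /ltW s1]; apply: dphi; rewrite s0.
have hc : {within `[0, t], continuous phi}.
  apply: derivable_within_continuous => s; rewrite in_itv /= => hs.
  by have := dphi s hs => -[].
have [c] := MVT_segment (ltW t0) hd hc.
rewrite in_itv /= subr0 => ct E.
have -> : f (x + t *: u + t *: v) - f (x + t *: u) - f (x + t *: v) + f x = phi t - phi 0.
  rewrite /phi !scale0r !addr0 (addrAC x). 
  ring.
rewrite E.
have := D2 c t ct tt; have := D2 c 0 ct zt.
rewrite scale0r !addr0 (addrAC x) (linearD ('d ('D_u f) x)) (linearZ_LR ('d ('D_u f) x) t) /=.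
rewrite -(deriveE v dDf).
move: ('D_u f (x + c *: u)) ('D_u f (x + t *: v + c *: u)) ('D_v ('D_u f) x) ('D_u f x) ('d ('D_u f) x (c *: u)) => a b D a0 l.
have -> : t *: D = t * D by [].
move=> h1 h2.
have h3 : `|b - a - t * D| <= e * t.
  have -> : b - a - t * D = (b - a0 - (l + t * D)) - (a - a0 - l) by ring.
  apply: le_trans (ler_normB _ _) _.
  by apply: le_trans (lerD h2 h1) _; rewrite -mulrDl -splitr.
have -> : (b - a) * t - t ^+ 2 * D = (b - a - t * D) * t by ring.
rewrite normrM (ger0_norm (ltW t0)) expr2 mulrA ler_wpM2r //; exact: ltW.
Qed.

End Schwarz.

(** The second difference is symmetric in u and v, and divided by t^2 it tends to either mixed
    derivative. *)
Lemma schwarz {R : realType} {V : normedModType R} (U : set V) (f : V -> R) u v x :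
  open U -> U x -> Ck 2 U f -> 'D_u ('D_v f) x = 'D_v ('D_u f) x.
Proof.
move=> oU Ux [df cf].
have near_df : \forall y \near x, differentiable f y.
  by have := open_nbhs_nbhs (conj oU Ux); apply: filterS.
have d2 w : differentiable ('D_w f) x by have [+ _] := cf w; apply.
have H (e : R) : 0 < e -> `|'D_u ('D_v f) x - 'D_v ('D_u f) x| <= e.
  move=> e0; have e20 : 0 < e / 2 by rewrite divr_gt0.
  have [d d0 H1] := second_difference v near_df (d2 u) e20.
  have [d' d'0 H2] := second_difference u near_df (d2 v) e20.
  pose t := Num.min d d' / 2.
  have t0 : 0 < t by rewrite divr_gt0 // lt_min d0.
  have td : 0 < t < d.
    by rewrite t0 /= /t ltr_pdivrMr // gt_min; apply/orP; left; lra.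
  have td' : 0 < t < d'.
    by rewrite t0 /= /t ltr_pdivrMr // gt_min; apply/orP; right; lra.
  have := H1 t td; have := H2 t td'; rewrite (addrAC x (t *: v)).
  move: (f _) (f (x + t *: v)) (f (x + t *: u)) (f x) => a b c z.
  have t2 : 0 < t ^+ 2 by rewrite exprn_gt0.
  move: ('D_u _ x) ('D_v _ x) => A B; move: (t ^+ 2) t2 => T T0.
  rewrite !ler_norml => /andP[h1 h2] /andP[h3 h4]; apply/andP; split; nra.
apply/eqP; rewrite -subr_eq0 -normr_eq0 eq_le normr_ge0 andbT.
by apply/ler_addgt0Pl => e e0; rewrite addr0; exact: H.
Qed.

(** Banach's fixed point theorem, used next, needs row vectors to be complete as a normed module. *)
HB.instance Definition _ (R : realType) m n := Complete.copy 'M[R]_(m, n) 'M[R]_(m, n).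

(** * Curves in level sets *)

Section ImplicitCurve.
Context {R : realType} {n : nat}.
Local Notation E := 'rV[R]_n.

(** The first hypothesis makes c |-> c - Psi t c a contraction of factor 1/2 on a small ball, whose
    fixed points are zeros of Psi t. They satisfy |c| <= 2 |Psi t 0| = o(t), so the zeros may be
    picked by choice: this bound alone gives continuity and zero derivative at 0, and no regularity
    elsewhere is claimed. *)
Lemma implicit_curve (Psi : R -> E -> E) :
  (forall e : R, 0 < e -> exists2 d : R, 0 < d &
     forall t c c', `|t| < d -> `|c| <= d -> `|c'| <= d ->
     `|Psi t c - Psi t c' - (c - c')| <= e * `|c - c'|) ->
  (forall e : R, 0 < e -> \forall t \near (0 : R), `|Psi t 0| <= e * `|t|) ->
  exists c : R -> E, [/\ c 0 = 0, is_derive (0 : R) (1 : R) c 0,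
    {for 0, continuous c} & \forall t \near (0 : R), Psi t (c t) = 0].
Proof.
move=> H1 H2.
have [d d0 Hd] := H1 2^-1 ltac:(by []).
(* With |Psi t 0| <= d / 2 and contraction factor 1/2 the ball of radius d is mapped into itself. *)
have [d2 /= d20 Hd2] := (nbhs_normP _ _).1 (H2 (d / 2) ltac:(by rewrite divr_gt0)).
pose d' := Num.min d (Num.min d2 1).
have d'0 : 0 < d' by rewrite !lt_min d0 d20 /=.
have ex t : `|t| < d' -> exists c, Psi t c = 0 /\ `|c| <= 2 * `|Psi t 0|.
  rewrite !lt_min => /and3P[td td2 t1].
  have P0 : `|Psi t 0| <= d / 2.
    have /= := Hd2 t; rewrite sub0r normrN => /(_ td2) /le_trans; apply.
    by rewrite -[leRHS]mulr1 ler_wpM2l ?divr_ge0 ?ltW.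
  pose Nf (c : E) := c - Psi t c.
  have ctr c c' : `|c| <= d -> `|c'| <= d -> `|Nf c - Nf c'| <= 2^-1 * `|c - c'|.
    move=> hc hc'; have := Hd t c c' td hc hc'.
    suff -> : Nf c - Nf c' = - (Psi t c - Psi t c' - (c - c')) by rewrite normrN.
    by apply/rowP => j; rewrite /Nf !mxE; ring.
  pose U : set E := [set c | `|c| <= d].
  have fU c : U c -> U (Nf c).
    move=> Uc; have := ctr c 0 Uc; rewrite normr0 (ltW d0) => /(_ isT).
    rewrite /Nf !sub0r opprK subr0 => h; rewrite /U /=.
    have -> : c - Psi t c = c - Psi t c + Psi t 0 - Psi t 0 by rewrite addrK.
    rewrite (le_trans (ler_normB _ _)) // [leRHS]splitr lerD //.
    by apply: le_trans h _; rewrite mulrC ler_wpM2r.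
  pose FM := isFun.Build E E U U Nf fU.
  pose F : {fun U >-> U} := HB.pack Nf FM.
  have cF : is_contraction F.
    exists (2^-1)%:nng; split; first by rewrite /=; lra.
    by move=> [c c'] /= [hc hc']; exact: ctr.
  have clU : closed U.
    have -> : U = (fun c : E => `|c|) @^-1` [set r | r <= d] by [].
    apply: closed_comp; last exact: closed_le.
    by move=> c _; apply: norm_continuous.
  have [|c Uc Ec] := banach_fixed_point cF clU.
    by exists 0; rewrite /U /= normr0 ltW.
  have Pc : Psi t c = 0.
    move: Ec; rewrite /F /= /Nf => Ec; apply/eqP; rewrite -oppr_eq0; apply/eqP.
    by apply: (addrI c); rewrite addr0 -Ec.
  exists c; split=> //.
  have := Hd t c 0 td Uc; rewrite normr0 (ltW d0) Pc => /(_ isT).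
  rewrite sub0r subr0 => h.
  have : `|c| <= `|Psi t 0| + `|- Psi t 0 - c|.
    have := ler_normB (- Psi t 0) (- Psi t 0 - c).
    by rewrite normrN opprB addrC subrK.
  move: h; move: (`|c|) (`|Psi t 0|) (`|- Psi t 0 - c|) => A B C; lra.
have /choice[c Hc] : forall t, exists c, `|t| < d' -> Psi t c = 0 /\ `|c| <= 2 * `|Psi t 0|.
  move=> t; have [/ex[c Hc]|h] := ltP `|t| d'; first by exists c.
  by exists 0.
have c0 : c 0 = 0.
  have [_] := Hc 0 ltac:(by rewrite normr0).
  have := nbhs_singleton (H2 1 ltr01); rewrite normr0 mulr0 => h.
  have -> : `|Psi 0 0| = 0 by apply/eqP; rewrite eq_le h normr_ge0.
  by rewrite mulr0 normr_le0 => /eqP.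
have near0 : \forall t \near (0 : R), `|t| < d'.
  by apply/nbhs_normP; exists d' => //= t; rewrite /= sub0r normrN.
pose dz : {linear R -> E} := (\0 : {linear R -> E}).
have [dc Ed] : differentiable c (0 : R) /\ 'd c (0 : R) = dz :> (R -> E).
  apply: diff_epsP; first exact: cst_continuous.
  move=> e e0; have := H2 (e / 2) ltac:(by rewrite divr_gt0).
  apply: filterS2 near0 => t /Hc[_ h1] h2.
  rewrite addr0 c0 !subr0; apply: le_trans h1 _.
  by move: h2; move: (`|Psi t 0|) (`|t|) => a b; lra.
exists c; split => //.
- have X : derivable c (0 : R) 1 := diff_derivable dc.
  have := derivableP X.
  by rewrite (deriveE _ dc) Ed.
- exact: differentiable_continuous.
- by apply: filterS near0 => t /Hc[].
Qed.

End ImplicitCurve.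

Section MxNorm.
Context {R : realType}.

Lemma mx_entry_norm m n (M : 'M[R]_(m, n)) i j : `|M i j| <= `|M|.
Proof.
rewrite [leRHS]/Num.Def.normr /= mx_normrE.
exact: (le_bigmax_cond _ (fun ij : 'I_m * 'I_n => `|M ij.1 ij.2|) (j := (i, j))).
Qed.

Lemma mx_norm_le m n (M : 'M[R]_(m, n)) (a : R) : 0 <= a ->
  (forall i j, `|M i j| <= a) -> `|M| <= a.
Proof.
move=> a0 h; rewrite [leLHS]/Num.Def.normr /= mx_normrE.
by apply: bigmax_le => // -[i j] _; exact: h.
Qed.

End MxNorm.

Section LevelCurve.
Context {R : realType} {V : normedModType R} {n : nat}.
Local Notation E := 'rV[R]_n.
Variables (U : set V) (x : V) (io : {linear E -> V}).
Hypotheses (oU : open U) (Ux : U x) (cio : continuous io).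

(** Strict differentiability along the image of io: by the mean value theorem the increment is a
    derivative at a point of the segment, and the finitely many partial derivatives along the basis
    are uniformly close to their values at x. *)
Lemma strong_diff (f : V -> R) : Ck 1 U f ->
  forall e : R, 0 < e -> exists2 d : R, 0 < d & forall a (c c' : E),
    `|a| < d -> `|c| <= d -> `|c'| <= d ->
    `|f (x + a + io c) - f (x + a + io c') - 'D_(io (c - c')) f x| <= e * `|c - c'|.
Proof.
move=> [df cf] e e0.
have [K K0 HK] := linear_lipschitz cio.
(* The n coordinates each contribute e1; dividing by n + 1 also covers n = 0. *)
pose e1 := e / n.+1%:R.
have e10 : 0 < e1 by rewrite divr_gt0.
have nU : \forall y \near x, U y by exact: open_nbhs_nbhs.
have nD : \forall y \near x, forall j : 'I_n,
   `|'D_(io (delta_mx 0 j)) f x - 'D_(io (delta_mx 0 j)) f y| <= e1.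
  apply: filter_forall => j; have := cf (io (delta_mx 0 j)) x Ux.
  by move=> /cvgrPdist_le; apply.
have [r /= r0 Hr] := (nbhs_normP _ _).1 (filterI nU nD).
(* With K a Lipschitz constant of io, points of the segment differ from x by a, by io c' and by a
   part of io (c - c'), of norms below d, at most K d and at most 2 K d. *)
have D0 : 0 < r / (1 + 3 * K) by rewrite divr_gt0 // addr_gt0 // mulr_gt0.
exists (r / (1 + 3 * K)) => // a c c'.
set d := r / _ in D0 *; move=> ha hc hc'.
have dr : d * (1 + 3 * K) = r by rewrite /d divfK // gt_eqF // addr_gt0 // mulr_gt0.
pose w := io (c - c').
have near_y (s : R) : 0 <= s <= 1 -> `|x - (x + a + io c' + s *: w)| < r.
  move=> /andP[s0 s1]; rewrite -!addrA opprD addNKr normrN -dr mulrDr mulr1.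
  apply: le_lt_trans (ler_normD _ _) _; rewrite ltr_leD //.
  apply: le_trans (ler_normD _ _) _; rewrite normrZ ger0_norm //.
  have h1 : `|io c'| <= K * d by apply: le_trans (HK _) _; rewrite ler_wpM2l // ltW.
  have h2 : `|w| <= K * (2 * d).
    apply: le_trans (HK _) _; rewrite ler_wpM2l ?(ltW K0) //.
    by apply: le_trans (ler_normB _ _) _; rewrite mulr2n mulrDl !mul1r lerD.
  have h3 : s * `|w| <= `|w| by rewrite ler_piMl.
  apply: le_trans (lerD h1 (le_trans h3 h2)) _.
  by rewrite le_eqVlt; apply/orP; left; apply/eqP; ring.
pose g (s : R) := f (x + a + io c' + s *: w).
have dg (s : R) : 0 <= s <= 1 -> is_derive s (1 : R) g ('D_w f (x + a + io c' + s *: w)).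
  by move=> /near_y /Hr [Uy _]; apply: derive_line; exact: df.
have hd (s : R) : s \in `]0, 1[ -> is_derive s (1 : R) g ('D_w f (x + a + io c' + s *: w)).
  by rewrite in_itv /= => /andP[/ltW s0 /ltW s1]; apply: dg; rewrite s0.
have hcont : {within `[0, 1], continuous g}.
  apply: derivable_within_continuous => s; rewrite in_itv /= => hs.
  by have := dg s hs => -[].
have [s] := MVT_segment ler01 hd hcont.
rewrite in_itv /= => hs; rewrite subr0 mulr1.
have -> : g 1 = f (x + a + io c).
  by rewrite /g scale1r /w linearB /= -addrA (addrC (io c')) subrK.
have -> : g 0 = f (x + a + io c') by rewrite /g scale0r addr0.
move=> ->; have [Uy Hy] := Hr _ (near_y s hs).
set y := x + a + io c' + s *: w in Uy Hy *.
have Ew z : U z -> 'D_w f z = \sum_j (c - c') 0 j * 'D_(io (delta_mx 0 j)) f z.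
  move=> Uz; rewrite {1}/w {1}[c - c']row_sum_delta linear_sum (derive_sumr _ _ _ (df z Uz)).
  by apply: eq_bigr => j _; rewrite linearZ /= (deriveZr _ _ (df z Uz)).
rewrite -/w !Ew // -sumrB; apply: le_trans (ler_norm_sum _ _ _) _.
have : \sum_(j < n) `|(c - c') 0 j * 'D_(io (delta_mx 0 j)) f y
    - (c - c') 0 j * 'D_(io (delta_mx 0 j)) f x| <= \sum_(j < n) (`|c - c'| * e1).
  apply: ler_sum => j _; rewrite -mulrBr normrM ler_pM //.
    exact: mx_entry_norm.
  by rewrite distrC; exact: Hy.
move=> /le_trans; apply.
rewrite sumr_const card_ord -mulrnAr (mulrC e) ler_wpM2l //.
rewrite -mulr_natr /e1 mulrAC ler_pdivrMr // ler_wpM2l ?(ltW e0) //.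
by rewrite ler_nat.
Qed.

(** Phi takes its values in the image of the projection Pi and has derivative Pi along io. Adding c
    - Pi c makes the derivative in c the identity, as [implicit_curve] requires; applying Pi to the
    resulting equation removes the added term again. *)
Lemma level_curve (Phi : V -> E) (Pi : {linear E -> E}) (xi : V) :
  (forall i, Ck 1 U (fun z => Phi z 0 i)) -> (forall c, Pi (Pi c) = Pi c) ->
  (forall z, U z -> Pi (Phi z) = Phi z) -> Phi x = 0 ->
  (forall c, 'D_(io c) Phi x = Pi c) -> 'D_xi Phi x = 0 ->
  exists c : R -> E, [/\ c 0 = 0, is_derive (0 : R) (1 : R) c 0 &
    \forall t \near (0 : R), U (x + t *: xi + io (c t)) /\ Phi (x + t *: xi + io (c t)) = 0].
Proof.
move=> cPhi PiPi PiPhi Phix DPhi Dxi.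
have dPhi : differentiable Phi x.
  have -> : Phi = (fun z => \sum_j Phi z 0 j *: delta_mx 0 j).
    by apply/funext => z; exact: row_sum_delta.
  rewrite -(fct_sumE _ xpredT (fun j z => Phi z 0 j *: (delta_mx 0 j : E))).
  apply: differentiable_sum => j.
  have [dj _] := cPhi j.
  exact: (proj1 (dscaleM (dj x Ux) (differentiable_cst (delta_mx 0 j : E) x))).
pose Psi (t : R) (c : E) : E := Phi (x + t *: xi + io c) + (c - Pi c).
have [||c [c0 dc cc Hc]] := @implicit_curve R n Psi.
- move=> e e0.
  have Hd (j : 'I_n) : exists d : R, 0 < d /\ forall a (c c' : E),
    `|a| < d -> `|c| <= d -> `|c'| <= d ->
    `|Phi (x + a + io c) 0 j - Phi (x + a + io c') 0 j - (Pi (c - c')) 0 j| <= e * `|c - c'|.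
    have [d d0 H] := strong_diff (cPhi j) e0.
    exists d; split=> // a c c' ha hc hc'; have := H a c c' ha hc hc'.
    by rewrite derive_entry // DPhi.
  have /choice[d Hd'] := Hd.
  pose d1 := \big[Num.min/1]_(j < n) d j.
  have d10 : 0 < d1 by apply: lt_bigmin => // j _; have [] := Hd' j.
  have K0 : 0 < 1 + `|xi| by rewrite ltr_wpDr.
  pose d2 := Num.min d1 (d1 / (1 + `|xi|)).
  have d20 : 0 < d2 by rewrite lt_min d10 divr_gt0.
  exists d2 => // t c c'; rewrite lt_min !le_min => /andP[t1 t2] /andP[c1 _] /andP[c'1 _].
  apply: mx_norm_le; first by rewrite mulr_ge0 // ltW.
  move=> i j; rewrite (ord1 i).
  have dj : d1 <= d j by exact: bigmin_le.
  have [dj0 H] := Hd' j.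
  have := H (t *: xi) c c'; rewrite /Psi !mxE.
  have -> : `|t *: xi| < d j.
    apply: lt_le_trans dj; rewrite normrZ.
    have : `|t| * (1 + `|xi|) < d1 by rewrite -ltr_pdivlMr.
    by apply: le_lt_trans; rewrite ler_wpM2l // lerDr.
  move=> /(_ isT (le_trans c1 dj) (le_trans c'1 dj)).
  rewrite linearB !mxE; congr (`|_| <= _); ring.
- move=> e e0; have K0 : 0 < 1 + `|xi| by rewrite ltr_wpDr.
  have He := diff_eps dPhi (divr_gt0 e0 K0).
  have ct : (fun t : R => t *: xi) @ (0 : R) --> (0 : V).
    rewrite -[X in _ --> X](scale0r xi).
    by apply: continuousZr_tmp; exact: cvg_id.
  have : \forall t \near (0 : R), `|Phi (t *: xi + x) - Phi x - 'd Phi x (t *: xi)|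
      <= e / (1 + `|xi|) * `|t *: xi| := ct _ He.
  apply: filterS => t.
  rewrite Phix subr0 linearZ /= -(deriveE _ dPhi) Dxi scaler0 subr0 addrC.
  rewrite /Psi !linear0 !addr0 => /le_trans; apply.
  have -> : e / (1 + `|xi|) * `|t *: xi| = e * `|t| * (`|xi| / (1 + `|xi|)).
    by rewrite normrZ; ring.
  rewrite ler_piMr ?mulr_ge0 ?(ltW e0) // ler_pdivrMr // mul1r.
  by rewrite lerDr.
exists c; split=> //.
have cioc : {for (0 : R), continuous (io \o c)} by apply: continuous_comp; [exact: cc|exact: cio].
have cz : (fun t : R => x + t *: xi + io (c t)) @ (0 : R) --> x.
  have -> : nbhs x = nbhs (x + 0 *: xi + io (c 0)) by rewrite c0 linear0 scale0r !addr0.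
  apply: cvgD; first apply: cvgD.
  - exact: cvg_cst.
  - by apply: continuousZr_tmp; exact: cvg_id.
  - exact: cioc.
have nU : \forall t \near (0 : R), U (x + t *: xi + io (c t)).
  by apply: cz; exact: open_nbhs_nbhs.
apply: filterS2 nU Hc => t Ut Pt; split => //.
have : Pi (Psi t (c t)) = 0 by rewrite Pt linear0.
by rewrite /Psi linearD linearB /= PiPi subrr addr0 PiPhi.
Qed.

Lemma level_vanish (W : normedModType R) (F : V -> W) (Phi : V -> E) (Pi : {linear E -> E}) (xi : V) :
  (forall i, Ck 1 U (fun z => Phi z 0 i)) -> (forall c, Pi (Pi c) = Pi c) ->
  (forall z, U z -> Pi (Phi z) = Phi z) -> Phi x = 0 ->
  (forall c, 'D_(io c) Phi x = Pi c) -> 'D_xi Phi x = 0 ->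
  differentiable F x -> (forall z, U z -> Phi z = 0 -> F z = 0) ->
  'D_xi F x = 0.
Proof.
move=> h1 h2 h3 h4 h5 h6 dF F0.
have [c [c0 dc Hc]] := level_curve h1 h2 h3 h4 h5 h6.
pose z (t : R) := x + t *: xi + io (c t).
have z0 : z 0 = x by rewrite /z c0 linear0 scale0r !addr0.
have dcd : differentiable c (0 : R) by apply/derivable1_diffP; case: dc.
have d1 : differentiable (fun t : R => x + t *: xi) (0 : R).
  apply: differentiableD; first exact: differentiable_cst.
  exact: differentiableZl.
have d2 : differentiable (io \o c) (0 : R).
  apply: differentiable_comp => //; exact: differentiable_lin.
have dz : differentiable z (0 : R) by exact: differentiableD.
have E : 'D_1 z (0 : R) = xi.
  rewrite (@deriveD _ _ _ _ _ _ _ (diff_derivable d1) (diff_derivable d2)).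
  rewrite (derive_comp _ dcd (@differentiable_lin _ _ _ io _ cio)).
  have -> : 'D_1 c (0 : R) = 0 by case: dc.
  rewrite derive0 addr0 deriveD; [|exact: derivable_cst|exact/diff_derivable/differentiableZl].
  rewrite derive_cst add0r.
  have [|_ ->] := @dscaleM R R V (fun s => s) (fun _ => xi) 0 _ (differentiable_cst xi (0 : R)) => //.
  by rewrite derive_id derive_cst scaler0 addr0 scale1r.
have dFz : differentiable F (z 0) by rewrite z0.
have := derive_comp (1 : R) dz dFz; rewrite E z0 => <-.
rewrite (@near_eq_derive _ _ _ _ (fun _ => 0) (0 : R)) ?derive_cst //.
by apply: filterS Hc => t [Ut Pt]; exact: F0.
Qed.

End LevelCurve.

(** * Linear and bilinear maps depending smoothly on a parameter *)

Section Families.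
Context {R : realType}.

(** Smoothness for each fixed argument suffices: expanding the argument over the standard basis
    gives joint smoothness, see [sm_fam]. *)
Definition slin (Z W : normedModType R) n (Om : set Z) (B : Z -> 'rV[R]_n -> W) :=
  (forall z, Om z -> linear (B z)) /\ forall e, smooth_on Om (B ^~ e).

Lemma lin_D (V W : lmodType R) (f : V -> W) : linear f -> {morph f : u v / u + v}.
Proof. by move=> l u v; have := l 1 u v; rewrite !scale1r. Qed.
Lemma lin_0 (V W : lmodType R) (f : V -> W) : linear f -> f 0 = 0.
Proof. by move=> l; have := l (-1) 0 0; rewrite addr0 !scaleN1r oppr0 addNr. Qed.
Lemma lin_Z (V W : lmodType R) (f : V -> W) : linear f -> forall a u, f (a *: u) = a *: f u.
Proof. by move=> l a u; have := l a u 0; rewrite (lin_0 l) !addr0. Qed.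
Lemma lin_N (V W : lmodType R) (f : V -> W) : linear f -> {morph f : u / - u}.
Proof. by move=> l u; rewrite -scaleN1r (lin_Z l) scaleN1r. Qed.
Lemma lin_B (V W : lmodType R) (f : V -> W) : linear f -> {morph f : u v / u - v}.
Proof. by move=> l u v; rewrite (lin_D l) (lin_N l). Qed.
Lemma lin_sum (V W : lmodType R) (f : V -> W) (I : Type) (r : seq I) (P : pred I) (F : I -> V) :
  linear f -> f (\sum_(i <- r | P i) F i) = \sum_(i <- r | P i) f (F i).
Proof. by move=> l; apply: (big_morph f (lin_D l) (lin_0 l)). Qed.
Lemma lin_delta (W : lmodType R) n (f : 'rV[R]_n -> W) e : linear f ->
  f e = \sum_j e 0 j *: f (delta_mx 0 j).
Proof.
by move=> l; rewrite {1}[e]row_sum_delta (lin_sum _ _ _ l); apply: eq_bigr => j _; rewrite (lin_Z l).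
Qed.

(** Over the standard basis the family is a finite sum of coordinates of e times functions of z, and
    the product rule applies to each summand. *)
Lemma fam_derive (X Z W : normedModType R) n (Om : set Z) (B : Z -> 'rV[R]_n -> W)
    (z : X -> Z) (e : X -> 'rV[R]_n) x : open Om ->
  (forall z, Om z -> linear (B z)) -> Om (z x) ->
  (forall e, differentiable (B ^~ e) (z x)) ->
  differentiable z x -> differentiable e x ->
  differentiable (fun x => B (z x) (e x)) x /\
  forall u, 'D_u (fun x => B (z x) (e x)) x =
    'D_('D_u z x) (B ^~ (e x)) (z x) + B (z x) ('D_u e x).
Proof.
move=> oOm lB Oz dB dz de.
pose G := \sum_(j < n) (fun x => e x 0 j *: B (z x) (delta_mx 0 j)).
have GE y : G y = \sum_j e y 0 j *: B (z y) (delta_mx 0 j) by rewrite /G fct_sumE.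
have nE : \forall y \near x, G y = B (z y) (e y).
  have : \forall y \near x, Om (z y).
    by apply: (differentiable_continuous dz); exact: open_nbhs_nbhs.
  by apply: filterS => y Oy; rewrite GE [RHS](lin_delta _ (lB _ Oy)).
have dej j : differentiable (fun x => e x 0 j) x.
  exact: (differentiable_comp de (@differentiable_lin _ _ _ (mxcoord 0 j) _ (@mxcoord_continuous R 1 n 0 j))).
have dBj j : differentiable (fun x => B (z x) (delta_mx 0 j)) x.
  exact: (differentiable_comp dz (dB (delta_mx 0 j))).
have dG : differentiable G x.
  by apply: differentiable_sum => j; exact: (proj1 (dscaleM (dej j) (dBj j))).
have [dBe _] := near_eq_diff nE dG.
split=> // u; rewrite -(near_eq_derive u nE) /G derive_sum; last first.
  by move=> j; apply: diff_derivable; exact: (proj1 (dscaleM (dej j) (dBj j))).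
have H j : 'D_u (fun x => e x 0 j *: B (z x) (delta_mx 0 j)) x =
    ('D_u e x) 0 j *: B (z x) (delta_mx 0 j) +
    e x 0 j *: 'D_('D_u z x) (B ^~ (delta_mx 0 j)) (z x).
  rewrite (proj2 (dscaleM (dej j) (dBj j))) derive_entry //; congr (_ + _ *: _).
  exact: (derive_comp u dz (dB (delta_mx 0 j))).
rewrite (eq_bigr _ (fun j _ => H j)) big_split /= addrC; congr (_ + _); last first.
  by rewrite [RHS](lin_delta _ (lB _ Oz)).
have nE' : \forall y \near z x, (\sum_j (fun y => e x 0 j *: B y (delta_mx 0 j))) y = B y (e x).
  have : \forall y \near z x, Om y by exact: open_nbhs_nbhs.
  by apply: filterS => y Oy; rewrite fct_sumE [RHS](lin_delta _ (lB _ Oy)).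
rewrite -(near_eq_derive _ nE') derive_sum; last first.
  move=> j; apply: diff_derivable.
  exact: (proj1 (dscaleM (differentiable_cst (e x 0 j) _) (dB (delta_mx 0 j)))).
apply: eq_bigr => j _.
have [_ ->] := dscaleM (differentiable_cst (e x 0 j) (z x)) (dB (delta_mx 0 j)).
by rewrite derive_cst scale0r add0r.
Qed.

Lemma sm_fam (X Z W : normedModType R) n (A : set X) (Om : set Z) (B : Z -> 'rV[R]_n -> W)
    (z : X -> Z) (e : X -> 'rV[R]_n) : finite_dim Z -> open A -> open Om ->
  slin Om B -> (forall x, A x -> Om (z x)) -> smooth_on A z -> smooth_on A e ->
  smooth_on A (fun x => B (z x) (e x)).
Proof.
move=> fZ oA oOm [lB sB] AO sz se.
apply: (@sm_ext _ _ _ _ (fun x => \sum_j e x 0 j *: B (z x) (delta_mx 0 j))) => //.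
  by move=> x /AO Ox; rewrite [RHS](lin_delta _ (lB _ Ox)).
apply: sm_sum => // j _; apply: sm_scale => //; first exact: sm_entry.
exact: (sm_comp fZ oA oOm AO (sB (delta_mx 0 j)) sz).
Qed.

End Families.

(* Sealed, since unifying two mismatched nested derivatives unfolds limits. *)
HB.lock Definition dv {R : realType} {V W : normedModType R} (f : V -> W) (x v : V) : W :=
  'D_v f x.
HB.lock Definition dif {R : realType} {V W : normedModType R} (f : V -> W) (x : V) : Prop :=
  differentiable f x.

Section SealedDerivative.
Context {R : realType}.
Implicit Types U V W X Z : normedModType R.

Lemma dvE V W (f : V -> W) x v : dv f x v = 'D_v f x. Proof. by rewrite dv.unlock. Qed.
Lemma difE V W (f : V -> W) x : dif f x = differentiable f x. Proof. by rewrite dif.unlock. Qed.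

Lemma sm_dif V W (A : set V) (f : V -> W) x : smooth_on A f -> A x -> dif f x.
Proof. by rewrite difE; exact: sm_differentiable. Qed.

Lemma sm_dv V W (A : set V) (f : V -> W) v : smooth_on A f -> smooth_on A (fun x => dv f x v).
Proof.
move=> sf; have -> : (fun x => dv f x v) = 'D_v f by apply/funext => x; exact: dvE.
exact: sm_derive.
Qed.

Lemma dif_id V (x : V) : dif id x.
Proof. exact: (sm_dif (@sm_id R V setT) I). Qed.
Lemma dif_cst V W (c : W) (x : V) : dif (fun _ => c) x.
Proof. exact: (sm_dif (@sm_cst R V W setT c) I). Qed.
Lemma dif_fst V W (x : V * W) : dif fst x.
Proof. exact: (sm_dif (@sm_fst R V W setT) I). Qed.
Lemma dif_snd V W (x : V * W) : dif snd x.
Proof. exact: (sm_dif (@sm_snd R V W setT) I). Qed.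

Lemma dv_id V (x v : V) : dv id x v = v. Proof. by rewrite dvE derive_id. Qed.
Lemma dv_cst V W (c : W) (x v : V) : dv (fun _ => c) x v = 0.
Proof. by rewrite dvE derive_cst. Qed.
Lemma dv_fst V W (u x : V * W) : dv fst x u = u.1.
Proof. by rewrite dvE (derive_lin _ _ (@fst_continuous _ _ _)). Qed.
Lemma dv_snd V W (u x : V * W) : dv snd x u = u.2.
Proof. by rewrite dvE (derive_lin _ _ (@snd_continuous _ _ _)). Qed.

Lemma dv_linear V W (f : V -> W) x : dif f x -> linear (dv f x).
Proof.
by rewrite difE => df a u v; rewrite !dvE (deriveDr _ _ df) (deriveZr _ _ df).
Qed.

Lemma dif_comp U V W (f : U -> V) (g : V -> W) x : dif f x -> dif g (f x) ->
  dif (fun y => g (f y)) x.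
Proof. by rewrite !difE; exact: differentiable_comp. Qed.

Lemma dv_comp U V W (f : U -> V) (g : V -> W) x u : dif f x -> dif g (f x) ->
  dv (fun y => g (f y)) x u = dv g (f x) (dv f x u).
Proof. by rewrite !difE !dvE => df dg; exact: derive_comp. Qed.

Lemma dif_pair U V W (f : U -> V) (g : U -> W) x : dif f x -> dif g x ->
  dif (fun y => (f y, g y)) x.
Proof. by rewrite !difE; exact: differentiable_pair. Qed.

Lemma dv_pair U V W (f : U -> V) (g : U -> W) x u : dif f x -> dif g x ->
  dv (fun y => (f y, g y)) x u = (dv f x u, dv g x u).
Proof. by rewrite !difE !dvE; exact: derive_pair. Qed.

Lemma dif_add V W (f g : V -> W) x : dif f x -> dif g x -> dif (fun y => f y + g y) x.
Proof. by rewrite !difE; exact: differentiableD. Qed.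

Lemma dv_add V W (f g : V -> W) x u : dif f x -> dif g x ->
  dv (fun y => f y + g y) x u = dv f x u + dv g x u.
Proof.
by rewrite !difE !dvE => df dg; exact: (deriveD (diff_derivable df) (diff_derivable dg)).
Qed.

Lemma dif_opp V W (f : V -> W) x : dif f x -> dif (fun y => - f y) x.
Proof. by rewrite !difE; exact: differentiableN. Qed.

Lemma dv_opp V W (f : V -> W) x u : dif f x -> dv (fun y => - f y) x u = - dv f x u.
Proof. by rewrite !difE !dvE => df; exact: (deriveN (diff_derivable df)). Qed.

Lemma dif_sub V W (f g : V -> W) x : dif f x -> dif g x -> dif (fun y => f y - g y) x.
Proof. by move=> df dg; apply: dif_add => //; exact: dif_opp. Qed.

Lemma dv_sub V W (f g : V -> W) x u : dif f x -> dif g x ->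
  dv (fun y => f y - g y) x u = dv f x u - dv g x u.
Proof. by move=> df dg; rewrite (dv_add _ df (dif_opp dg)) (dv_opp _ dg). Qed.

Lemma dif_scale V W (a : V -> R) (f : V -> W) x : dif a x -> dif f x ->
  dif (fun y => a y *: f y) x.
Proof. by rewrite !difE => da df; have [] := dscaleM da df. Qed.

Lemma dv_scale V W (a : V -> R) (f : V -> W) x u : dif a x -> dif f x ->
  dv (fun y => a y *: f y) x u = dv a x u *: f x + a x *: dv f x u.
Proof. by rewrite !difE !dvE => da df; have [_ ->] := dscaleM da df. Qed.

Lemma dif_scalec V W (k : R) (f : V -> W) x : dif f x -> dif (fun y => k *: f y) x.
Proof. by move=> df; apply: dif_scale => //; exact: dif_cst. Qed.

Lemma dv_scalec V W (k : R) (f : V -> W) x u : dif f x ->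
  dv (fun y => k *: f y) x u = k *: dv f x u.
Proof. by move=> df; rewrite (dv_scale u (dif_cst k x) df) dv_cst scale0r add0r. Qed.

Lemma dv_cmul V (k : R) (f : V -> R) x u : dif f x ->
  dv (fun y => k * f y) x u = k * dv f x u.
Proof. exact: dv_scalec. Qed.

Lemma dv_eq V W (A : set V) (f g : V -> W) x v : open A -> A x ->
  (forall y, A y -> f y = g y) -> dv f x v = dv g x v.
Proof. by rewrite !dvE; exact: near_eq_deriv. Qed.

Lemma dif_eq V W (A : set V) (f g : V -> W) x : open A -> A x ->
  (forall y, A y -> f y = g y) -> dif f x -> dif g x.
Proof. by rewrite !difE; exact: near_eq_differentiable. Qed.

Lemma dv_schwarz V (A : set V) (f : V -> R) u v x : open A -> A x -> smooth_on A f ->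
  dv (fun y => dv f y v) x u = dv (fun y => dv f y u) x v.
Proof.
move=> oA Ax sf.
have H w : (fun y => dv f y w) = 'D_w f by apply/funext => y; exact: dvE.
by rewrite !H !dvE; exact: (schwarz u v oA Ax (sf 2)).
Qed.

Lemma dv_entry V m n (f : V -> 'M[R]_(m, n)) x v i j : dif f x ->
  dv (fun x => f x i j) x v = (dv f x v) i j.
Proof. by rewrite difE !dvE; exact: derive_entry. Qed.

Lemma dif_entry V m n (f : V -> 'M[R]_(m, n)) x i j : dif f x -> dif (fun x => f x i j) x.
Proof.
rewrite !difE => df.
exact: (differentiable_comp df (@differentiable_lin _ _ _ (mxcoord i j) _ (@mxcoord_continuous R m n i j))).
Qed.

Lemma dv_schwarz_rV V (A : set V) n (f : V -> 'rV[R]_n) u v x : open A -> A x -> smooth_on A f ->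
  dv (fun y => dv f y v) x u = dv (fun y => dv f y u) x v.
Proof.
move=> oA Ax sf; apply/rowP => j.
have sfj : smooth_on A (fun y => f y 0 j) by exact: sm_entry.
rewrite -(dv_entry u 0 j (sm_dif (sm_dv v sf) Ax)) -(dv_entry v 0 j (sm_dif (sm_dv u sf) Ax)).
have E w y : A y -> (dv f y w) 0 j = dv (fun y => f y 0 j) y w.
  by move=> Ay; rewrite (dv_entry w 0 j (sm_dif sf Ay)).
rewrite (dv_eq u oA Ax (E v)) (dv_eq v oA Ax (E u)).
exact: dv_schwarz sfj.
Qed.

Lemma dif_line V (x v : V) (t : R) : dif (fun t : R => x + t *: v) t.
Proof. by apply: dif_add; [exact: dif_cst|apply: dif_scale; [exact: dif_id|exact: dif_cst]]. Qed.

Lemma dv_line V (x v : V) (t s : R) : dv (fun t : R => x + t *: v) t s = s *: v.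
Proof.
rewrite (dv_add _ (dif_cst _ _)); last by apply: dif_scale; [exact: dif_id|exact: dif_cst].
by rewrite (dv_scale s (dif_id t) (dif_cst v t)) !dv_cst dv_id scaler0 add0r addr0.
Qed.

Lemma dv_fam X Z W n (Om : set Z) (B : Z -> 'rV[R]_n -> W) (z : X -> Z)
    (e : X -> 'rV[R]_n) x u : open Om -> slin Om B -> Om (z x) ->
  dif z x -> dif e x ->
  dv (fun x => B (z x) (e x)) x u =
    dv (fun z => B z (e x)) (z x) (dv z x u) + B (z x) (dv e x u).
Proof.
rewrite !difE !dvE => oOm [lB sB] Oz dz de.
have dB e0 : differentiable (B ^~ e0) (z x) by exact: sm_differentiable (sB e0) Oz.
by have [_ ->] := fam_derive oOm lB Oz dB dz de.
Qed.

Lemma dif_fam X Z W n (Om : set Z) (B : Z -> 'rV[R]_n -> W) (z : X -> Z)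
    (e : X -> 'rV[R]_n) x : open Om -> slin Om B -> Om (z x) ->
  dif z x -> dif e x -> dif (fun x => B (z x) (e x)) x.
Proof.
rewrite !difE => oOm [lB sB] Oz dz de.
have dB e0 : differentiable (B ^~ e0) (z x) by exact: sm_differentiable (sB e0) Oz.
by have [] := fam_derive oOm lB Oz dB dz de.
Qed.

Definition sbil Z W n p (Om : set Z) (B : Z -> 'rV[R]_n -> 'rV[R]_p -> W) :=
  [/\ forall z e, Om z -> linear (B z e), forall z h, Om z -> linear ((B z)^~ h)
    & forall e h, smooth_on Om (fun z => B z e h)].

Lemma sbil_slin Z W n p (Om : set Z) (B : Z -> 'rV[R]_n -> 'rV[R]_p -> W) :
  sbil Om B -> forall e, slin Om (fun z => B z e).
Proof. by move=> [l1 l2 s] e; split=> [z Oz|h]; [exact: l1|exact: s]. Qed.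

Lemma sbil_slin2 Z W n p (Om : set Z) (B : Z -> 'rV[R]_n -> 'rV[R]_p -> W) :
  sbil Om B -> forall h, slin Om (fun z e => B z e h).
Proof. by move=> [l1 l2 s] e; split=> [z Oz|h]; [exact: l2|exact: s]. Qed.

(** Absorbing the first argument into the parameter reduces the rules for bilinear families to those
    for linear ones. *)
Lemma fst_fam_slin Z W n p (Om : set Z) (B : Z -> 'rV[R]_n -> 'rV[R]_p -> W) :
  open Om -> finite_dim Z -> sbil Om B ->
  slin (fst @^-1` Om : set (Z * 'rV[R]_n)) (fun q h => B q.1 q.2 h).
Proof.
move=> oOm fZ Bb; have [l1 l2 sB] := Bb; split=> [q O1|h]; first exact: l1.
have oA : open (fst @^-1` Om : set (Z * 'rV[R]_n)).
  by apply: open_comp => // q _; exact: fst_continuous.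
apply: (sm_fam fZ oA oOm (sbil_slin2 Bb h)) => //; [exact: sm_fst|exact: sm_snd].
Qed.

Lemma sm_bil X Z W n p (A : set X) (Om : set Z)
    (B : Z -> 'rV[R]_n -> 'rV[R]_p -> W) (z : X -> Z) (e : X -> 'rV[R]_n) (h : X -> 'rV[R]_p) :
  finite_dim Z -> open A -> open Om -> sbil Om B -> (forall x, A x -> Om (z x)) ->
  smooth_on A z -> smooth_on A e -> smooth_on A h ->
  smooth_on A (fun x => B (z x) (e x) (h x)).
Proof.
move=> fZ oA oOm Bb AO sz se sh; have [l1 l2 sB] := Bb.
apply: (@sm_ext _ _ _ _ (fun x => \sum_j h x 0 j *: B (z x) (e x) (delta_mx 0 j))) => //.
  by move=> x /AO Ox; rewrite [RHS](lin_delta _ (l1 _ (e x) Ox)).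
apply: sm_sum => // j _; apply: sm_scale => //; first exact: sm_entry.
exact: (sm_fam fZ oA oOm (sbil_slin2 Bb (delta_mx 0 j)) AO sz se).
Qed.

Section Bilinear.
Context {X Z W : normedModType R} {n p : nat}.
Variables (Om : set Z) (B : Z -> 'rV[R]_n -> 'rV[R]_p -> W).
Variables (z : X -> Z) (e : X -> 'rV[R]_n) (h : X -> 'rV[R]_p) (x : X).
Hypotheses (oOm : open Om) (fZ : finite_dim Z) (Bb : sbil Om B) (Oz : Om (z x)).
Hypotheses (dz : dif z x) (de : dif e x) (dh : dif h x).

Lemma dv_bil u : dv (fun x => B (z x) (e x) (h x)) x u =
    dv (fun z => B z (e x) (h x)) (z x) (dv z x u)
    + B (z x) (dv e x u) (h x) + B (z x) (e x) (dv h x u).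
Proof.
have oA : open (fst @^-1` Om : set (Z * 'rV[R]_n)).
  by apply: open_comp => // q _; exact: fst_continuous.
have sl := fst_fam_slin oOm fZ Bb.
have E := dv_fam u oA sl (Oz : (fst @^-1` Om) (z x, e x)) (dif_pair dz de) dh.
rewrite [LHS]E (dv_pair _ dz de); congr (_ + _).
have := dv_fam (dv z x u, dv e x u) oOm (sbil_slin2 Bb (h x)) (Oz : Om (z x, e x).1)
  (dif_fst _) (dif_snd _).
by rewrite dv_fst dv_snd.
Qed.

Lemma dif_bil : dif (fun x => B (z x) (e x) (h x)) x.
Proof using oOm fZ Bb Oz dz de dh.
have oA : open (fst @^-1` Om : set (Z * 'rV[R]_n)).
  by apply: open_comp => // q _; exact: fst_continuous.
have sl := fst_fam_slin oOm fZ Bb.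
exact: (dif_fam oA sl (Oz : (fst @^-1` Om) (z x, e x)) (dif_pair dz de) dh).
Qed.
End Bilinear.

Lemma fd_Z n p : finite_dim ('rV[R]_n * 'rV[R]_p)%type.
Proof. by apply: fd_prod; exact: fd_rV. Qed.

Lemma pair_split (V W : lmodType R) (a : V) (b c : W) : (a, b + c) = (a, b) + (0, c).
Proof. by apply: injective_projections; rewrite /= ?addr0. Qed.

Lemma dv_split V V' W (f : V * V' -> W) z a b c : dif f z ->
  dv f z (a, b + c) = dv f z (a, b) + dv f z (0, c).
Proof. by move=> df; rewrite pair_split (lin_D (dv_linear df)). Qed.

Lemma inr_lin (V W : lmodType R) (a : R) (u v : W) :
  ((0, a *: u + v) : V * W) = a *: (0, u) + (0, v).
Proof. by apply: injective_projections; rewrite /= ?scaler0 ?addr0. Qed.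

Lemma mx_unit_inj n (N : 'M[R]_n) : (forall u : 'rV_n, u *m N = 0 -> u = 0) -> N \in unitmx.
Proof. by move=> h; rewrite -row_free_unit; exact: inj_row_free. Qed.

End SealedDerivative.

(** * Finsler geometry of a chart *)

Section Fundamental.
Context {R : realType} {m : nat}.
Local Notation E := 'rV[R]_m.
Variables (Om : set (E * E)) (l : E * E -> R).

(** At z = (x, v) the fibre directions are the pairs (0, e). The factor 1/2 here and the one in [cf]
    multiply to the 1/4 of the Cartan tensor. *)
Definition gf (z : E * E) (e h : E) : R := 2^-1 * dv (fun y => dv l y (0, h)) z (0, e).
Definition cf (z : E * E) (b e h : E) : R := 2^-1 * dv (fun z => gf z e h) z (0, b).

Hypotheses (oOm : open Om) (sl : smooth_on Om l).

Lemma gf_smooth e h : smooth_on Om (fun z => gf z e h).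
Proof. by apply: (sm_scalec 2^-1 oOm); do 2 apply: sm_dv. Qed.

Lemma cf_smooth b e h : smooth_on Om (fun z => cf z b e h).
Proof. by apply: (sm_scalec 2^-1 oOm); apply: sm_dv; exact: gf_smooth. Qed.

Lemma gf_sym z e h : Om z -> gf z e h = gf z h e.
Proof. by move=> Oz; rewrite /gf (dv_schwarz _ _ oOm Oz sl). Qed.

Lemma gf_lin1 z h : Om z -> linear (fun e => gf z e h).
Proof.
move=> Oz a u v; have df := sm_dif (sm_dv (0, h) sl) Oz.
by rewrite /gf inr_lin (dv_linear df) /GRing.scale /=; ring.
Qed.

Lemma gf_lin2 z e : Om z -> linear (gf z e).
Proof.
by move=> Oz a u v; rewrite !(gf_sym e _ Oz); exact: (gf_lin1 e Oz).
Qed.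

Lemma gf_bil : sbil Om gf.
Proof.
by split=> [z e|z h|e h]; [exact: gf_lin2|exact: gf_lin1|exact: gf_smooth].
Qed.

Lemma cf_sym23 z b e h : Om z -> cf z b e h = cf z b h e.
Proof.
move=> Oz; have H y : Om y -> gf y e h = gf y h e by exact: gf_sym.
by rewrite /cf (dv_eq (0, b) oOm Oz H).
Qed.

Lemma cf_sym12 z b e h : Om z -> cf z b e h = cf z e b h.
Proof.
move=> Oz; have sh := sm_dv (0, h) sl.
rewrite /cf /gf (dv_cmul _ _ (sm_dif (sm_dv (0, e) sh) Oz)).
rewrite (dv_cmul _ _ (sm_dif (sm_dv (0, b) sh) Oz)).
by rewrite (dv_schwarz (0, b) (0, e) oOm Oz sh).
Qed.

Lemma cf_lin1 z e h : Om z -> linear (fun b => cf z b e h).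
Proof.
move=> Oz a u v; have df := sm_dif (gf_smooth e h) Oz.
by rewrite /cf inr_lin (dv_linear df) /GRing.scale /=; ring.
Qed.

Lemma cf_lin2 z b h : Om z -> linear (fun e => cf z b e h).
Proof. by move=> Oz a u v; rewrite !(cf_sym12 b _ h Oz); exact: (cf_lin1 b h Oz). Qed.

Lemma cf_lin3 z b e : Om z -> linear (cf z b e).
Proof. by move=> Oz a u v; rewrite !(cf_sym23 b e _ Oz); exact: (cf_lin2 b e Oz). Qed.

Lemma dv_gf0 z b e h : dv (fun z => gf z e h) z (0, b) = 2 * cf z b e h.
Proof. by rewrite /cf mulrA mulfV // mul1r. Qed.

Hypothesis (hhom : forall z (k : R), Om z -> 0 < k -> l (z.1, k *: z.2) = k ^+ 2 * l z).

(** Differentiate l (x, (1 + t) v) = (1 + t)^2 l (x, v) at t = 0. *)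
Lemma euler z : Om z -> dv l z (0, z.2) = 2 * l z.
Proof.
move=> Oz; pose a (t : R) : R := 1 + t.
have H t : -1 < t -> a t *: (a t *: l z) = l (z + t *: (0, z.2)).
  move=> t1; have -> : z + t *: (0, z.2) = (z.1, (1 + t) *: z.2).
    by apply: injective_projections; rewrite /= ?scaler0 ?addr0 ?scalerDl ?scale1r.
  rewrite (hhom Oz); last by lra.
  by rewrite /a /GRing.scale /= mulrA -expr2.
have dl : dif l (z + 0 *: (0, z.2)) by rewrite scale0r addr0; exact: sm_dif sl Oz.
have E1 := dv_comp (1 : R) (dif_line z (0, z.2) 0) dl.
rewrite dv_line scale1r scale0r addr0 in E1; rewrite -E1.
rewrite -(dv_eq (A := [set t : R | -1 < t]) 1 _ _ H); [|exact: open_gt|by rewrite /=; lra].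
have da : dif a 0 by apply: dif_add; [exact: dif_cst|exact: dif_id].
have Ea : dv a 0 1 = 1 by rewrite (dv_add _ (dif_cst _ _) (dif_id _)) dv_cst dv_id add0r.
have d1 := dif_scale da (dif_cst (l z) (0 : R)).
rewrite (dv_scale (1 : R) da d1) (dv_scale (1 : R) da (dif_cst _ _)) Ea dv_cst /a addr0 !scale1r addr0.
by rewrite mulr2n mulrDl mul1r.
Qed.

(** The fibre derivative of Euler's relation in the direction h is 2 g(v, h) + dl(h) = 2 dl(h). *)
Lemma gf_vl z h : Om z -> gf z z.2 h = 2^-1 * dv l z (0, h).
Proof.
move=> Oz; have dl := sm_dif sl Oz.
have S : slin Om (fun z e => dv l z (0, e)).
  split=> [y Oy a u v|e]; last exact: sm_dv.
  by rewrite inr_lin (dv_linear (sm_dif sl Oy)).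
have := dv_fam (0, h) oOm S Oz (dif_id z) (dif_snd z).
rewrite dv_id dv_snd (dv_eq (0, h) oOm Oz euler) (dv_cmul 2 (0, h) dl) => E2.
rewrite (gf_sym _ _ Oz) /gf; move: E2 => /=; lra.
Qed.

(** Differentiating [gf_vl] in the direction e gives 2 C(e, v, h) + g(e, h) = g(e, h). *)
Lemma cf_v z e h : Om z -> cf z e z.2 h = 0.
Proof.
move=> Oz; have dd := sm_dif (sm_dv (0, h) sl) Oz.
have := dv_fam (0, e) oOm (sbil_slin2 gf_bil h) Oz (dif_id z) (dif_snd z).
have H y : Om y -> gf y y.2 h = 2^-1 * dv l y (0, h) by exact: gf_vl.
rewrite (dv_eq (0, e) oOm Oz H) (dv_cmul 2^-1 (0, e) dd) dv_id dv_snd dv_gf0 /=.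
rewrite -/(gf z e h); lra.
Qed.

Lemma l_gf z : Om z -> l z = gf z z.2 z.2.
Proof. by move=> Oz; rewrite (gf_vl _ Oz) (euler Oz) mulrA mulVf // mul1r. Qed.

End Fundamental.

Section LinearMaps.
Context {R : realType}.
Implicit Types U V W : lmodType R.

Lemma lin_comp U V W (g : V -> W) (f : U -> V) : linear g -> linear f -> linear (fun x => g (f x)).
Proof. by move=> lg lf a u v; rewrite lf lg. Qed.
Lemma lin_add V W (f g : V -> W) : linear f -> linear g -> linear (fun x => f x + g x).
Proof. by move=> lf lg a u v; rewrite lf lg scalerDr addrACA. Qed.
Lemma lin_opp V W (f : V -> W) : linear f -> linear (fun x => - f x).
Proof. by move=> lf a u v; rewrite lf opprD scalerN. Qed.
Lemma lin_sub V W (f g : V -> W) : linear f -> linear g -> linear (fun x => f x - g x).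
Proof. by move=> lf lg; apply: lin_add => //; exact: lin_opp. Qed.
Lemma lin_scale V W (k : R) (f : V -> W) : linear f -> linear (fun x => k *: f x).
Proof. by move=> lf a u v; rewrite lf scalerDr !scalerA mulrC. Qed.

End LinearMaps.

(* The horizontal lift of h at z = (x, v) is (h, - Ga z h v); [cov] is the covariant
   derivative of an anisotropic vector field in a chart. *)
HB.lock Definition cov {R : realType} {m : nat}
    (Ga : 'rV[R]_m * 'rV[R]_m -> 'rV[R]_m -> 'rV[R]_m -> 'rV[R]_m)
    (X : 'rV[R]_m * 'rV[R]_m -> 'rV[R]_m) (z : 'rV[R]_m * 'rV[R]_m) (h : 'rV[R]_m) : 'rV[R]_m :=
  dv X z (h, 0) - dv X z (0, Ga z h z.2) + Ga z h (X z).

Definition gram {R : realType} {m : nat} (l : 'rV[R]_m * 'rV[R]_m -> R)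
    (z : 'rV[R]_m * 'rV[R]_m) : 'M[R]_m :=
  \matrix_(i, j) gf l z (delta_mx 0 i) (delta_mx 0 j).

(** C^sharp: the Cartan form with an index raised by the inverse Gram matrix, a formula that is
    visibly smooth. *)
HB.lock Definition csf {R : realType} {m : nat} (l : 'rV[R]_m * 'rV[R]_m -> R)
    (z : 'rV[R]_m * 'rV[R]_m) (e h : 'rV[R]_m) : 'rV[R]_m :=
  (\row_j cf l z (delta_mx 0 j) e h) *m invmx (gram l z).

Definition dmat {R : realType} {m n : nat} (sg : 'rV[R]_m -> 'rV[R]_n)
    (z : 'rV[R]_m * 'rV[R]_m) : 'M[R]_(m, n) :=
  \matrix_(i, j) dv sg z.1 (delta_mx 0 i) 0 j.

(* The vertical projection solves a linear system with Lagrange multipliers for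
   the constraint [dv sg z.1 w = 0]; hence it depends smoothly on z. *)
Definition kkt {R : realType} {m n : nat} (l : 'rV[R]_m * 'rV[R]_m -> R)
    (sg : 'rV[R]_m -> 'rV[R]_n) (z : 'rV[R]_m * 'rV[R]_m) : 'M[R]_(m + n) :=
  block_mx (gram l z) (dmat sg z) (dmat sg z)^T 0.

HB.lock Definition topf {R : realType} {m n : nat} (l : 'rV[R]_m * 'rV[R]_m -> R)
    (sg : 'rV[R]_m -> 'rV[R]_n) (z : 'rV[R]_m * 'rV[R]_m) (e : 'rV[R]_m) : 'rV[R]_m :=
  lsubmx (row_mx (e *m gram l z) (0 : 'rV[R]_n) *m invmx (kkt l sg z)).

(* [ktop] is (nabla_h top) e: it exchanges vertical and horizontal vectors, and
   chi = ktop - 2 top ktop. *)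
HB.lock Definition ktop {R : realType} {m n : nat} (l : 'rV[R]_m * 'rV[R]_m -> R)
    (Ga : 'rV[R]_m * 'rV[R]_m -> 'rV[R]_m -> 'rV[R]_m -> 'rV[R]_m)
    (sg : 'rV[R]_m -> 'rV[R]_n) (z : 'rV[R]_m * 'rV[R]_m) (h e : 'rV[R]_m) : 'rV[R]_m :=
  cov Ga (fun y => topf l sg y e) z h - topf l sg z (Ga z h e).

HB.lock Definition chif {R : realType} {m n : nat} (l : 'rV[R]_m * 'rV[R]_m -> R)
    (Ga : 'rV[R]_m * 'rV[R]_m -> 'rV[R]_m -> 'rV[R]_m -> 'rV[R]_m)
    (sg : 'rV[R]_m -> 'rV[R]_n) (z : 'rV[R]_m * 'rV[R]_m) (h e : 'rV[R]_m) : 'rV[R]_m :=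
  ktop l Ga sg z h e - 2 *: topf l sg z (ktop l Ga sg z h e).

Section LocalFinsler.
Context {R : realType} {m : nat}.
Local Notation E := 'rV[R]_m.

(** A pseudo-Finsler metric with its connection, as seen in one chart. Symmetry of Ga is
    torsion-freeness, since coordinate fields commute; [lf_compat] is nabla g = 0 written along the
    horizontal lift. *)
Record local_finsler (Om : set (E * E)) (l : E * E -> R) (Ga : E * E -> E -> E -> E)
    : Prop := LocalFinsler {
  lf_open : open Om;
  lf_smooth : smooth_on Om l;
  lf_hom : forall z (k : R), Om z -> 0 < k -> l (z.1, k *: z.2) = k ^+ 2 * l z;
  lf_nondeg : forall z, Om z -> forall e, (forall h, gf l z e h = 0) -> e = 0;
  lf_bil : sbil Om Ga;
  lf_sym : forall z e h, Om z -> Ga z e h = Ga z h e;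
  lf_compat : forall z h e e', Om z ->
    dv (fun y => gf l y e e') z (h, - Ga z h z.2) = gf l z (Ga z h e) e' + gf l z e (Ga z h e')
}.

Lemma dv_hlift (W : normedModType R) (f : E * E -> W) z a b : dif f z ->
  dv f z (a, - b) = dv f z (a, 0) - dv f z (0, b).
Proof.
move=> df; have -> : ((a, - b) : E * E) = (a, 0) - (0, b).
  by apply: injective_projections; rewrite /= ?subr0 ?sub0r.
by rewrite (lin_B (dv_linear df)).
Qed.

Lemma dv_cov (Ga : E * E -> E -> E -> E) (X : E * E -> E) z h b : dif X z ->
  dv X z (h, b - Ga z h z.2) = cov Ga X z h - Ga z h (X z) + dv X z (0, b).
Proof.
move=> dX; rewrite addrC (dv_split _ _ _ dX) (dv_hlift _ _ dX) cov.unlock; congr (_ + _).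
by rewrite addrK.
Qed.

Section Metric.
Variables (Om : set (E * E)) (l : E * E -> R) (Ga : E * E -> E -> E -> E).
Hypothesis H : local_finsler Om l Ga.
Let oOm := lf_open H.
Let sl := lf_smooth H.
Local Notation g := (gf l).
Local Notation C := (csf l).

Lemma gramE z u j : Om z -> (u *m gram l z) 0 j = g z u (delta_mx 0 j).
Proof.
move=> Oz; rewrite (lin_delta u (gf_lin1 sl (delta_mx 0 j) Oz)) mxE.
by apply: eq_bigr => i _; rewrite mxE.
Qed.

Lemma gramE2 z u w : Om z -> (u *m gram l z *m w^T) 0 0 = g z u w.
Proof.
move=> Oz; rewrite [RHS](lin_delta w (gf_lin2 oOm sl u Oz)) mxE.
by apply: eq_bigr => j _; rewrite gramE // mxE mulrC.
Qed.

Lemma gram_unit z : Om z -> gram l z \in unitmx.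
Proof.
move=> Oz; apply: mx_unit_inj => u u0; apply: (lf_nondeg H Oz) => h.
by rewrite -gramE2 // u0 mul0mx mxE.
Qed.

Lemma csfP z b e h : Om z -> g z b (C z e h) = cf l z b e h.
Proof.
move=> Oz; rewrite (gf_sym oOm sl _ _ Oz) -gramE2 // csf.unlock mulmxKV ?gram_unit //.
rewrite [RHS](lin_delta b (cf_lin1 oOm sl e h Oz)) mxE.
by apply: eq_bigr => j _; rewrite !mxE mulrC.
Qed.

Lemma gf_inj z c c' : Om z -> (forall b, g z b c = g z b c') -> c = c'.
Proof.
move=> Oz h; apply/eqP; rewrite -subr_eq0; apply/eqP; apply: (lf_nondeg H Oz) => b.
by rewrite (gf_sym oOm sl _ _ Oz) (lin_B (gf_lin2 oOm sl b Oz)) h subrr.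
Qed.

Lemma csf_sym z e h : Om z -> C z e h = C z h e.
Proof. by move=> Oz; apply: (gf_inj Oz) => b; rewrite !csfP // (cf_sym23 oOm sl). Qed.

Lemma csf_lin2 z e : Om z -> linear (C z e).
Proof.
move=> Oz a u w; apply: (gf_inj Oz) => b.
by rewrite (gf_lin2 oOm sl b Oz) !csfP // (cf_lin3 oOm sl b e Oz).
Qed.

Lemma csf_bil : sbil Om C.
Proof.
split=> [z e Oz|z h Oz a u w|e h]; first exact: csf_lin2.
  by rewrite !(csf_sym _ h Oz) (csf_lin2 h Oz).
rewrite csf.unlock; apply: sm_mulmx => //.
  apply: sm_mx => // i j; under eq_fun do rewrite mxE; exact: cf_smooth.
apply: sm_invmx => //; first exact: gram_unit.
apply: sm_mx => // i j; under eq_fun do rewrite mxE; exact: gf_smooth.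
Qed.

Lemma csf_v z e : Om z -> C z e z.2 = 0.
Proof.
move=> Oz; apply: (gf_inj Oz) => b; rewrite csfP // (lin_0 (gf_lin2 oOm sl b Oz)).
by rewrite (cf_sym23 oOm sl) // (cf_v oOm sl (lf_hom H)).
Qed.

Lemma dv_g z h b e e' : Om z -> dv (fun y => g y e e') z (h, b - Ga z h z.2)
  = g z (Ga z h e) e' + g z e (Ga z h e') + 2 * cf l z b e e'.
Proof.
move=> Oz; have dg := sm_dif (gf_smooth oOm sl e e') Oz.
by rewrite addrC (dv_split _ _ _ dg) (lf_compat H h e e' Oz) dv_gf0.
Qed.

End Metric.

Section Submersion.
Context {n : nat}.
Variables (Om : set (E * E)) (l : E * E -> R) (Ga : E * E -> E -> E -> E).
Variables (U : set E) (sg : E -> 'rV[R]_n).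

Record local_submersion : Prop := LocalSubmersion {
  ls_open : open U;
  ls_dom : forall z, Om z -> U z.1;
  ls_smooth : smooth_on U sg;
  ls_surj : forall x, U x -> forall y, exists e, dv sg x e = y;
  ls_vnondeg : forall z w, Om z -> dv sg z.1 w = 0 ->
    (forall u, dv sg z.1 u = 0 -> gf l z w u = 0) -> w = 0
}.

Hypothesis H : local_finsler Om l Ga.
Hypothesis S : local_submersion.
Let oOm := lf_open H.
Let sl := lf_smooth H.
Let oU := ls_open S.
Let ssg := ls_smooth S.
Local Notation g := (gf l).
Local Notation C := (csf l).
Local Notation top := (topf l sg).
Local Notation dmat := (dmat sg).
Local Notation kkt := (kkt l sg).

Let g1 z h (Oz : Om z) := gf_lin1 sl h Oz.
Let g2 z e (Oz : Om z) := gf_lin2 oOm sl e Oz.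
Let gsym z e h (Oz : Om z) := gf_sym oOm sl e h Oz.

Lemma dsg_lin z : Om z -> linear (dv sg z.1).
Proof. by move=> Oz; apply: dv_linear; exact: sm_dif ssg (ls_dom S Oz). Qed.

Lemma dmatE z e : Om z -> e *m dmat z = dv sg z.1 e.
Proof.
move=> Oz; rewrite [RHS](lin_delta e (dsg_lin Oz)); apply/rowP => j.
by rewrite mxE summxE; apply: eq_bigr => i _; rewrite !mxE.
Qed.

(** For (w, la) in the kernel, w is vertical and orthogonal to all vertical vectors, so it vanishes
    by vertical non-degeneracy; then la vanishes because the differential of sg is surjective. *)
Lemma kkt_unit z : Om z -> kkt z \in unitmx.
Proof.
move=> Oz; apply: mx_unit_inj => u.
rewrite -(hsubmxK u); set w := lsubmx u; set la := rsubmx u.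
rewrite /kkt mul_row_block mulmx0 addr0 -(row_mx0) => /eq_row_mx[E1 E2].
have w0 : w = 0.
  apply: (ls_vnondeg S Oz); first by rewrite -dmatE.
  move=> v v0; rewrite -(gramE2 H) //.
  have -> : w *m gram l z = - (la *m (dmat z)^T) by apply/eqP; rewrite -addr_eq0 E1.
  by rewrite mulNmx -mulmxA -trmx_mul dmatE // v0 trmx0 mulmx0 oppr0 mxE.
move: E1; rewrite w0 mul0mx add0r => E1.
(* Writing la itself as the image of some e turns the remaining equation into la la^T = 0, a
   vanishing sum of squares. *)
have [e Ee] := ls_surj S (ls_dom S Oz) la.
suff -> : la = 0 by rewrite row_mx0.
have : la *m la^T = 0 by rewrite -{2}Ee -dmatE // trmx_mul mulmxA E1 mul0mx.
move=> /matrixP/(_ 0 0); rewrite !mxE => /eqP; rewrite psumr_eq0; last first.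
  move=> j _; have -> : la^T j 0 = la 0 j by rewrite mxE.
  by rewrite -expr2 sqr_ge0.
move=> /allP h; apply/rowP => j; have := h j; rewrite mem_index_enum => /(_ isT).
by rewrite !mxE mulf_eq0 orbb => /eqP.
Qed.

Lemma topf_eq z e : Om z -> exists la : 'rV[R]_n,
  top z e *m gram l z + la *m (dmat z)^T = e *m gram l z /\ top z e *m dmat z = 0.
Proof.
rewrite topf.unlock => Oz; set u := row_mx (e *m gram l z) (0 : 'rV[R]_n) *m invmx (kkt z).
exists (rsubmx u).
have : u *m kkt z = row_mx (e *m gram l z) 0 by rewrite /u mulmxKV // kkt_unit.
rewrite -{1}(hsubmxK u) /kkt mul_row_block mulmx0 addr0 => /eq_row_mx[E1 E2].
by split.
Qed.

Lemma top_ver z e : Om z -> dv sg z.1 (top z e) = 0.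
Proof. by move=> Oz; have [la [_]] := topf_eq e Oz; rewrite dmatE. Qed.

Lemma top_orth z e w : Om z -> dv sg z.1 w = 0 -> g z (top z e) w = g z e w.
Proof.
move=> Oz w0; have [la [E1 _]] := topf_eq e Oz.
have E0 : la *m (dmat z)^T *m w^T = 0.
  by rewrite -mulmxA -trmx_mul (dmatE _ Oz) w0 trmx0 mulmx0.
by rewrite -!(gramE2 H) // -E1 mulmxDl E0 addr0.
Qed.

Lemma top_uniq z e w : Om z -> dv sg z.1 w = 0 ->
  (forall u, dv sg z.1 u = 0 -> g z w u = g z e u) -> top z e = w.
Proof.
move=> Oz w0 hw; apply/eqP; rewrite -subr_eq0; apply/eqP; apply: (ls_vnondeg S Oz).
  by rewrite (lin_B (dsg_lin Oz)) top_ver // w0 subrr.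
by move=> u u0; rewrite (lin_B (g1 u Oz)) top_orth // hw // subrr.
Qed.

Lemma top_id z w : Om z -> dv sg z.1 w = 0 -> top z w = w.
Proof. by move=> Oz w0; apply: top_uniq. Qed.

Lemma top_top z e : Om z -> top z (top z e) = top z e.
Proof. by move=> Oz; apply: top_id => //; exact: top_ver. Qed.

Lemma ver_top z w : Om z -> top z w = w -> dv sg z.1 w = 0.
Proof. by move=> Oz <-; exact: top_ver. Qed.

Lemma top_sa z e h : Om z -> g z (top z e) h = g z e (top z h).
Proof.
move=> Oz; rewrite -(top_orth e Oz (top_ver h Oz)) (gsym _ h Oz).
by rewrite -(top_orth h Oz (top_ver e Oz)) (gsym _ (top z e) Oz).
Qed.

Lemma top_lin z : Om z -> linear (top z).
Proof.
move=> Oz a u v; apply: top_uniq => //.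
  by rewrite (dsg_lin Oz) !top_ver // scaler0 addr0.
by move=> w w0; rewrite !(g1 w Oz) !top_orth.
Qed.

Lemma top_slin : slin Om top.
Proof.
split=> [z Oz|e]; first exact: top_lin.
have sG : smooth_on Om (gram l).
  apply: sm_mx => // i j; under eq_fun do rewrite mxE; exact: gf_smooth.
have sD : smooth_on Om dmat.
  apply: sm_mx => // i j; under eq_fun do rewrite mxE.
  apply: sm_entry => //.
  apply: (@sm_comp _ _ _ _ Om U fst (fun x => dv sg x (delta_mx 0 i)) (fd_rV _) oOm oU (ls_dom S)); [exact: sm_dv|exact: sm_fst].
rewrite topf.unlock; apply: sm_lsubmx => //; apply: sm_mulmx => //.
  apply: sm_row0 => //; apply: sm_mulmx => //; exact: sm_cst.
apply: sm_invmx => //; first exact: kkt_unit.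
apply: sm_block => //; [exact: sm_trmx|exact: sm_cst].
Qed.

Local Notation K := (ktop l Ga sg).
Local Notation chi := (chif l Ga sg).

Lemma top_dif e z : Om z -> dif (fun y => top y e) z.
Proof. by have [_ st] := top_slin; exact: sm_dif. Qed.

Lemma ga_lin1 z h : Om z -> linear (fun e => Ga z e h).
Proof. by have [_ + _] := lf_bil H; apply. Qed.
Lemma ga_lin2 z e : Om z -> linear (Ga z e).
Proof. by have [+ _ _] := lf_bil H; apply. Qed.

(** The direction is the horizontal lift of h plus the fibre vector b. Along the lift the plain and
    the covariant derivative of [top] differ by its commutator with Ga z h. *)
Lemma dv_top z h b e : Om z -> dv (fun y => top y e) z (h, b - Ga z h z.2) =
  K z h e - Ga z h (top z e) + top z (Ga z h e) + dv (fun y => top y e) z (0, b).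
Proof.
move=> Oz; rewrite (dv_cov _ _ _ (top_dif e Oz)) ktop.unlock; congr (_ + _).
by apply/rowP => j; rewrite !mxE; ring.
Qed.

Lemma dv_top0 z h e : Om z -> dv (fun y => top y e) z (h, - Ga z h z.2) =
  K z h e - Ga z h (top z e) + top z (Ga z h e).
Proof.
move=> Oz; have := dv_top h 0 e Oz; rewrite add0r => ->.
by rewrite (lin_0 (dv_linear (top_dif e Oz))) addr0.
Qed.

Lemma dv_top_lin z (q : E * E) : Om z -> linear (fun e => dv (fun y => top y e) z q).
Proof.
move=> Oz a u v /=.
have E1 y : Om y -> top y (a *: u + v) = a *: top y u + top y v by move=> Oy; exact: top_lin.
rewrite (dv_eq q oOm Oz E1) dv_add ?dv_scalec //; try exact: top_dif.
by apply: dif_scalec; exact: top_dif.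
Qed.

Lemma K_bil : sbil Om K.
Proof.
rewrite ktop.unlock cov.unlock.
split=> [z h Oz|z e Oz|h e].
- apply: lin_sub; last by apply: lin_comp; [exact: top_lin|exact: ga_lin2].
  apply: lin_add; first by apply: lin_sub; exact: dv_top_lin.
  by apply: lin_comp; [exact: ga_lin2|exact: top_lin].
- apply: lin_sub; last by apply: lin_comp; [exact: top_lin|exact: ga_lin1].
  apply: lin_add; last exact: ga_lin1.
  have ld := dv_linear (top_dif e Oz).
  apply: lin_sub.
    move=> a u v /=; have -> : ((a *: u + v, 0) : E * E) = a *: (u, 0) + (v, 0).
      by apply: injective_projections; rewrite /= ?scaler0 ?addr0.
    exact: ld.
  move=> a u v /=; rewrite (ga_lin1 _ Oz) inr_lin; exact: ld.
- have [_ st] := top_slin; have [_ _ sG] := lf_bil H.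
  have sGz : smooth_on Om (fun z => Ga z h z.2).
    apply: (sm_fam (fd_Z _ _) oOm oOm (sbil_slin (lf_bil H) h)) => //.
      exact: sm_id.
    exact: sm_snd.
  apply: sm_sub2 => //; last first.
    exact: (sm_fam (fd_Z _ _) oOm oOm top_slin (fun z h => h) (@sm_id _ _ _) (sG h e)).
  apply: sm_add => //; last first.
    exact: (sm_fam (fd_Z _ _) oOm oOm (sbil_slin (lf_bil H) h) (fun z h => h) (@sm_id _ _ _) (st e)).
  apply: sm_sub2 => //; first exact: sm_dv.
  have sB : slin Om (fun z w => dv (fun y => top y e) z (0, w)).
    split=> [z Oz a u v|w]; last exact: sm_dv.
    by rewrite inr_lin; apply: dv_linear; exact: top_dif.
  exact: (sm_fam (fd_Z _ _) oOm oOm sB (fun z h => h) (@sm_id _ _ _) sGz).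
Qed.

(** The covariant derivative of top o top = top; the terms in Ga cancel. *)
Lemma K_swap z h e : Om z -> top z (K z h e) + K z h (top z e) = K z h e.
Proof.
move=> Oz; have [lt st] := top_slin.
have := dv_fam (h, - Ga z h z.2) oOm top_slin Oz (dif_id z) (top_dif e Oz).
have E1 y : Om y -> top y (top y e) = top y e by move=> Oy; exact: top_top.
rewrite (dv_eq _ oOm Oz E1) dv_id !dv_top0 // !top_top //.
rewrite (lin_D (lt z Oz)) (lin_B (lt z Oz)) top_top //.
move: (K z h e) (K z h (top z e)) (top z (K z h e)) (Ga z h (top z e))
  (top z (Ga z h e)) (top z (Ga z h (top z e))) => a b c d f k E2.
apply/rowP => j; move/rowP: E2 => /(_ j); rewrite !mxE => E2; lra.
Qed.

(** Since nabla g = 0, the covariant derivative of a self-adjoint field of endomorphisms is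
    self-adjoint. *)
Lemma K_sa z h e e' : Om z -> g z (K z h e) e' = g z e (K z h e').
Proof.
move=> Oz; have [lt st] := top_slin.
have gb := gf_bil oOm sl.
have D1 := dv_bil oOm (fd_Z _ _) gb Oz (dif_id z) (top_dif e Oz) (dif_cst e' z) (h, - Ga z h z.2).
have D2 := dv_bil oOm (fd_Z _ _) gb Oz (dif_id z) (dif_cst e z) (top_dif e' Oz) (h, - Ga z h z.2).
have E1 y : Om y -> g y (top y e) e' = g y e (top y e') by move=> Oy; exact: top_sa.
move: D1; rewrite (dv_eq _ oOm Oz E1) D2 dv_id !dv_cst !(lf_compat H) // !dv_top0 //.
rewrite (lin_0 (g1 _ Oz)) (lin_0 (g2 _ Oz)) !addr0.
rewrite !(lin_D (g1 _ Oz)) !(lin_N (g1 _ Oz)) !(lin_D (g2 _ Oz)) !(lin_N (g2 _ Oz)).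
rewrite (top_sa (Ga z h e) e' Oz) -(top_sa e (Ga z h e') Oz).
lra.
Qed.

Lemma K_ver z h e : Om z -> top z e = e -> top z (K z h e) = 0.
Proof.
by move=> Oz te; have := K_swap h e Oz; rewrite te => E1; apply: (addIr (K z h e)); rewrite E1 add0r.
Qed.

Lemma K_hor z h e : Om z -> top z e = 0 -> top z (K z h e) = K z h e.
Proof.
move=> Oz te; have [+ _ _] := K_bil => lK; have := K_swap h e Oz.
by rewrite te (lin_0 (lK z h Oz)) addr0.
Qed.

Lemma chi_ver z h e : Om z -> top z e = e -> chi z h e = K z h e.
Proof. by move=> Oz te; rewrite chif.unlock K_ver // scaler0 subr0. Qed.

Lemma chi_hor z h e : Om z -> top z e = 0 -> chi z h e = - K z h e.
Proof. by move=> Oz te; rewrite chif.unlock K_hor // mulr2n scalerDl scale1r opprD addNKr. Qed.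

Lemma chi_ver_top z h e : Om z -> top z e = e -> top z (chi z h e) = 0.
Proof. by move=> Oz te; rewrite chi_ver // K_ver. Qed.

Lemma chi_hor_top z h e : Om z -> top z e = 0 -> top z (chi z h e) = chi z h e.
Proof. by move=> Oz te; rewrite chi_hor // (lin_N (top_lin Oz)) K_hor. Qed.

(** Here chi = (1 - 2 top) K, where both factors are self-adjoint and anticommute by [K_swap]. *)
Lemma chi_skew z h e e' : Om z -> g z (chi z h e) e' = - g z e (chi z h e').
Proof.
move=> Oz; have [lK1 _ _] := K_bil.
have E1 : g z (top z (K z h e)) e' = g z e (K z h (top z e')) by rewrite top_sa // K_sa.
have E2 : g z e (top z (K z h e')) = g z (K z h (top z e)) e' by rewrite -top_sa // K_sa.
rewrite chif.unlock (lin_B (g1 _ Oz)) (lin_Z (g1 _ Oz)) (lin_B (g2 _ Oz)) (lin_Z (g2 _ Oz)) E1.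
have := K_swap h e' Oz; have := K_sa h e e' Oz => E3 E4.
have : g z e (top z (K z h e') + K z h (top z e')) = g z e (K z h e') by rewrite E4.
rewrite (lin_D (g2 _ Oz)) E3 /GRing.scale /=; lra.
Qed.

Lemma chi_bil : sbil Om chi.
Proof.
rewrite chif.unlock.
have [l1 l2 sK] := K_bil; have [_ st] := top_slin.
split=> [z h Oz|z e Oz|h e].
- apply: lin_sub; first exact: l1.
  by apply: lin_scale; apply: lin_comp; [exact: top_lin|exact: l1].
- apply: lin_sub; first exact: l2.
  by apply: lin_scale; apply: (@lin_comp _ _ _ _ _ (fun h => K z h e)); [exact: top_lin|exact: l2].
- apply: sm_sub2 => //; apply: sm_scalec => //.
  exact: (sm_fam (fd_Z _ _) oOm oOm top_slin (fun z h => h) (@sm_id _ _ _) (sK h e)).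
Qed.

(** Differentiate g(top e, top u) = g(e, top u) in the fibre direction b, where dg = 2 C. As top e =
    0 and e is orthogonal to vertical vectors, only g(D, top u) = 2 C(b, e, top u) survives. *)
Lemma dv_top_fiber z b e : Om z -> top z e = 0 ->
  dv (fun y => top y e) z (0, b) = 2 *: top z (C z b e).
Proof.
move=> Oz te; set D := dv _ _ _.
(* Along a fibre the base point is fixed, so the vertical space is a fixed linear subspace, which
   contains the derivative of any curve in it. *)
have dver w : dv sg z.1 (dv (fun y => top y w) z (0, b)) = 0.
  have sS : slin U (fun x e => dv sg x e).
    by split=> [x Ux|w']; [apply: dv_linear; exact: sm_dif ssg Ux|exact: sm_dv].
  have := dv_fam (0, b) oU sS (ls_dom S Oz) (dif_fst z) (top_dif w Oz).
  have E1 y : Om y -> dv sg y.1 (top y w) = 0 by move=> Oy; exact: top_ver.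
  rewrite (dv_eq _ oOm Oz E1) dv_cst dv_fst /=.
  by rewrite (lin_0 (dv_linear (sm_dif (sm_dv _ ssg) (ls_dom S Oz)))) add0r => <-.
have Dg u : g z D (top z u) = 2 * cf l z b e (top z u).
  have gb := gf_bil oOm sl.
  have D1 := dv_bil oOm (fd_Z _ _) gb Oz (dif_id z) (top_dif e Oz) (top_dif u Oz) (0, b).
  have D2 := dv_bil oOm (fd_Z _ _) gb Oz (dif_id z) (dif_cst e z) (top_dif u Oz) (0, b).
  have E1 y : Om y -> g y (top y e) (top y u) = g y e (top y u).
    by move=> Oy; rewrite top_sa // top_top.
  move: D1; rewrite (dv_eq _ oOm Oz E1) D2 dv_id dv_cst !dv_gf0 te.
  rewrite (lin_0 (g1 _ Oz)) (lin_0 (cf_lin2 oOm sl _ _ Oz)) addr0 (lin_0 (g1 _ Oz)).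
  rewrite -(top_orth e Oz (dver u)) te (lin_0 (g1 _ Oz)) -/D; lra.
have D0 : dv sg z.1 D = 0 := dver e.
rewrite -(top_id Oz D0) -(lin_Z (top_lin Oz)).
apply: top_uniq => //; first exact: top_ver.
move=> u u0; rewrite (top_orth _ Oz u0) (gsym (2 *: _) u Oz) (lin_Z (g2 _ Oz)) (csfP H) //.
have := Dg u; rewrite (top_id Oz u0) => ->.
by rewrite (cf_sym12 oOm sl) // (cf_sym23 oOm sl).
Qed.

End Submersion.
End LocalFinsler.

(** * The tensors Qhat and Qtilde in a chart *)

HB.lock Definition Qhf {R : realType} {m n : nat} (l : 'rV[R]_m * 'rV[R]_m -> R)
    (Ga : 'rV[R]_m * 'rV[R]_m -> 'rV[R]_m -> 'rV[R]_m -> 'rV[R]_m)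
    (sg : 'rV[R]_m -> 'rV[R]_n) (z : 'rV[R]_m * 'rV[R]_m) (u0 w0 : 'rV[R]_m) : 'rV[R]_m :=
  let top := topf l sg z in
  let T := chif l Ga sg z (top z.2) in
  let C := csf l z in
  let u := top u0 in let w := top w0 in
  - top (T (C u w) + C (T u) w + C u (T w) + C (top (C u w)) (T z.2)
         - C (top (C u (T z.2))) w - C u (top (C w (T z.2)))).

HB.lock Definition Qtf {R : realType} {m n : nat} (l : 'rV[R]_m * 'rV[R]_m -> R)
    (Ga : 'rV[R]_m * 'rV[R]_m -> 'rV[R]_m -> 'rV[R]_m -> 'rV[R]_m)
    (sg : 'rV[R]_m -> 'rV[R]_n) (z : 'rV[R]_m * 'rV[R]_m) (x0 y0 : 'rV[R]_m) : 'rV[R]_m :=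
  let top := topf l sg z in
  let A := chif l Ga sg z (z.2 - top z.2) in
  let C := csf l z in
  let x := x0 - top x0 in let y := y0 - top y0 in
  let X := A (C x y) + C (A x) y + C x (A y) in
  X - top X.

(* The bracket term of the curvature is absent: coordinate fields commute. *)
Definition Rf {R : realType} {m : nat}
    (Ga : 'rV[R]_m * 'rV[R]_m -> 'rV[R]_m -> 'rV[R]_m -> 'rV[R]_m)
    (z : 'rV[R]_m * 'rV[R]_m) (h e b : 'rV[R]_m) : 'rV[R]_m :=
  cov Ga (fun y => Ga y e b) z h - cov Ga (fun y => Ga y h b) z e.

Definition Pf {R : realType} {m : nat}
    (Ga : 'rV[R]_m * 'rV[R]_m -> 'rV[R]_m -> 'rV[R]_m -> 'rV[R]_m)
    (z : 'rV[R]_m * 'rV[R]_m) (e h b : 'rV[R]_m) : 'rV[R]_m :=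
  dv (fun y => Ga y e h) z (0, b).

Definition covT {R : realType} {m : nat}
    (Ga Q : 'rV[R]_m * 'rV[R]_m -> 'rV[R]_m -> 'rV[R]_m -> 'rV[R]_m)
    (z : 'rV[R]_m * 'rV[R]_m) (x y w : 'rV[R]_m) : 'rV[R]_m :=
  cov Ga (fun y' => Q y' y w) z x - Q z (Ga z x y) w - Q z y (Ga z x w).

Section QTensors.
Context {R : realType} {m n : nat}.
Local Notation E := 'rV[R]_m.
Variables (Om : set (E * E)) (l : E * E -> R) (Ga : E * E -> E -> E -> E).
Variables (U : set E) (sg : E -> 'rV[R]_n).
Hypothesis H : local_finsler Om l Ga.
Hypothesis S : local_submersion Om l U sg.
Let oOm := lf_open H.
Let sl := lf_smooth H.
Local Notation top := (topf l sg).
Local Notation chi := (chif l Ga sg).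
Local Notation C := (csf l).
Local Notation Qh := (Qhf l Ga sg).
Local Notation Qt := (Qtf l Ga sg).

Let smt (e : E * E -> E) : smooth_on Om e -> smooth_on Om (fun z => top z (e z)).
Proof.
exact: (sm_fam (fd_Z _ _) oOm oOm (top_slin H S) (fun z h => h) (@sm_id _ _ _)).
Qed.

Let smc (e h : E * E -> E) : smooth_on Om e -> smooth_on Om h ->
  smooth_on Om (fun z => C z (e z) (h z)).
Proof.
exact: (sm_bil (fd_Z _ _) oOm oOm (csf_bil H) (fun z h => h) (@sm_id _ _ _)).
Qed.

Let smx (e h : E * E -> E) : smooth_on Om e -> smooth_on Om h ->
  smooth_on Om (fun z => chi z (e z) (h z)).
Proof.
exact: (sm_bil (fd_Z _ _) oOm oOm (chi_bil H S) (fun z h => h) (@sm_id _ _ _)).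
Qed.

Lemma Qhf_bil : sbil Om Qh.
Proof.
have [lc1 lc2 _] := csf_bil H; have [lx1 lx2 _] := chi_bil H S.
rewrite Qhf.unlock; split=> [z e Oz|z h Oz|e h] /=.
- have lt := top_lin H S Oz; have lT := lx1 z (top z z.2) Oz.
  have lC a := lc1 z a Oz; have lC' a := lc2 z a Oz.
  apply: (@lin_comp _ _ _ _ (fun w => - top z (chi z (top z z.2) (C z (top z e) w) + C z (chi z (top z z.2) (top z e)) w +
     C z (top z e) (chi z (top z z.2) w) + C z (top z (C z (top z e) w)) (chi z (top z z.2) z.2) -
     C z (top z (C z (top z e) (chi z (top z z.2) z.2))) w - C z (top z e) (top z (C z w (chi z (top z z.2) z.2))))) (top z) _ lt).
  apply: lin_opp; apply: (lin_comp lt).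
  repeat first [apply: lin_sub|apply: lin_add].
  + exact: (lin_comp lT (lC _)).
  + exact: lC.
  + exact: (lin_comp (lC _) lT).
  + apply: (@lin_comp _ _ _ _ (fun x => C z x (chi z (top z z.2) z.2))) => //.
    exact: (lin_comp lt (lC _)).
  + exact: lC.
  + apply: (lin_comp (lC _)); apply: (lin_comp lt); exact: lC'.
- have lt := top_lin H S Oz; have lT := lx1 z (top z z.2) Oz.
  have lC a := lc1 z a Oz; have lC' a := lc2 z a Oz.
  apply: (@lin_comp _ _ _ _ (fun w => - top z (chi z (top z z.2) (C z w (top z h)) + C z (chi z (top z z.2) w) (top z h) +
     C z w (chi z (top z z.2) (top z h)) + C z (top z (C z w (top z h))) (chi z (top z z.2) z.2) -
     C z (top z (C z w (chi z (top z z.2) z.2))) (top z h) - C z w (top z (C z (top z h) (chi z (top z z.2) z.2))))) (top z) _ lt).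
  apply: lin_opp; apply: (lin_comp lt).
  repeat first [apply: lin_sub|apply: lin_add].
  + apply: (lin_comp lT); exact: lC'.
  + exact: (@lin_comp _ _ _ _ (fun x => C z x (top z h)) _ (lC' _) lT).
  + exact: lC'.
  + apply: (@lin_comp _ _ _ _ (fun x => C z x (chi z (top z z.2) z.2))) => //.
    apply: (lin_comp lt); exact: lC'.
  + apply: (@lin_comp _ _ _ _ (fun x => C z x (top z h))) => //.
    apply: (lin_comp lt); exact: lC'.
  + exact: lC'.
- have s2 : smooth_on Om (snd : E * E -> E) by exact: sm_snd.
  have se : smooth_on Om (fun _ : E * E => e) by exact: sm_cst.
  have sh : smooth_on Om (fun _ : E * E => h) by exact: sm_cst.
  apply: sm_opp => //; apply: smt.
  do ![first [exact: s2|exact: se|exact: sh|apply: sm_sub2 => //|apply: sm_add => //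
    |apply: smt|apply: smc|apply: smx]].
Qed.

Lemma Qtf_bil : sbil Om Qt.
Proof.
have [lc1 lc2 _] := csf_bil H; have [lx1 lx2 _] := chi_bil H S.
rewrite Qtf.unlock; split=> [z e Oz|z h Oz|e h] /=.
- have lt := top_lin H S Oz; have lT := lx1 z (z.2 - top z z.2) Oz.
  have lC a := lc1 z a Oz; have lC' a := lc2 z a Oz.
  have lb : linear (fun w => w - top z w) by apply: lin_sub.
  set e1 := e - top z e; set A := chi z _ in lT *.
  have l1 : linear (fun w => A (C z e1 w) + C z (A e1) w + C z e1 (A w)).
    repeat apply: lin_add; [exact: (lin_comp lT (lC _))|exact: lC|exact: (lin_comp (lC _) lT)].
  exact: (lin_comp lb (lin_comp l1 lb)).
- have lt := top_lin H S Oz; have lT := lx1 z (z.2 - top z z.2) Oz.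
  have lC a := lc1 z a Oz; have lC' a := lc2 z a Oz.
  have lb : linear (fun w => w - top z w) by apply: lin_sub.
  set e1 := h - top z h; set A := chi z _ in lT *.
  have l1 : linear (fun w => A (C z w e1) + C z (A w) e1 + C z w (A e1)).
    repeat apply: lin_add.
    + by apply: (lin_comp lT); exact: lC'.
    + exact: (@lin_comp _ _ _ _ (fun x => C z x e1) _ (lC' _) lT).
    + exact: lC'.
  exact: (lin_comp lb (lin_comp l1 lb)).
- have s2 : smooth_on Om (snd : E * E -> E) by exact: sm_snd.
  have se : smooth_on Om (fun _ : E * E => e) by exact: sm_cst.
  have sh : smooth_on Om (fun _ : E * E => h) by exact: sm_cst.
  do ![first [exact: s2|exact: se|exact: sh|apply: sm_sub2 => //|apply: sm_add => //
    |apply: smt|apply: smc|apply: smx]].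
Qed.

Lemma Qhf_top z e h : Om z -> top z (Qh z e h) = Qh z e h.
Proof. by move=> Oz; rewrite Qhf.unlock /= (lin_N (top_lin H S Oz)) (top_top H S). Qed.

Lemma Qtf_top z e h : Om z -> top z (Qt z e h) = 0.
Proof. by move=> Oz; rewrite Qtf.unlock /= (lin_B (top_lin H S Oz)) (top_top H S) // subrr. Qed.

Lemma dv_top_vert z b w : Om z -> dv sg z.1 (dv (fun y => top y w) z (0, b)) = 0.
Proof.
move=> Oz; have oU := ls_open S; have ssg := ls_smooth S.
have sS : slin U (fun x e => dv sg x e).
  by split=> [x Ux|w']; [apply: dv_linear; exact: sm_dif ssg Ux|exact: sm_dv].
have := dv_fam (0, b) oU sS (ls_dom S Oz) (dif_fst z) (top_dif H S w Oz).
have E1 y : Om y -> dv sg y.1 (top y w) = 0 by move=> Oy; exact: (top_ver H S).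
rewrite (dv_eq _ oOm Oz E1) dv_cst dv_fst /=.
by rewrite (lin_0 (dv_linear (sm_dif (sm_dv _ ssg) (ls_dom S Oz)))) add0r => <-.
Qed.

(** The vertical space depends on the base point only. In terms of the derivative D: differentiating
    top o top = top gives D = D + top D, and top D = D because D is vertical. *)
Lemma dv_top_fiber_ver z b w : Om z -> top z w = w ->
  dv (fun y => top y w) z (0, b) = 0.
Proof.
move=> Oz tw; have := dv_fam (0, b) oOm (top_slin H S) Oz (dif_id z) (top_dif H S w Oz).
have E1 y : Om y -> top y (top y w) = top y w by move=> Oy; exact: (top_top H S).
rewrite (dv_eq _ oOm Oz E1) dv_id tw (top_id H S Oz (dv_top_vert b w Oz)) => E2.
by apply: (addIr (dv (fun y => top y w) z (0, b))); rewrite add0r -E2.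
Qed.

End QTensors.

(** * The Gauss equation in charts *)

Section Gauss.
Context {R : realType} {m n k : nat}.
Local Notation E := 'rV[R]_m.
Local Notation F := 'rV[R]_k.
Variables (Om : set (E * E)) (l : E * E -> R) (Ga : E * E -> E -> E -> E).
Variables (U : set E) (sg : E -> 'rV[R]_n).
Hypothesis H : local_finsler Om l Ga.
Hypothesis S : local_submersion Om l U sg.
Variables (OmF : set (F * F)) (lF : F * F -> R) (GaF : F * F -> F -> F -> F).
Hypothesis HF : local_finsler OmF lF GaF.
Variables (W : set F) (io : F -> E).

Definition tio (q : F * F) : E * E := (io q.1, dv io q.1 q.2).

Record local_fiber : Prop := LocalFiber {
  fb_open : open W;
  fb_smooth : smooth_on W io;
  fb_dom : forall q, OmF q -> W q.1 /\ Om (tio q);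
  fb_metric : forall q, OmF q -> lF q = l (tio q);
  fb_ver : forall q a, OmF q -> dv sg (io q.1) (dv io q.1 a) = 0;
  fb_range : forall q w, OmF q -> dv sg (io q.1) w = 0 -> exists a, dv io q.1 a = w
}.
Hypothesis B : local_fiber.

Let oOm := lf_open H.
Let sl := lf_smooth H.
Let oOmF := lf_open HF.
Let oW := fb_open B.
Let sio := fb_smooth B.
Local Notation g := (gf l).
Local Notation gF := (gf lF).
Local Notation top := (topf l sg).
Local Notation chi := (chif l Ga sg).
Local Notation K := (ktop l Ga sg).
Local Notation C := (csf l).
Local Notation Qh := (Qhf l Ga sg).
Local Notation J y a := (dv io y a).
Local Notation D2 y a b := (dv (fun y' => dv io y' b) y a).

Let g1 z h (Oz : Om z) := gf_lin1 sl h Oz.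
Let g2 z e (Oz : Om z) := gf_lin2 oOm sl e Oz.
Let gsym z e h (Oz : Om z) := gf_sym oOm sl e h Oz.

Let dio y : W y -> dif io y. Proof. exact: sm_dif. Qed.
Let dJ b y : W y -> dif (fun y' => J y' b) y.
Proof. by apply: sm_dif; exact: sm_dv. Qed.

Let Jslin : slin W (fun y b => J y b).
Proof. by split=> [y Wy|b]; [exact: dv_linear (dio Wy)|exact: sm_dv]. Qed.

Lemma dif_J q b : OmF q -> dif (fun q' : F * F => J q'.1 b) q.
Proof.
move=> Oq; have [Wq _] := fb_dom B Oq.
exact: (dif_comp (g := fun y => J y b) (dif_fst q) (dJ b Wq)).
Qed.

Lemma dv_J q b xi : OmF q -> dv (fun q' : F * F => J q'.1 b) q xi = D2 q.1 xi.1 b.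
Proof.
move=> Oq; have [Wq _] := fb_dom B Oq.
by rewrite (dv_comp xi (dif_fst q) (dJ b Wq)) dv_fst.
Qed.

Lemma dif_tio q : OmF q -> dif tio q.
Proof.
move=> Oq; have [Wq _] := fb_dom B Oq; apply: dif_pair.
  by apply: (dif_comp (dif_fst q)); exact: dio.
exact: (dif_fam oW Jslin Wq (dif_fst q) (dif_snd q)).
Qed.

Lemma dv_tio q xi : OmF q -> dv tio q xi = (J q.1 xi.1, D2 q.1 xi.1 q.2 + J q.1 xi.2).
Proof.
move=> Oq; have [Wq _] := fb_dom B Oq.
have d1 : dif (fun q' : F * F => io q'.1) q by apply: (dif_comp (dif_fst q)); exact: dio.
have d2 := dif_fam oW Jslin Wq (dif_fst q) (dif_snd q).
rewrite (dv_pair xi d1 d2) (dv_comp xi (dif_fst q) (dio Wq)) dv_fst; congr (_, _).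
by rewrite (dv_fam xi oW Jslin Wq (dif_fst q) (dif_snd q)) dv_fst dv_snd.
Qed.

Lemma D2_sym q a b : OmF q -> D2 q.1 a b = D2 q.1 b a.
Proof. by move=> Oq; have [Wq _] := fb_dom B Oq; exact: (dv_schwarz_rV _ _ oW Wq sio). Qed.

Lemma D2_0 q b : OmF q -> D2 q.1 0 b = 0.
Proof. by move=> Oq; have [Wq _] := fb_dom B Oq; rewrite (lin_0 (dv_linear (dJ b Wq))). Qed.

Lemma dv_lF q b : OmF q -> dv lF q (0, b) = dv l (tio q) (0, J q.1 b).
Proof.
move=> Oq; have [Wq Oz] := fb_dom B Oq.
rewrite (dv_eq _ oOmF Oq (fb_metric B)) (dv_comp _ (dif_tio Oq) (sm_dif sl Oz)).
rewrite (dv_tio _ Oq) /= (D2_0 _ Oq) add0r.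
by rewrite (lin_0 (dv_linear (dio Wq))).
Qed.

Lemma gF_eq q a b : OmF q -> gF q a b = g (tio q) (J q.1 a) (J q.1 b).
Proof.
move=> Oq; have [Wq Oz] := fb_dom B Oq; rewrite /gf; congr (_ * _).
have E1 q' : OmF q' -> dv lF q' (0, b) = dv l (tio q') (0, J q'.1 b) by exact: dv_lF.
have sB : slin Om (fun z e => dv l z (0, e)).
  split=> [y Oy a' u v|e]; last exact: sm_dv.
  by rewrite inr_lin (dv_linear (sm_dif sl Oy)).
rewrite (dv_eq _ oOmF Oq E1) (dv_fam _ oOm sB Oz (dif_tio Oq) (dif_J b Oq)).
rewrite (dv_J _ _ Oq) (dv_tio _ Oq) /= !(D2_0 _ Oq) add0r.
rewrite (lin_0 (dv_linear (dio Wq))).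
by rewrite (lin_0 (dv_linear (sm_dif sl Oz))) addr0.
Qed.

(* The difference of the ambient and the intrinsic connection: by [gauss_formula]
   it is Qhat + T. *)
Definition Sg q a b : E :=
  D2 q.1 a b + Ga (tio q) (J q.1 a) (J q.1 b) - J q.1 (GaF q a b).

Lemma Sg_sym q a b : OmF q -> Sg q a b = Sg q b a.
Proof.
move=> Oq; have [Wq Oz] := fb_dom B Oq.
by rewrite /Sg D2_sym // (lf_sym H) // (lf_sym HF).
Qed.

Lemma dv_tioh q c : OmF q -> dv tio q (c, - GaF q c q.2) =
  (J q.1 c, Sg q c q.2 - Ga (tio q) (J q.1 c) (tio q).2).
Proof.
move=> Oq; have [Wq Oz] := fb_dom B Oq.
rewrite (dv_tio _ Oq) /= (lin_N (dv_linear (dio Wq))); congr (_, _).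
rewrite /Sg /tio /=; move: (D2 _ _ _) (Ga _ _ _) (J _ (GaF _ _ _)) => x y w.
by apply/rowP => j; rewrite !mxE; ring.
Qed.

Lemma J_ver q a : OmF q -> top (tio q) (J q.1 a) = J q.1 a.
Proof.
by move=> Oq; have [Wq Oz] := fb_dom B Oq; apply: (top_id H S Oz); exact: (fb_ver B).
Qed.

(** Metric compatibility on the fibre minus that of the ambient space. The tangent map of io sends
    the lift of a to the ambient lift plus the fibre vector Sg a v, and moving g by the latter costs
    the Cartan term. *)
Lemma Sg_metric q a b c : OmF q ->
  g (tio q) (Sg q a b) (J q.1 c) + g (tio q) (J q.1 b) (Sg q a c)
  + 2 * cf l (tio q) (Sg q a q.2) (J q.1 b) (J q.1 c) = 0.
Proof.
move=> Oq; have [Wq Oz] := fb_dom B Oq.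
have := lf_compat HF a b c Oq.
rewrite !gF_eq //.
have E1 q' : OmF q' -> gF q' b c = g (tio q') (J q'.1 b) (J q'.1 c) by move=> O'; exact: gF_eq.
rewrite (dv_eq _ oOmF Oq E1).
rewrite (dv_bil oOm (fd_Z _ _) (gf_bil oOm sl) Oz (dif_tio Oq) (dif_J b Oq) (dif_J c Oq)).
rewrite !(dv_J _ _ Oq) (dv_tioh _ Oq) (dv_g H) //= /Sg.
rewrite !(lin_B (g1 _ Oz)) !(lin_D (g1 _ Oz)) !(lin_B (g2 _ Oz)) !(lin_D (g2 _ Oz)).
lra.
Qed.

(** Differentiate top (J b) = J b along the lift of a. The fibre component Sg a v of the direction
    does not contribute, by [dv_top_fiber_ver]. *)
Lemma chi_Sg q a b : OmF q ->
  chi (tio q) (J q.1 a) (J q.1 b) = Sg q a b - top (tio q) (Sg q a b).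
Proof.
move=> Oq; have [Wq Oz] := fb_dom B Oq; have lt := top_lin H S Oz.
rewrite (chi_ver H S _ Oz (J_ver b Oq)).
have := dv_fam (a, - GaF q a q.2) oOm (top_slin H S) Oz (dif_tio Oq) (dif_J b Oq).
have E1 q' : OmF q' -> top (tio q') (J q'.1 b) = J q'.1 b by move=> O'; exact: J_ver.
rewrite (dv_eq _ oOmF Oq E1) (dv_J _ _ Oq) (dv_tioh _ Oq) (dv_top H S) //=.
rewrite (dv_top_fiber_ver H S _ Oz (J_ver b Oq)) (J_ver b Oq).
rewrite /Sg (lin_B lt) (lin_D lt) (J_ver _ Oq).
move: (D2 _ _ _) (K _ _ _) (Ga _ _ _) (top _ (D2 _ _ _)) (top _ (Ga _ _ _)) (J _ (GaF _ _ _)).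
move=> a1 a2 a3 a4 a5 a6 E2; apply/rowP => j; move/rowP: E2 => /(_ j); rewrite !mxE; lra.
Qed.

Lemma ver_ext q (w w' : E) : OmF q -> top (tio q) w = w -> top (tio q) w' = w' ->
  (forall c, g (tio q) w (J q.1 c) = g (tio q) w' (J q.1 c)) -> w = w'.
Proof.
move=> Oq tw tw' h; have [Wq Oz] := fb_dom B Oq.
rewrite -tw; apply: (top_uniq H S Oz); first exact: (ver_top H S Oz tw').
by move=> u u0; have [c <-] := fb_range B Oq u0; rewrite h.
Qed.

(** The horizontal part is [chi_Sg]. For the vertical part, the cyclic combination of [Sg_metric]
    expresses Sg by Cartan terms in Sg(., v), which are resolved by putting both arguments, then
    one, equal to v. Substituting the outcome reproduces the formula of Qhat. *)
Lemma gauss_formula q a b : OmF q ->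
  Sg q a b = Qh (tio q) (J q.1 a) (J q.1 b) + chi (tio q) (J q.1 a) (J q.1 b).
Proof.
move=> Oq; have [Wq Oz] := fb_dom B Oq; have lt := top_lin H S Oz.
suff Et : top (tio q) (Sg q a b) = Qh (tio q) (J q.1 a) (J q.1 b).
  by rewrite chi_Sg // -Et addrC subrK.
set z := tio q in Oz lt *.
have vE : z.2 = J q.1 q.2 by [].
have tv : top z z.2 = z.2 by exact: J_ver.
pose t := chi z z.2 z.2.
have Cs b' e h := cf_sym12 oOm sl b' e h Oz.
have Cs' b' e h := cf_sym23 oOm sl b' e h Oz.
pose c3 := cf l z.
have c1 e h : linear (fun x => c3 x e h) by move=> *; apply: (cf_lin1 oOm sl).
have cv e h : c3 e z.2 h = 0 by exact: (cf_v oOm sl (lf_hom H)).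
have cv3 e h : c3 e h z.2 = 0 by rewrite /c3 Cs'; exact: cv.
(* Koszul: two cyclic instances of [Sg_metric] minus the third, by the symmetry of Sg. *)
have F3 a' b' c' : g z (Sg q a' b') (J q.1 c') =
    - c3 (Sg q a' q.2) (J q.1 b') (J q.1 c') - c3 (Sg q b' q.2) (J q.1 c') (J q.1 a')
    + c3 (Sg q c' q.2) (J q.1 a') (J q.1 b').
  have h1 := Sg_metric a' b' c' Oq; have h2 := Sg_metric b' c' a' Oq.
  have h3 := Sg_metric c' a' b' Oq.
  rewrite (gsym (J q.1 b') _ Oz) in h1; rewrite (gsym (J q.1 c') _ Oz) in h2.
  rewrite (gsym (J q.1 a') _ Oz) in h3.
  rewrite (Sg_sym b' a' Oq) in h2; rewrite (Sg_sym c' a' Oq) (Sg_sym c' b' Oq) in h3.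
  by rewrite -/z in h1 h2 h3; rewrite /c3; lra.
have Fv a' c' : g z (Sg q a' q.2) (J q.1 c') = - c3 (Sg q q.2 q.2) (J q.1 c') (J q.1 a').
  by rewrite F3 -vE cv cv3; lra.
(* Every remaining Cartan term has v as an argument; hence Sg v v = T_v v, the vector t below. *)
have Svv : top z (Sg q q.2 q.2) = 0.
  apply: (ver_ext Oq); rewrite -/z; first exact: (top_top H S).
    by rewrite (lin_0 lt).
  move=> c; rewrite (top_orth H S _ Oz (fb_ver B c Oq)) Fv -vE cv3 oppr0.
  by rewrite (lin_0 (g1 _ Oz)).
have tE : Sg q q.2 q.2 = t by have := chi_Sg q.2 q.2 Oq; rewrite -/z Svv subr0.
have TS a' b' : chi z (J q.1 a') (J q.1 b') = chi z (J q.1 b') (J q.1 a').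
  by rewrite /z !chi_Sg // Sg_sym.
(* The one surviving Cartan term involves Sg v v = t. Inserting this value of Sg(., v) into [F3]
   creates the nested terms of Qhat. *)
have NE a' : Sg q a' q.2 = chi z z.2 (J q.1 a') - top z (C z (J q.1 a') t).
  have -> : chi z z.2 (J q.1 a') = Sg q a' q.2 - top z (Sg q a' q.2).
    by rewrite vE TS /z chi_Sg.
  suff -> : top z (Sg q a' q.2) = - top z (C z (J q.1 a') t).
    by rewrite opprK addrK.
  apply: (ver_ext Oq); rewrite -/z; first exact: (top_top H S).
    by rewrite (lin_N lt) (top_top H S).
  move=> c; rewrite (top_orth H S _ Oz (fb_ver B c Oq)) Fv tE.
  rewrite (lin_N (g1 _ Oz)) (top_orth H S _ Oz (fb_ver B c Oq)) (gsym (C z _ _) _ Oz).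
  by rewrite (csfP H) // /c3 Cs Cs'.
apply: (ver_ext Oq); rewrite -/z; first exact: (top_top H S).
  exact: (Qhf_top H S).
move=> c; rewrite (top_orth H S _ Oz (fb_ver B c Oq)) F3 !NE.
rewrite Qhf.unlock; cbv zeta beta.
rewrite tv !(J_ver _ Oq) -/t (lin_N (g1 _ Oz)).
rewrite (top_orth H S _ Oz (fb_ver B c Oq)).
set u := J q.1 a; set w := J q.1 b; set x := J q.1 c.
rewrite !(lin_B (g1 _ Oz)) !(lin_D (g1 _ Oz)) !(lin_B (c1 _ _)).
have gC e h : g z (C z e h) x = c3 x e h by rewrite gsym // (csfP H).
rewrite !gC (chi_skew H S _ _ _ Oz).
(* Both sides are g(top C(u, w), C(x, t)): C^sharp represents the Cartan form and [top] is
   self-adjoint. *)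
have E1 : c3 x (top z (C z u w)) t = c3 (top z (C z x t)) u w.
  rewrite {1}/c3 Cs -(csfP H _ _ _ Oz) (top_sa H S _ _ Oz).
  by rewrite (gsym _ _ Oz) (csfP H _ _ _ Oz).
have rot p r o : c3 p r o = c3 r o p by rewrite /c3 Cs Cs'.
rewrite (gsym (C z u w) _ Oz) (csfP H _ _ _ Oz) -/c3 E1.
rewrite (rot x (chi z z.2 u) w) (rot x (top z (C z u t)) w).
rewrite -(rot (chi z z.2 w) x u) -(rot (top z (C z w t)) x u).
ring.
Qed.

(** Stands for Qhat pulled back to the fibre, whose covariant derivative is taken there; [qfib]
    later supplies it. *)
Variable qF : F * F -> F -> F -> F.
Hypothesis qF_smooth : forall a b, smooth_on OmF (fun q => qF q a b).
Hypothesis qFP : forall q a b, OmF q -> J q.1 (qF q a b) = Qh (tio q) (J q.1 a) (J q.1 b).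

Let dQ q a b : OmF q -> dif (fun q' => qF q' a b) q.
Proof. exact: sm_dif. Qed.

Let dGaF q a b : OmF q -> dif (fun q' => GaF q' a b) q.
Proof. by have [_ _ s] := lf_bil HF; exact: sm_dif. Qed.

Let dGa z a b : Om z -> dif (fun z' => Ga z' a b) z.
Proof. by have [_ _ s] := lf_bil H; exact: sm_dif. Qed.

Let lift q c : F * F := (c, - GaF q c q.2).

Lemma dv_covF (X : F * F -> F) q c : dif X q ->
  dv X q (c, - GaF q c q.2) = cov GaF X q c - GaF q c (X q).
Proof.
move=> dX; have := dv_cov GaF c 0 dX.
by rewrite add0r (lin_0 (dv_linear dX)) addr0.
Qed.

Lemma dv_Jvar (X : F * F -> F) q c : OmF q -> dif X q ->
  dv (fun q' => J q'.1 (X q')) q (lift q c) =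
  D2 q.1 c (X q) + J q.1 (cov GaF X q c) - J q.1 (GaF q c (X q)).
Proof.
move=> Oq dX; have [Wq Oz] := fb_dom B Oq.
have := dv_fam (lift q c) oW Jslin Wq (dif_fst q) dX.
rewrite dv_fst /= dv_covF // (lin_B (dv_linear (dio Wq))) => ->.
by rewrite addrA.
Qed.

(* The identity [gauss_formula] differentiated along the horizontal lift of c,
   projected to the vertical space. *)
Lemma gauss_derived q a b c : OmF q ->
  let z := tio q in
  let N := Sg q c q.2 in
  let T x y := chi z (J q.1 x) y in
  let Q x y := Qh z (J q.1 x) (J q.1 y) in
  top z (dv (fun y => D2 y a b) q.1 c) + top z (cov Ga (fun z' => Ga z' (J q.1 a) (J q.1 b)) z (J q.1 c))
  - top z (Ga z (J q.1 c) (Ga z (J q.1 a) (J q.1 b))) + top z (Pf Ga z (J q.1 a) (J q.1 b) N)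
  + top z (Ga z (D2 q.1 c a) (J q.1 b)) + top z (Ga z (J q.1 a) (D2 q.1 c b))
  = top z (D2 q.1 c (GaF q a b)) + J q.1 (cov GaF (fun q' => GaF q' a b) q c)
    - J q.1 (GaF q c (GaF q a b))
    + (top z (D2 q.1 c (qF q a b)) + J q.1 (cov GaF (fun q' => qF q' a b) q c) - J q.1 (GaF q c (qF q a b)))
    + (T c (T a (J q.1 b)) - top z (Ga z (J q.1 c) (T a (J q.1 b)))
       - 2 *: top z (C z (T a (J q.1 b)) N)).
Proof.
move=> Oq z N T Q; have [Wq Oz] := fb_dom B Oq; have lt := top_lin H S Oz.
have E1 q' : OmF q' -> D2 q'.1 a b + Ga (tio q') (J q'.1 a) (J q'.1 b) =
    J q'.1 (GaF q' a b) + J q'.1 (qF q' a b) + chi (tio q') (J q'.1 a) (J q'.1 b).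
  move=> O'; have := gauss_formula a b O'; rewrite /Sg -(qFP _ _ O').
  move: (D2 _ _ _) (Ga _ _ _) (J _ (GaF _ _ _)) (J _ (qF _ _ _)) (chi _ _ _).
  move=> x1 x2 x3 x4 x5 E0; apply/rowP => j; move/rowP: E0 => /(_ j); rewrite !mxE; lra.
have d2 : dif (fun q' : F * F => D2 q'.1 a b) q.
  exact: (dif_comp (g := fun y => D2 y a b) (dif_fst q) (sm_dif (sm_dv a (sm_dv b sio)) Wq)).
have dG : dif (fun q' : F * F => Ga (tio q') (J q'.1 a) (J q'.1 b)) q.
  exact: (dif_bil oOm (fd_Z _ _) (lf_bil H) Oz (dif_tio Oq) (dif_J a Oq) (dif_J b Oq)).
have dX : dif (fun q' : F * F => chi (tio q') (J q'.1 a) (J q'.1 b)) q.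
  exact: (dif_bil oOm (fd_Z _ _) (chi_bil H S) Oz (dif_tio Oq) (dif_J a Oq) (dif_J b Oq)).
have dJ1 : dif (fun q' : F * F => J q'.1 (GaF q' a b)) q.
  exact: (dif_fam oW Jslin Wq (dif_fst q) (dGaF a b Oq)).
have dJ2 : dif (fun q' : F * F => J q'.1 (qF q' a b)) q.
  exact: (dif_fam oW Jslin Wq (dif_fst q) (dQ a b Oq)).
have := dv_eq (lift q c) oOmF Oq E1.
rewrite (dv_add _ d2 dG) (dv_add _ (dif_add dJ1 dJ2) dX) (dv_add _ dJ1 dJ2).
rewrite (dv_Jvar _ Oq (dGaF a b Oq)) (dv_Jvar _ Oq (dQ a b Oq)).
rewrite (dv_comp (lift q c) (dif_fst q) (sm_dif (sm_dv a (sm_dv b sio)) Wq)) dv_fst /=.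
rewrite (dv_bil oOm (fd_Z _ _) (lf_bil H) Oz (dif_tio Oq) (dif_J a Oq) (dif_J b Oq)).
rewrite !(dv_J _ _ Oq) (dv_tioh _ Oq) (dv_cov _ _ _ (dGa _ _ Oz)) -/(Pf Ga z (J q.1 a) (J q.1 b) N) /=.
set Y := dv (fun q' => chi (tio q') _ _) q _.
(* Differentiate top (T_a b) = 0. The horizontal variation of the projection yields T_c T_a b, as K
   = - chi on horizontal vectors, and its variation along the fibre vector N yields - 2 top C. *)
have tY : top z Y = T c (T a (J q.1 b)) - top z (Ga z (J q.1 c) (T a (J q.1 b)))
    - 2 *: top z (C z (T a (J q.1 b)) N).
  have t0 : top z (T a (J q.1 b)) = 0.
    by apply: (chi_ver_top H S _ Oz); exact: J_ver.
  have E2 q' : OmF q' -> top (tio q') (chi (tio q') (J q'.1 a) (J q'.1 b)) = 0.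
    move=> O'; have [_ Oz'] := fb_dom B O'.
    by apply: (chi_ver_top H S _ Oz'); exact: J_ver.
  have := dv_fam (lift q c) oOm (top_slin H S) Oz (dif_tio Oq) dX.
  rewrite (dv_eq _ oOmF Oq E2) dv_cst (dv_tioh _ Oq) (dv_top H S) // -/z -/(T a (J q.1 b)) -/Y t0.
  rewrite (dv_top_fiber H S _ Oz t0) -/N (lin_0 (ga_lin2 H _ Oz)) subr0.
  rewrite (csf_sym H _ _ Oz) [T c (T a _)](chi_hor H S _ Oz t0).
  move: (K _ _ _) (top z (Ga _ _ _)) (top z (C _ _ _)) (top z Y) => x1 x2 x3 x4 E3.
  apply/rowP => j; move/rowP: E3 => /(_ j); rewrite !mxE; lra.
move=> /(congr1 (top z)); rewrite !(lin_D lt) !(lin_N lt) tY.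
rewrite !(J_ver _ Oq) -/z => E3.
apply/rowP => j; move/rowP: E3 => /(_ j); rewrite !mxE; lra.
Qed.

(** Antisymmetrise [gauss_derived] in a and c. The nested products of Ga are rewritten by
    [gauss_formula], after which all second and third derivatives of io cancel in pairs. *)
Lemma gauss_local q a b c : OmF q ->
  let z := tio q in
  let T x y := chi z (J q.1 x) y in
  let Q := Qh z in
  top z (Rf Ga z (J q.1 c) (J q.1 a) (J q.1 b)) =
    J q.1 (Rf GaF q c a b) + T c (T a (J q.1 b)) - T a (T c (J q.1 b))
    + J q.1 (covT GaF qF q c a b) - J q.1 (covT GaF qF q a c b)
    + Q (J q.1 c) (Q (J q.1 a) (J q.1 b)) - Q (J q.1 a) (Q (J q.1 c) (J q.1 b))
    - top z (Pf Ga z (J q.1 a) (J q.1 b) (Q (J q.1 c) z.2 + T c z.2))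
    + top z (Pf Ga z (J q.1 c) (J q.1 b) (Q (J q.1 a) z.2 + T a z.2))
    - 2 *: top z (C z (T a (J q.1 b)) (Q (J q.1 c) z.2 + T c z.2))
    + 2 *: top z (C z (T c (J q.1 b)) (Q (J q.1 a) z.2 + T a z.2)).
Proof.
move=> Oq z T Q; have [Wq Oz] := fb_dom B Oq; have lt := top_lin H S Oz.
have lJ := dv_linear (dio Wq).
have G1 := gauss_derived a b c Oq; have G2 := gauss_derived c b a Oq.
rewrite /= -/z in G1 G2.
have NE x : Sg q x q.2 = Q (J q.1 x) z.2 + T x z.2 by exact: gauss_formula.
rewrite !NE in G1 G2.
(* Third derivatives of io are symmetric, so they drop out of the difference. *)
have D3 : dv (fun y => D2 y a b) q.1 c = dv (fun y => D2 y c b) q.1 a.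
  exact: (dv_schwarz_rV _ _ oW Wq (sm_dv b sio)).
rewrite D3 (D2_sym c a Oq) in G1.
have tD x y : top z (D2 q.1 x y) = J q.1 (GaF q x y) + Q (J q.1 x) (J q.1 y) - top z (Ga z (J q.1 x) (J q.1 y)).
  have := gauss_formula x y Oq; rewrite -/z -/Q /Sg => /(congr1 (top z)).
  rewrite (lin_B lt) !(lin_D lt) (J_ver _ Oq) (Qhf_top H S _ _ Oz).
  rewrite (chi_ver_top H S _ Oz (J_ver y Oq)) addr0 -/z -/Q => E0.
  by apply/rowP => j; move/rowP: E0 => /(_ j); rewrite !mxE; lra.
(* Used for the inner factor of Ga o Ga: its parts are tensorial, intrinsic to the fibre, or the D2
   term already present on the left of [gauss_derived]. *)
have GG x y : Ga z (J q.1 x) (J q.1 y) = J q.1 (GaF q x y) + Q (J q.1 x) (J q.1 y) + T x (J q.1 y) - D2 q.1 x y.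
  have := gauss_formula x y Oq; rewrite -/z -/Q /Sg -/(T x (J q.1 y)).
  move: (D2 _ _ _) (Ga _ _ _) (J _ (GaF _ _ _)) (Q _ _) (T _ _).
  move=> x1 x2 x3 x4 x5 E0; apply/rowP => j; move/rowP: E0 => /(_ j); rewrite !mxE; lra.
have lg x := ga_lin2 H x Oz.
have GGt x y w : top z (Ga z (J q.1 w) (Ga z (J q.1 x) (J q.1 y))) =
   top z (Ga z (J q.1 w) (J q.1 (GaF q x y))) + top z (Ga z (J q.1 w) (J q.1 (qF q x y)))
   + top z (Ga z (J q.1 w) (T x (J q.1 y))) - top z (Ga z (J q.1 w) (D2 q.1 x y)).
  by rewrite GG (qFP _ _ Oq) (lin_B (lg _)) !(lin_D (lg _)) (lin_B lt) !(lin_D lt).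
rewrite !GGt !tD !(qFP _ _ Oq) in G1 G2.
rewrite /Rf /covT !(lin_B lt) !(lin_B lJ) !(qFP _ _ Oq) (lf_sym HF c a Oq).
rewrite -/Q in G1 G2 *.
apply/rowP => j; move/rowP: G1 => /(_ j) G1; move/rowP: G2 => /(_ j) G2.
rewrite !mxE in G1 G2 *; rewrite /T in G1 G2 *; lra.
Qed.

End Gauss.

(** * The dual Gauss equation in charts *)

Section DualGauss.
Context {R : realType} {m n : nat}.
Local Notation E := 'rV[R]_m.
Local Notation F := 'rV[R]_n.
Variables (Om : set (E * E)) (l : E * E -> R) (Ga : E * E -> E -> E -> E).
Variables (U : set E) (sg : E -> F).
Hypothesis H : local_finsler Om l Ga.
Hypothesis S : local_submersion Om l U sg.
Variables (OmB : set (F * F)) (lB : F * F -> R) (GaB : F * F -> F -> F -> F).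
Hypothesis HB : local_finsler OmB lB GaB.

Definition tsg (z : E * E) : F * F := (sg z.1, dv sg z.1 z.2).

Local Notation g := (gf l).
Local Notation gB := (gf lB).
Local Notation top := (topf l sg).
Local Notation chi := (chif l Ga sg).
Local Notation K := (ktop l Ga sg).
Local Notation C := (csf l).
Local Notation Qt := (Qtf l Ga sg).
Local Notation J x a := (dv sg x a).
Local Notation D2 x a b := (dv (fun y => dv sg y b) x a).

Definition hor (z : E * E) : Prop := Om z /\ top z z.2 = 0.

Hypothesis iso : forall z, hor z -> OmB (tsg z) /\ l z = lB (tsg z).

Let oOm := lf_open H.
Let sl := lf_smooth H.
Let oOmB := lf_open HB.
Let slB := lf_smooth HB.
Let oU := ls_open S.
Let ssg := ls_smooth S.
Let g1 z h (Oz : Om z) := gf_lin1 sl h Oz.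
Let g2 z e (Oz : Om z) := gf_lin2 oOm sl e Oz.
Let gsym z e h (Oz : Om z) := gf_sym oOm sl e h Oz.
Let gB1 z h (Oz : OmB z) := gf_lin1 slB h Oz.
Let gB2 z e (Oz : OmB z) := gf_lin2 oOmB slB e Oz.
Let gBsym z e h (Oz : OmB z) := gf_sym oOmB slB e h Oz.
Let lK1 z h : Om z -> linear (K z h). Proof. by have [+ _ _] := K_bil H S; apply. Qed.
Let lK2 z e : Om z -> linear (fun h => K z h e). Proof. by have [_ + _] := K_bil H S; apply. Qed.
Let dsg x : U x -> dif sg x. Proof. exact: sm_dif. Qed.
Let dJ b x : U x -> dif (fun y => J y b) x.
Proof. by apply: sm_dif; exact: sm_dv. Qed.
Let Jslin : slin U (fun y b => J y b).
Proof. by split=> [y Wy|b]; [exact: dv_linear (dsg Wy)|exact: sm_dv]. Qed.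
Let Jlin x : U x -> linear (dv sg x). Proof. by move=> /dsg; exact: dv_linear. Qed.
Let Uz z : Om z -> U z.1. Proof. exact: (ls_dom S). Qed.

Lemma D2_bil : sbil U (fun x a b => D2 x a b).
Proof.
split=> [x a Ux|x b Ux|a b].
- move=> k u v /=.
  have E1 y : U y -> J y (k *: u + v) = k *: J y u + J y v by move=> Uy; exact: (Jlin Uy).
  rewrite (dv_eq a oU Ux E1) dv_add ?dv_scalec //; try exact: dJ.
  by apply: dif_scalec; exact: dJ.
- exact: (dv_linear (dJ b Ux)).
- by do 2 apply: sm_dv.
Qed.

Lemma D2s_sym x a b : U x -> D2 x a b = D2 x b a.
Proof. by move=> Ux; exact: (dv_schwarz_rV _ _ oU Ux ssg). Qed.

Lemma dif_tsg z : Om z -> dif tsg z.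
Proof.
move=> Oz; apply: dif_pair; first exact: (dif_comp (dif_fst z) (dsg (Uz Oz))).
exact: (dif_fam oU Jslin (Uz Oz) (dif_fst z) (dif_snd z)).
Qed.

Lemma dv_tsg z xi : Om z -> dv tsg z xi = (J z.1 xi.1, D2 z.1 xi.1 z.2 + J z.1 xi.2).
Proof.
move=> Oz; have Ux := Uz Oz.
have d1 : dif (fun z' : E * E => sg z'.1) z by exact: (dif_comp (dif_fst z) (dsg Ux)).
have d2 := dif_fam oU Jslin Ux (dif_fst z) (dif_snd z).
rewrite (dv_pair xi d1 d2) (dv_comp xi (dif_fst z) (dsg Ux)) dv_fst; congr (_, _).
by rewrite (dv_fam xi oU Jslin Ux (dif_fst z) (dif_snd z)) dv_fst dv_snd.
Qed.

Lemma dif_Jz z b : Om z -> dif (fun z' : E * E => J z'.1 b) z.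
Proof. by move=> Oz; exact: (dif_comp (g := fun y => J y b) (dif_fst z) (dJ b (Uz Oz))). Qed.

Lemma dv_Jz z b xi : Om z -> dv (fun z' : E * E => J z'.1 b) z xi = D2 z.1 xi.1 b.
Proof. by move=> Oz; rewrite (dv_comp xi (dif_fst z) (dJ b (Uz Oz))) dv_fst. Qed.

Lemma J_top z e : Om z -> J z.1 (top z e) = 0.
Proof. exact: (top_ver H S). Qed.

(** Projecting nearby vertical spaces onto the one at z is injective. Horizontality of z' can
    therefore be tested by an equation with values in one fixed subspace, as [level_vanish]
    demands. *)
Lemma near_top_inj z : Om z -> exists2 A : set (E * E), open A /\ A z &
  forall z' e, A z' -> Om z' /\ (top z (top z' e) = 0 -> top z' e = 0).
Proof.
move=> Oz.
(* S1 lifts vectors of the base at the point z. *)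
have [S1 HS1] : exists S1 : 'M[R]_(n, m), S1 *m dmat sg z = 1%:M.
  have ex j : exists e : E, J z.1 e = delta_mx 0 j by exact: (ls_surj S (Uz Oz)).
  have /choice[e He] := ex; exists (\matrix_j e j).
  apply/row_matrixP => j; rewrite row_mul rowK row1 -He.
  by rewrite (dmatE S (e j) Oz).
pose P0 : 'M[R]_m := \matrix_i top z (delta_mx 0 i).
have P0E e : e *m P0 = top z e.
  rewrite [RHS](lin_delta e (top_lin H S Oz)) mulmx_sum_row.
  by apply: eq_bigr => i _; rewrite rowK.
(* On vectors vertical at z' this is just the projection [top z]. At z itself it is injective, so
   its determinant is nonzero there and, by continuity, nearby. *)
pose N (z' : E * E) := P0 + dmat sg z' *m S1.
have sN : smooth_on Om (fun z' => \det (N z')).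
  apply: sm_det => //; apply: sm_add => //; first exact: sm_cst.
  apply: sm_mulmx => //; last exact: sm_cst.
  apply: sm_mx => // i j; under eq_fun do rewrite mxE.
  apply: sm_entry => //.
  apply: (@sm_comp _ _ _ _ Om U fst (fun x => dv sg x (delta_mx 0 i)) (fd_rV _) oOm oU (ls_dom S)); [exact: sm_dv|exact: sm_fst].
have Nz : \det (N z) != 0.
  have : N z \in unitmx.
    apply: mx_unit_inj => u; rewrite /N mulmxDr mulmxA => u0.
    have uD : u *m dmat sg z = 0.
      have := congr1 (mulmx^~ (dmat sg z)) u0.
      rewrite mul0mx mulmxDl -[u *m dmat sg z *m S1 *m _]mulmxA HS1 mulmx1.
      by rewrite P0E (dmatE S _ Oz) (J_top _ Oz) add0r.
    move: u0; rewrite uD mul0mx addr0 P0E => <-.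
    by rewrite (top_id H S Oz) // -(dmatE S _ Oz) uD.
  by rewrite unitmxE unitfE.
have nA : \forall z' \near z, Om z' /\ \det (N z') != 0.
  apply: filterI; first exact: open_nbhs_nbhs.
  have c := differentiable_continuous (sm_differentiable sN Oz).
  exact: (cvgr_neq0 _ c Nz).
exists [set z' | Om z' /\ \det (N z') != 0]°.
  by split; [exact: open_interior|exact: nA].
move=> z' e /interior_subset[Oz' dN]; split=> // t0.
have uN : N z' \in unitmx by rewrite unitmxE unitfE.
have : top z' e *m N z' = 0.
  by rewrite /N mulmxDr mulmxA P0E t0 (dmatE S _ Oz') (J_top _ Oz') mul0mx addr0.
by move=> /(congr1 (mulmx^~ (invmx (N z')))); rewrite mulmxK // mul0mx.
Qed.

Definition inrE (c : E) : E * E := (0, c).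
Lemma inrE_linear : linear inrE.
Proof. by move=> a u v; exact: inr_lin. Qed.
HB.instance Definition _ := GRing.isLinear.Build R E (E * E)%type _ inrE inrE_linear.
Lemma inrE_continuous : continuous inrE.
Proof.
move=> c; apply: differentiable_continuous; rewrite -difE.
exact: (dif_pair (dif_cst 0 c) (dif_id c)).
Qed.

(* The directions (h, b - Ga h v) with [top b = - K h v] are tangent to the set of
   horizontal vectors: a function vanishing on it has zero derivative there. *)
Lemma hor_vanish (W : normedModType R) (f : E * E -> W) z h b : hor z -> dif f z ->
  (forall z', hor z' -> f z' = 0) -> top z b = - K z h z.2 ->
  dv f z (h, b - Ga z h z.2) = 0.
Proof.
move=> [Oz tz] df f0 tb; have lt := top_lin H S Oz.
have [A [oA Az] HA] := near_top_inj Oz.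
pose PM := GRing.isLinear.Build R E E _ (top z) lt.
pose Pi : {linear E -> E} := HB.pack (top z) PM.
(* The outer projection, taken at the fixed point z, places the values in the image of Pi; near z
   the zeros are exactly the horizontal vectors, by [near_top_inj]. *)
pose Phi (z' : E * E) := top z (top z' z'.2).
have sT : smooth_on Om (fun z' : E * E => top z' z'.2).
  by apply: (sm_fam (fd_Z _ _) oOm oOm (top_slin H S)) => //; [exact: sm_id|exact: sm_snd].
have sA : A `<=` Om by move=> z' Az'; have [] := HA z' 0 Az'.
have sPhi : smooth_on Om Phi.
  have sl0 : slin setT (fun _ : E * E => top z) by split=> [z' _|e]; [exact: lt|exact: sm_cst].
  exact: (sm_fam (fd_Z _ _) oOm openT sl0 (fun _ _ => I) (@sm_id _ _ _) sT).
have dT := sm_dif sT Oz.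
have dPhi xi : dv Phi z xi = top z (dv (fun y => top y z.2) z xi + top z xi.2).
  have sl0 : slin setT (fun _ : E * E => top z) by split=> [z' _|e]; [exact: lt|exact: sm_cst].
  rewrite (dv_fam xi openT sl0 I (dif_id z) dT) dv_cst add0r.
  by rewrite (dv_fam xi oOm (top_slin H S) Oz (dif_id z) (dif_snd z)) dv_id dv_snd.
(* The fibre derivative 2 top C(c, v) vanishes since C kills v; hence Phi has derivative Pi along
   the fibre. *)
have fib c : dv (fun y => top y z.2) z (0, c) = 0.
  by rewrite (dv_top_fiber H S) // (csf_v H) // (lin_0 lt) scaler0.
rewrite dvE; apply: (@level_vanish R (E * E)%type m A z inrE oA Az inrE_continuous W f Phi Pi).
- by move=> i; exact: (Ck_sub sA (sm_entry 0 i oOm sPhi 1%N)).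
- by move=> c; exact: (top_top H S).
- by move=> z' Az'; exact: (top_top H S).
- by rewrite /Phi tz (lin_0 lt).
- by move=> c; rewrite -dvE dPhi fib add0r /= (top_top H S).
- rewrite -dvE dPhi (dv_top H S) // tz (lin_0 (ga_lin2 H _ Oz)) subr0 fib addr0 /=.
  rewrite (lin_B lt) tb.
  have -> : K z h z.2 + top z (Ga z h z.2) + (- K z h z.2 - top z (Ga z h z.2)) = 0.
    by rewrite -opprD subrr.
  exact: (lin_0 lt).
- by rewrite -difE.
- by move=> z' Az' P0; apply: f0; have [Oz' ti] := HA z' z'.2 Az'; split=> //; exact: ti.
Qed.

Lemma hor_ver_orth z x w : Om z -> top z x = 0 -> J z.1 w = 0 -> g z x w = 0.
Proof. by move=> Oz tx w0; rewrite -(top_orth H S x Oz w0) tx (lin_0 (g1 _ Oz)). Qed.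

Lemma K0 z e : Om z -> K z 0 e = 0.
Proof. by move=> Oz; rewrite (lin_0 (lK2 e Oz)). Qed.

Lemma top_bot z e : Om z -> top z (e - top z e) = 0.
Proof. by move=> Oz; rewrite (lin_B (top_lin H S Oz)) (top_top H S) // subrr. Qed.

Lemma J_bot z e : Om z -> J z.1 (e - top z e) = J z.1 e.
Proof. by move=> Oz; rewrite (lin_B (Jlin (Uz Oz))) J_top // subr0. Qed.

(** Fibre directions (0, x) with x horizontal are tangent to the horizontal set, and along them L =
    Lt o dsigma gives dL(x) = dLt(dsigma x), where dL(x) = 2 g(v, x). Vertical components of e
    contribute zero to both sides. *)
Lemma isometry1 z e : hor z -> g z z.2 e = gB (tsg z) (tsg z).2 (J z.1 e).
Proof.
move=> hz; have [Oz tz] := hz; have [OB _] := iso hz; have Ux := Uz Oz.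
suff Hh x : top z x = 0 -> g z z.2 x = gB (tsg z) (tsg z).2 (J z.1 x).
  have -> : e = (e - top z e) + top z e by rewrite subrK.
  rewrite (lin_D (g2 _ Oz)) (lin_D (Jlin Ux)) J_top // addr0.
  by rewrite Hh ?top_bot // (hor_ver_orth Oz tz (J_top e Oz)) addr0.
move=> tx.
have dl := sm_dif sl Oz; have dlB := sm_dif slB OB.
have dlt := dif_comp (dif_tsg Oz) dlB.
have f0 z' : hor z' -> l z' - lB (tsg z') = 0 by move=> hz'; have [_ ->] := iso hz'; rewrite subrr.
have tb : top z x = - K z 0 z.2 by rewrite (K0 _ Oz) oppr0.
have := hor_vanish hz (dif_sub dl dlt) f0 tb.
rewrite (lin_0 (ga_lin1 H _ Oz)) subr0 (dv_sub _ dl dlt).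
rewrite (dv_comp _ (dif_tsg Oz) dlB) (dv_tsg _ Oz) /=.
have [_ + _] := D2_bil; move=> /(_ z.1 z.2 Ux) l2; rewrite (lin_0 l2) add0r (lin_0 (Jlin Ux)) => E3.
rewrite (gf_vl oOm sl (lf_hom H)) // (gf_vl oOmB slB (lf_hom HB)) //; lra.
Qed.

(** One more derivative of [isometry1] in a horizontal fibre direction; the Cartan terms contain v
    on either side and vanish. *)
Lemma isometry2 z x e : hor z -> top z x = 0 ->
  g z x e = gB (tsg z) (J z.1 x) (J z.1 e).
Proof.
move=> hz tx; have [Oz tz] := hz; have [OB _] := iso hz; have Ux := Uz Oz.
have bg := gf_bil oOm sl; have bgB := gf_bil oOmB slB.
have d1 := dif_bil oOm (fd_Z _ _) bg Oz (dif_id z) (dif_snd z) (dif_cst e z).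
have ds : dif (fun z' => (tsg z').2) z by exact: (dif_comp (dif_tsg Oz) (dif_snd _)).
have d2 := dif_bil oOmB (fd_Z _ _) bgB OB (dif_tsg Oz) ds (dif_Jz e Oz).
have f0 z' : hor z' -> g z' z'.2 e - gB (tsg z') (tsg z').2 (J z'.1 e) = 0.
  by move=> hz'; rewrite (isometry1 e hz') subrr.
have tb : top z x = - K z 0 z.2 by rewrite (K0 _ Oz) oppr0.
have := hor_vanish hz (dif_sub d1 d2) f0 tb.
rewrite (lin_0 (ga_lin1 H _ Oz)) subr0 (dv_sub _ d1 d2).
rewrite (dv_bil oOm (fd_Z _ _) bg Oz (dif_id z) (dif_snd z) (dif_cst e z)).
rewrite (dv_bil oOmB (fd_Z _ _) bgB OB (dif_tsg Oz) ds (dif_Jz e Oz)).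
rewrite dv_id dv_snd dv_cst (dv_Jz _ _ Oz) (dv_comp _ (dif_tsg Oz) (dif_snd _)) dv_snd (dv_tsg _ Oz) /=.
have [_ + _] := D2_bil => l2; rewrite !(lin_0 (l2 _ _ Ux)) add0r (lin_0 (Jlin Ux)).
rewrite (dv_gf0 l) (dv_gf0 lB) (cf_v oOm sl (lf_hom H)) //.
have -> : cf lB (tsg z) (J z.1 x) (J z.1 z.2) (J z.1 e) = 0.
  exact: (cf_v oOmB slB (lf_hom HB) _ _ OB).
rewrite (lin_0 (g2 _ Oz)) (lin_0 (gB2 _ OB)); lra.
Qed.

Lemma base_ext z (y y' : F) : hor z ->
  (forall x, top z x = 0 -> gB (tsg z) y (J z.1 x) = gB (tsg z) y' (J z.1 x)) -> y = y'.
Proof.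
move=> hz h; have [Oz tz] := hz; have [OB _] := iso hz.
apply/eqP; rewrite -subr_eq0; apply/eqP; apply: (lf_nondeg HB OB) => c.
have [e <-] := ls_surj S (Uz Oz) c.
by rewrite (lin_B (gB1 _ OB)) -J_bot // h ?subrr // top_bot.
Qed.

(** Differentiate dsigma (top w) = 0 along the horizontal lift of h: on vertical vectors, minus the
    second fundamental form of sigma is the image of K. *)
Lemma E0_ver z h w : Om z -> J z.1 w = 0 ->
  J z.1 (Ga z h w) - D2 z.1 h w = J z.1 (K z h w).
Proof.
move=> Oz w0; have Ux := Uz Oz; have tw := top_id H S Oz w0.
have := dv_fam (h, - Ga z h z.2) oU Jslin Ux (dif_fst z) (top_dif H S w Oz).
have E1 z' : Om z' -> J z'.1 (top z' w) = 0 by move=> O'; exact: J_top.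
rewrite (dv_eq _ oOm Oz E1) dv_cst dv_fst (dv_top0 H S) //= tw.
rewrite (lin_D (Jlin Ux)) (lin_B (Jlin Ux)) J_top // addr0.
move: (D2 _ _ _) (J _ (K _ _ _)) (J _ (Ga _ _ _)) => a b c E2.
by apply/rowP => j; move/rowP: E2 => /(_ j); rewrite !mxE; lra.
Qed.

Lemma dv_l z h b : Om z -> dv l z (h, b - Ga z h z.2) = 2 * g z z.2 b.
Proof.
move=> Oz; have bg := gf_bil oOm sl.
have E1 z' : Om z' -> l z' = g z' z'.2 z'.2 by exact: (l_gf oOm sl (lf_hom H)).
rewrite (dv_eq _ oOm Oz E1) (dv_bil oOm (fd_Z _ _) bg Oz (dif_id z) (dif_snd z) (dif_snd z)).
rewrite dv_id dv_snd (dv_g H) //= (cf_v oOm sl (lf_hom H)) //.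
rewrite (lin_B (g1 _ Oz)) (lin_B (g2 _ Oz)) (gsym b _ Oz); lra.
Qed.

Lemma dv_tsgh z h b : Om z -> dv tsg z (h, b - Ga z h z.2) =
  (J z.1 h, D2 z.1 h z.2 + J z.1 b - J z.1 (Ga z h z.2)).
Proof.
by move=> Oz; rewrite (dv_tsg _ Oz) /= (lin_B (Jlin (Uz Oz))) addrA.
Qed.

(** K_v v is vertical, so it is tested on a vertical w, where g(K_v v, w) = g(v, K_v w).
    Differentiating L = Lt o dsigma along the tangent direction over w, which keeps the base point
    of B fixed, shows that the latter is zero. *)
Lemma K_vv z : hor z -> K z z.2 z.2 = 0.
Proof.
move=> hz; have [Oz tz] := hz; have [OB _] := iso hz; have Ux := Uz Oz.
have lt := top_lin H S Oz.
have Kver h : J z.1 (K z h z.2) = 0.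
  by rewrite -(K_hor H S h Oz tz) J_top.
apply: (ls_vnondeg S Oz) => // w w0.
have dl := sm_dif sl Oz; have dlB := sm_dif slB OB.
have dlt := dif_comp (dif_tsg Oz) dlB.
have tb : top z (- K z w z.2) = - K z w z.2 by rewrite (lin_N lt) (K_hor H S).
have f0 z' : hor z' -> l z' - lB (tsg z') = 0 by move=> hz'; have [_ ->] := iso hz'; rewrite subrr.
have := hor_vanish hz (dif_sub dl dlt) f0 tb.
rewrite (dv_sub _ dl dlt) (dv_l _ _ Oz) (dv_comp _ (dif_tsg Oz) dlB).
rewrite (dv_tsgh _ _ Oz) w0 (lin_N (Jlin Ux)) Kver oppr0 addr0.
rewrite (lin_N (g2 _ Oz)) (hor_ver_orth Oz tz (Kver w)) oppr0 mulr0 sub0r.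
rewrite (D2s_sym _ _ Ux) (lf_sym H _ _ Oz) -(opprB (J z.1 (Ga _ _ _))) (E0_ver _ Oz w0).
move=> E1; have E2 := gf_vl oOmB slB (lf_hom HB) (- J z.1 (K z z.2 w)) OB.
have E3 : gB (tsg z) (tsg z).2 (J z.1 (K z z.2 w)) = 0.
  by move: E2; rewrite (lin_N (gB2 _ OB)); lra.
by rewrite (K_sa H S) // isometry1.
Qed.

(* The difference of the connections of the base and of the total space: by
   [dual_formula] it is the image of - Qtilde on horizontal vectors. *)
Definition Us z h X : F := GaB (tsg z) (J z.1 h) (J z.1 X) + D2 z.1 h X - J z.1 (Ga z h X).

Lemma Us_sym z h X : hor z -> Us z h X = Us z X h.
Proof.
move=> hz; have [Oz tz] := hz; have [OB _] := iso hz.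
by rewrite /Us (lf_sym HB _ _ OB) (D2s_sym _ _ (Uz Oz)) (lf_sym H _ _ Oz).
Qed.

Lemma Us_ver z w X : hor z -> J z.1 w = 0 -> Us z w X = - J z.1 (K z X w).
Proof.
move=> hz w0; have [Oz tz] := hz; have [OB _] := iso hz.
rewrite /Us w0 (lin_0 (ga_lin1 HB _ OB)) add0r (lf_sym H _ _ Oz) (D2s_sym _ _ (Uz Oz)).
by rewrite -(E0_ver X Oz w0) opprB.
Qed.

Lemma K_ver_v z h : hor z -> J z.1 (K z h z.2) = 0.
Proof. by move=> [Oz tz]; rewrite -(K_hor H S h Oz tz) J_top. Qed.

Lemma dv_tsgU z h : hor z -> dv tsg z (h, - K z h z.2 - Ga z h z.2) =
  (J z.1 h, Us z h z.2 - GaB (tsg z) (J z.1 h) (tsg z).2).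
Proof.
move=> hz; have [Oz tz] := hz.
rewrite (dv_tsgh _ _ Oz) (lin_N (Jlin (Uz Oz))) K_ver_v // oppr0 addr0 /Us /=; congr (_, _).
move: (D2 _ _ _) (J _ (Ga _ _ _)) (GaB _ _ _) => a b c.
by apply/rowP => j; rewrite !mxE; ring.
Qed.

(** The isometry g(X - top X, Y) = gB(dsigma X, dsigma Y), valid at all horizontal vectors, is
    differentiated along the tangent direction over h and compared with compatibility on both
    spaces. The left Cartan term comes from the vertical correction - K_h v, the right one from Us h
    v. *)
Lemma Us_metric z h X Y : hor z -> top z X = 0 -> top z Y = 0 ->
  - 2 * cf l z (K z h z.2) X Y = 2 * cf lB (tsg z) (Us z h z.2) (J z.1 X) (J z.1 Y)
  + gB (tsg z) (Us z h X) (J z.1 Y) + gB (tsg z) (J z.1 X) (Us z h Y).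
Proof.
move=> hz tX tY; have [Oz tz] := hz; have [OB _] := iso hz; have Ux := Uz Oz.
have lt := top_lin H S Oz.
have bg := gf_bil oOm sl; have bgB := gf_bil oOmB slB.
have dP : dif (fun z' => X - top z' X) z.
  by apply: dif_sub; [exact: dif_cst|exact: (top_dif H S)].
have d1 := dif_bil oOm (fd_Z _ _) bg Oz (dif_id z) dP (dif_cst Y z).
have d2 := dif_bil oOmB (fd_Z _ _) bgB OB (dif_tsg Oz) (dif_Jz X Oz) (dif_Jz Y Oz).
have tb : top z (- K z h z.2) = - K z h z.2 by rewrite (lin_N lt) (K_hor H S).
have f0 z' : hor z' -> g z' (X - top z' X) Y - gB (tsg z') (J z'.1 X) (J z'.1 Y) = 0.
  move=> hz'; have [Oz' _] := hz'; rewrite isometry2 ?top_bot // J_bot // subrr.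
  by [].
have := hor_vanish hz (dif_sub d1 d2) f0 tb.
rewrite (dv_sub _ d1 d2) (dv_bil oOm (fd_Z _ _) bg Oz (dif_id z) dP (dif_cst Y z)).
rewrite (dv_bil oOmB (fd_Z _ _) bgB OB (dif_tsg Oz) (dif_Jz X Oz) (dif_Jz Y Oz)).
rewrite dv_id dv_cst (dv_sub _ (dif_cst X z) (top_dif H S X Oz)) dv_cst sub0r.
rewrite !(dv_Jz _ _ Oz) (dv_tsgU _ hz) (dv_g HB) // /= tX subr0 (dv_g H) //.
rewrite (dv_top H S) // tX (lin_0 (ga_lin2 H _ Oz)) subr0 (dv_top_fiber H S _ Oz tX).
(* The variation of the horizontal part of X is vertical, hence orthogonal to Y. *)
have vert : J z.1 (- (K z h X + top z (Ga z h X) + 2 *: top z (C z (- K z h z.2) X))) = 0.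
  rewrite (lin_N (Jlin Ux)) !(lin_D (Jlin Ux)) (lin_Z (Jlin Ux)) !J_top //.
  by rewrite -(K_hor H S h Oz tX) J_top // scaler0 !addr0 oppr0.
rewrite (gsym (- (_ + _ + _)) Y Oz) (hor_ver_orth Oz tY vert) (lin_0 (g2 _ Oz)) !addr0.
rewrite (gsym (Ga z h X) Y Oz) (isometry2 _ hz tX) (isometry2 _ hz tY).
rewrite (gBsym (J z.1 Y) _ OB) (lin_N (cf_lin1 oOm sl _ _ Oz)).
rewrite /Us !(lin_B (gB1 _ OB)) !(lin_D (gB1 _ OB)) !(lin_B (gB2 _ OB)) !(lin_D (gB2 _ OB)).
lra.
Qed.

(** Take h = w vertical and Y = v in [Us_metric]. The Cartan terms contain v, and [Us_ver] turns the
    rest into g(K_X w, v) + g(X, K_v w) = 0; self-adjointness of K frees w. *)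
Lemma K_skew_v z X : hor z -> top z X = 0 -> K z X z.2 = - K z z.2 X.
Proof.
move=> hz tX; have [Oz tz] := hz; have [OB _] := iso hz; have Ux := Uz Oz.
apply/eqP; rewrite -subr_eq0 opprK; apply/eqP; apply: (ls_vnondeg S Oz).
  by rewrite (lin_D (Jlin Ux)) -(K_hor H S _ Oz tX) -(K_hor H S _ Oz tz) !J_top // addr0.
move=> w w0; have := Us_metric w hz tX tz.
rewrite (cf_sym23 oOm sl) // (cf_v oOm sl (lf_hom H)) // (cf_sym23 oOmB slB) //.
have -> : cf lB (tsg z) (Us z w z.2) (J z.1 z.2) (J z.1 X) = 0.
  exact: (cf_v oOmB slB (lf_hom HB) _ _ OB).
rewrite !(Us_ver _ hz w0) (lin_N (gB1 _ OB)) (lin_N (gB2 _ OB)).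
rewrite (gBsym (J z.1 (K z X w)) _ OB) -(isometry2 _ hz tX) -(isometry2 _ hz tz).
rewrite (lin_D (g1 _ Oz)) !(K_sa H S _ _ _ Oz); lra.
Qed.

(** The Koszul argument of [gauss_formula] transposed to the base. Here Us(., v) vanishes, so no
    Cartan term of the base survives, and K_X v = - K_v X = A_v X turns the three remaining ones
    into Qtilde. *)
Lemma dual_formula z X Y : hor z -> top z X = 0 -> top z Y = 0 ->
  Us z X Y = - J z.1 (Qt z X Y) /\ Us z X z.2 = 0.
Proof.
move=> hz tX0 tY0; have [Oz tz] := hz; have [OB _] := iso hz; have Ux := Uz Oz.
have lt := top_lin H S Oz.
pose c3 := cf l z; pose cB := cf lB (tsg z).
have cv e h : c3 e h z.2 = 0.
  by rewrite /c3 (cf_sym23 oOm sl) // (cf_v oOm sl (lf_hom H)).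
have cv2 e h : c3 e z.2 h = 0 by exact: (cf_v oOm sl (lf_hom H)).
have cBv e h : cB e (J z.1 z.2) h = 0 by exact: (cf_v oOmB slB (lf_hom HB) _ _ OB).
have cBv3 e h : cB e h (J z.1 z.2) = 0.
  by rewrite /cB (cf_sym23 oOmB slB) //; exact: cBv.
have F3 A B D : top z A = 0 -> top z B = 0 -> top z D = 0 ->
   gB (tsg z) (Us z A B) (J z.1 D) =
   - (c3 (K z A z.2) B D + cB (Us z A z.2) (J z.1 B) (J z.1 D))
   - (c3 (K z B z.2) D A + cB (Us z B z.2) (J z.1 D) (J z.1 A))
   + (c3 (K z D z.2) A B + cB (Us z D z.2) (J z.1 A) (J z.1 B)).
  move=> tA tB tD; have h1 := Us_metric A hz tB tD; have h2 := Us_metric B hz tD tA.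
  have h3 := Us_metric D hz tA tB.
  rewrite (gBsym (J z.1 B) _ OB) in h1; rewrite (gBsym (J z.1 D) _ OB) in h2.
  rewrite (gBsym (J z.1 A) _ OB) in h3.
  rewrite (Us_sym B A hz) in h2; rewrite (Us_sym D A hz) (Us_sym D B hz) in h3.
  by rewrite -/c3 -/cB in h1 h2 h3; lra.
have Uvv : Us z z.2 z.2 = 0.
  apply: (base_ext hz) => D tD; rewrite F3 // !cv !cv2 !cBv !cBv3 (lin_0 (gB1 _ OB)).
  by lra.
(* The only Cartan terms free of v have K_v v or Us v v as an argument, and both are zero. *)
have UXv A : top z A = 0 -> Us z A z.2 = 0.
  move=> tA; apply: (base_ext hz) => D tD; rewrite F3 // cv cv2 cBv cBv3 (K_vv hz) Uvv.
  rewrite /c3 /cB (lin_0 (cf_lin1 oOm sl _ _ Oz)) (lin_0 (cf_lin1 oOmB slB _ _ OB)) (lin_0 (gB1 _ OB)).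
  by lra.
split; last exact: UXv.
apply: (base_ext hz) => D tD; rewrite F3 // !UXv // .
rewrite /cB !(lin_0 (cf_lin1 oOmB slB _ _ OB)) !addr0.
rewrite (lin_N (gB1 _ OB)) (gBsym _ (J z.1 D) OB) -(isometry2 _ hz tD).
rewrite Qtf.unlock; cbv zeta beta; rewrite tX0 tY0 tz !subr0.
set R0 := _ + C z X _.
rewrite (lin_B (g2 _ Oz)) (hor_ver_orth Oz tD (J_top R0 Oz)) subr0 /R0.
rewrite !(lin_D (g2 _ Oz)) !(csfP H) // (gsym D _ Oz) (chi_skew H S) // (gsym (C z X Y) _ Oz) (csfP H) //.
rewrite (chi_hor H S z.2 Oz tD) (chi_hor H S z.2 Oz tX0) (chi_hor H S z.2 Oz tY0).
rewrite -!K_skew_v // -/c3.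
have rot p r o : c3 p r o = c3 r o p.
  by rewrite /c3 (cf_sym12 oOm sl) // (cf_sym23 oOm sl).
rewrite (rot D (K z X z.2) Y) -(rot (K z Y z.2) D X); lra.
Qed.

Lemma Qt_bot z e h : Om z -> Qt z (e - top z e) (h - top z h) = Qt z e h.
Proof. by move=> Oz; rewrite Qtf.unlock; cbv zeta beta; rewrite !top_bot // !subr0. Qed.

Lemma Qt_botr z e h : Om z -> Qt z e (h - top z h) = Qt z e h.
Proof. by move=> Oz; rewrite Qtf.unlock; cbv zeta beta; rewrite !top_bot // !subr0. Qed.

Lemma E0_split z h e : hor z -> top z h = 0 ->
  J z.1 (Ga z h e) - D2 z.1 h e =
  J z.1 (chi z h (top z e)) + GaB (tsg z) (J z.1 h) (J z.1 e) + J z.1 (Qt z h e).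
Proof.
move=> hz th; have [Oz tz] := hz; have Ux := Uz Oz.
have te := top_top H S e Oz; have tb := top_bot e Oz.
have [F1 _] := dual_formula hz th tb.
have F2 := E0_ver h Oz (J_top e Oz).
have [_ lD2 _] := D2_bil; have [lD1 _ _] := D2_bil.
move: F1; rewrite /Us J_bot // Qt_botr // (lin_B (lD1 _ h Ux)) (lin_B (ga_lin2 H _ Oz)) (lin_B (Jlin Ux)).
rewrite (chi_ver H S _ Oz te) => F1.
apply/rowP => j; move/rowP: F1 => /(_ j); move/rowP: F2 => /(_ j); rewrite !mxE; lra.
Qed.

(* The identity of [dual_formula] differentiated along the set of horizontal
   vectors, in the direction (h, A h v - Ga z h v). *)
Lemma dual_derived z h X Y : hor z -> top z h = 0 -> top z X = 0 -> top z Y = 0 ->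
  let A := chi z in
  let b := A h z.2 in
  let zB := tsg z in
  let Jz a := J z.1 a in
  cov GaB (fun y => GaB y (Jz X) (Jz Y)) zB (Jz h) + GaB zB (D2 z.1 h X) (Jz Y)
  + GaB zB (Jz X) (D2 z.1 h Y) + GaB zB (Jz h) (D2 z.1 X Y)
  + dv (fun y => D2 y X Y) z.1 h
  + Jz (A Y (- A h X + top z (Ga z h X) + 2 *: top z (C z X b)))
  + Jz (A X (- A h Y + top z (Ga z h Y) + 2 *: top z (C z Y b)))
  + Jz (A h (top z (Ga z X Y)))
  - Jz (cov Ga (fun y => Ga y X Y) z h) - Jz (Pf Ga z X Y b)
  + Jz (Qt z h (Ga z X Y)) - Jz (Qt z h (Qt z X Y))
  + Jz (cov Ga (fun y => Qt y X Y) z h) + Jz (dv (fun y => Qt y X Y) z (0, b)) = 0.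
Proof.
move=> hz th tX tY A b zB Jz; have [Oz tz] := hz; have [OB _] := iso hz; have Ux := Uz Oz.
have lt := top_lin H S Oz; have lJ := Jlin Ux.
have [lA1 lA2 _] := chi_bil H S; have [lQ1 _ sQ] := Qtf_bil H S.
have [lD1 lD2 _] := D2_bil.
have bE : b = - K z h z.2 by rewrite /b /A (chi_hor H S _ Oz tz).
have [_ Uh] := dual_formula hz th th.
pose xi : E * E := (h, - K z h z.2 - Ga z h z.2).
(* Because Us h v = 0, the direction projects exactly onto the horizontal lift in the base; this is
   why no P or Cartan term of the base occurs. *)
have dtsg : dv tsg z xi = (Jz h, - GaB zB (Jz h) zB.2).
  by rewrite (dv_tsgU _ hz) Uh sub0r.
have dP V : dif (fun z' => V - top z' V) z.
  by apply: dif_sub; [exact: dif_cst|exact: (top_dif H S)].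
pose V' V := - (K z h V + top z (Ga z h V) + 2 *: top z (C z V b)).
have dPV V : top z V = 0 -> dv (fun z' => V - top z' V) z xi = V' V.
  move=> tV; rewrite (dv_sub _ (dif_cst V z) (top_dif H S V Oz)) dv_cst sub0r.
  rewrite (dv_top H S _ _ _ Oz) tV (lin_0 (ga_lin2 H _ Oz)) subr0 (dv_top_fiber H S _ Oz tV).
  by rewrite -bE (csf_sym H _ _ Oz).
have tV' V : top z V = 0 -> top z (V' V) = V' V.
  move=> tV; rewrite (lin_N lt) !(lin_D lt) (lin_Z lt) !(top_top H S _ Oz).
  by rewrite (K_hor H S _ Oz tV).
have bGa := lf_bil H; have bGaB := lf_bil HB.
have d1 := dif_bil oOmB (fd_Z _ _) bGaB OB (dif_tsg Oz) (dif_Jz X Oz) (dif_Jz Y Oz).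
have d2 := dif_bil oU (fd_rV _) D2_bil Ux (dif_fst z) (dP X) (dP Y).
have d3 := dif_bil oOm (fd_Z _ _) bGa Oz (dif_id z) (dP X) (dP Y).
have d3' := dif_fam oU Jslin Ux (dif_fst z) d3.
have dQ := sm_dif (sQ X Y) Oz.
have d4 := dif_fam oU Jslin Ux (dif_fst z) dQ.
(* Horizontality of X and Y depends on z', so away from z they are replaced by their horizontal
   parts; the derivatives of these are the vertical vectors [V']. *)
have f0 z' : hor z' -> GaB (tsg z') (J z'.1 X) (J z'.1 Y)
    + D2 z'.1 (X - top z' X) (Y - top z' Y)
    - J z'.1 (Ga z' (X - top z' X) (Y - top z' Y)) + J z'.1 (Qt z' X Y) = 0.
  move=> hz'; have [Oz' tz'] := hz'.
  have [F1 _] := dual_formula hz' (top_bot X Oz') (top_bot Y Oz').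
  move: F1; rewrite /Us !J_bot // Qt_bot // => F1.
  by rewrite F1 addNr.
have tb : top z (- K z h z.2) = - K z h z.2 by rewrite (lin_N lt) (K_hor H S).
have := hor_vanish hz (dif_add (dif_sub (dif_add d1 d2) d3') d4) f0 tb.
rewrite -/xi (dv_add _ (dif_sub (dif_add d1 d2) d3') d4) (dv_sub _ (dif_add d1 d2) d3') (dv_add _ d1 d2).
rewrite (dv_bil oOmB (fd_Z _ _) bGaB OB (dif_tsg Oz) (dif_Jz X Oz) (dif_Jz Y Oz)).
rewrite (dv_bil oU (fd_rV _) D2_bil Ux (dif_fst z) (dP X) (dP Y)).
rewrite (dv_fam _ oU Jslin Ux (dif_fst z) d3) (dv_fam _ oU Jslin Ux (dif_fst z) dQ).
rewrite (dv_bil oOm (fd_Z _ _) bGa Oz (dif_id z) (dP X) (dP Y)).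
rewrite (dPV X tX) (dPV Y tY) !(dv_Jz _ _ Oz) dv_id dv_fst dtsg tX tY !subr0.
have [_ _ sG] := bGa; have [_ _ sGB] := bGaB.
have := dv_cov GaB (Jz h) 0 (sm_dif (sGB (Jz X) (Jz Y)) OB).
rewrite add0r (lin_0 (dv_linear (sm_dif (sGB (Jz X) (Jz Y)) OB))) addr0 => ->.
rewrite /xi (dv_cov _ _ _ (sm_dif (sG X Y) Oz)) (dv_cov _ _ _ dQ) -bE -/(Pf Ga z X Y b).
(* Inserting the vertical variation [V'] into the second fundamental form produces the terms A_Y A_h
   X and 2 A_Y C(X, A_h v) of the dual equation. *)
have EV V W : top z V = 0 -> D2 z.1 (V' V) W - J z.1 (Ga z (V' V) W) = - J z.1 (A W (V' V)).
  move=> tV; rewrite (D2s_sym _ _ Ux) (lf_sym H _ _ Oz) /A (chi_ver H S _ Oz (tV' V tV)).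
  by rewrite -(E0_ver W Oz (ver_top H S Oz (tV' V tV))) opprB.
have EX := EV X Y tX.
have EY : D2 z.1 X (V' Y) - J z.1 (Ga z X (V' Y)) = - J z.1 (A X (V' Y)).
  by rewrite (D2s_sym _ _ Ux) (lf_sym H _ _ Oz) EV.
have AV V W : top z V = 0 -> - J z.1 (A W (V' V)) =
    J z.1 (A W (- A h V + top z (Ga z h V) + 2 *: top z (C z V b))).
  move=> tV; have lA e : linear (A e) := lA1 z e Oz.
  rewrite /V' (lin_N (lA _)) (lin_N lJ) opprK.
  by rewrite {3}/A (chi_hor H S _ Oz tV) opprK.
rewrite /Jz /= -(AV X Y tX) -(AV Y X tY) -EX -EY.
have EG := E0_split (Ga z X Y) hz th; have EQ := E0_split (Qt z X Y) hz th.
rewrite (Qtf_top H S _ _ Oz) (lin_0 (lA1 _ _ Oz)) (lin_0 lJ) add0r in EQ.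
have [F1 _] := dual_formula hz tX tY.
have JG : J z.1 (Ga z X Y) = GaB zB (Jz X) (Jz Y) + D2 z.1 X Y + J z.1 (Qt z X Y).
  by move: F1; rewrite /Us => F1; apply/rowP => j; move/rowP: F1 => /(_ j); rewrite !mxE; lra.
rewrite JG !(lin_D (ga_lin2 HB _ OB)) in EG.
rewrite !(lin_D lJ) !(lin_N lJ) /A /zB => E0.
rewrite /zB /Jz in EG.
apply/rowP => j; move/rowP: E0 => /(_ j); move/rowP: EG => /(_ j); move/rowP: EQ => /(_ j).
rewrite !mxE /Jz /A; lra.
Qed.

(** Antisymmetrise [dual_derived] in h and X: the third derivatives of sg, the vector D2 h X and the
    term A_Y (top (Ga h X)) are symmetric and cancel, and the other connection terms assemble into
    the curvatures and into the covariant derivative of Qtilde. *)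
Lemma dual_local z h X Y : hor z -> top z h = 0 -> top z X = 0 -> top z Y = 0 ->
  let A := chi z in
  let v := z.2 in
  J z.1 (Rf Ga z h X Y) = Rf GaB (tsg z) (J z.1 h) (J z.1 X) (J z.1 Y) + J z.1 (
    A h (A X Y) - A X (A h Y) + A Y (A X h) - A Y (A h X)
    + 2 *: A Y (top z (C z X (A h v))) + 2 *: A X (top z (C z Y (A h v)))
    - 2 *: A Y (top z (C z h (A X v))) - 2 *: A h (top z (C z Y (A X v)))
    + (covT Ga Qt z h X Y - covT Ga Qt z X h Y)
    + Qt z X (Qt z h Y) - Qt z h (Qt z X Y)
    + dv (fun y => Qt y X Y) z (0, A h v) - dv (fun y => Qt y h Y) z (0, A X v)
    - Pf Ga z X Y (A h v) + Pf Ga z h Y (A X v)).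
Proof.
move=> hz th tX tY A v; have [Oz tz] := hz; have [OB _] := iso hz; have Ux := Uz Oz.
have lJ := Jlin Ux; have [lA1 _ _] := chi_bil H S.
have G1 := dual_derived hz th tX tY; have G2 := dual_derived hz tX th tY.
rewrite /= -/A -/v in G1 G2.
have D3 : dv (fun y => D2 y X Y) z.1 h = dv (fun y => D2 y h Y) z.1 X.
  exact: (dv_schwarz_rV _ _ oU Ux (sm_dv Y ssg)).
rewrite D3 (D2s_sym h X Ux) (lf_sym H h X Oz) in G1.
rewrite /Rf /covT (lf_sym H h X Oz).
rewrite !(lin_D lJ, lin_B lJ, lin_N lJ, lin_Z lJ).
have lA e : linear (A e) := lA1 z e Oz.
rewrite !(lin_D (lA _)) !(lin_N (lA _)) !(lin_Z (lA _)) !(lin_D lJ) !(lin_N lJ) !(lin_Z lJ) in G1 G2.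
apply/rowP => j; move/rowP: G1 => /(_ j) G1; move/rowP: G2 => /(_ j) G2.
rewrite !mxE in G1 G2 *; lra.
Qed.

End DualGauss.

(** * Charts of manifolds and of their tangent bundles *)

Section Charts.
Context {R : realType}.

Section OneManifold.
Context {n : nat} {M : manifold R n}.
Implicit Types (p q r : M) (O U : set M).
Local Notation E := 'rV[R]_n.

Lemma chart_open p O : open O -> open [set x | ccod p x /\ O (cinv p x)].
Proof.
move=> oO; rewrite openE => x [cx Ox]; apply: filterI.
  by apply: open_nbhs_nbhs; split=> //; exact: ccod_open.
by apply: (cinv_continuous cx); exact: open_nbhs_nbhs.
Qed.

Lemma chart_pull_open p (W : set E) : open W -> open [set q | cdom p q /\ W (cmap p q)].
Proof.
move=> oW; rewrite openE => q [cq Wq]; apply: filterI.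
  by apply: open_nbhs_nbhs; split=> //; exact: cdom_open.
by apply: (cmap_continuous cq); exact: open_nbhs_nbhs.
Qed.

End OneManifold.

Section Maps.
Context {m n : nat} {M : manifold R m} {N : manifold R n}.
Implicit Types (p q : M) (r s : N).
Variable f : M -> N.
Hypothesis sf : smooth_map f.

Definition cexp p r : 'rV[R]_m -> 'rV[R]_n := fun x => cmap r (f (cinv p x)).

Definition cexp_dom p r : set 'rV[R]_m := [set x | ccod p x /\ cdom r (f (cinv p x))].

Lemma cexp_open p r : open (cexp_dom p r).
Proof.
have [cf _] := sf; apply: (@chart_open _ _ p (f @^-1` cdom r)).
by apply: open_comp => [q _|]; [exact: cf|exact: cdom_open].
Qed.

Lemma cexp_smooth p r : smooth_on (cexp_dom p r) (cexp p r).
Proof. by have [_] := sf; apply. Qed.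

Lemma cexp_center p r q : cdom p q -> cdom r (f q) -> cexp_dom p r (cmap p q).
Proof. by move=> pq rq; split; [exact: cmap_ccod|rewrite cmapK]. Qed.

Lemma cexp_dif p r q : cdom p q -> cdom r (f q) -> dif (cexp p r) (cmap p q).
Proof. by move=> pq rq; exact: sm_dif (@cexp_smooth p r) (cexp_center pq rq). Qed.

Lemma cexp_cmap p r q : cdom p q -> cexp p r (cmap p q) = cmap r (f q).
Proof. by move=> pq; rewrite /cexp cmapK. Qed.

End Maps.

Lemma smooth_id n (M : manifold R n) : smooth_map (fun q : M => q).
Proof. by split=> [q|p r]; [exact: cvg_id|exact: ctrans_smooth]. Qed.

(** A transition map is the coordinate expression of the identity, so this chain rule also governs
    every change of chart. *)
Lemma cexp_comp l m n (K : manifold R l) (M : manifold R m) (N : manifold R n)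
    (f : K -> M) (g : M -> N) (p : K) (r : M) (s : N) (q : K) e :
  smooth_map f -> smooth_map g -> smooth_map (fun x => g (f x)) ->
  cdom p q -> cdom r (f q) -> cdom s (g (f q)) ->
  dv (cexp g r s) (cmap r (f q)) (dv (cexp f p r) (cmap p q) e)
  = dv (cexp (fun x => g (f x)) p s) (cmap p q) e.
Proof.
move=> sf sg sgf pq rq sq.
have df := cexp_dif sf pq rq; have := cexp_dif sg rq sq.
rewrite -(cexp_cmap f r pq) => dg; rewrite -(dv_comp e df dg).
have oD : open (cexp_dom f p r) by exact: cexp_open.
apply: (dv_eq e oD (cexp_center pq rq)) => x [cx rx].
by rewrite /cexp cmapK.
Qed.

Section Tangent.
Context {n : nat} {M : manifold R n}.
Implicit Types (p q r : M) (U : set M).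
Local Notation E := 'rV[R]_n.
Local Notation tr := (cexp (fun q : M => q)).
Let si := smooth_id M.

Lemma tr_id p q e : cdom p q -> dv (tr p p) (cmap p q) e = e.
Proof.
move=> pq; rewrite -[RHS](dv_id (cmap p q) e).
by apply: (dv_eq e (@ccod_open _ _ _ p) (cmap_ccod pq)) => x cx; rewrite /cexp cinvK.
Qed.

Lemma extE p e q : ext p e q = dv (tr p q) (cmap p q) e.
Proof. by rewrite dvE. Qed.

Lemma tcoordE p q w : tcoord p ((q, w) : TM M) = dv (tr q p) (cmap q q) w.
Proof. by rewrite dvE. Qed.

Lemma tcoord_trans p r q e : cdom p q -> cdom r q ->
  tcoord r ((q, ext p e q) : TM M) = dv (tr p r) (cmap p q) e.
Proof.
move=> pq rq; rewrite tcoordE extE.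
exact: (cexp_comp e si si si pq (cdom_center q) rq).
Qed.

Lemma tcoord_ext p q e : cdom p q -> tcoord p ((q, ext p e q) : TM M) = e.
Proof. by move=> pq; rewrite tcoord_trans // tr_id. Qed.

Lemma ext_tcoord p q w : cdom p q -> ext p (tcoord p ((q, w) : TM M)) q = w.
Proof.
move=> pq; rewrite tcoordE extE.
rewrite (cexp_comp w si si si (cdom_center q) pq (cdom_center q)).
by rewrite tr_id //; exact: cdom_center.
Qed.

Lemma ext_center p e : ext p e p = e.
Proof. by rewrite extE tr_id //; exact: cdom_center. Qed.

Lemma tcoord_center p w : tcoord p ((p, w) : TM M) = w.
Proof. by rewrite tcoordE tr_id //; exact: cdom_center. Qed.

Lemma ext_lin p q : cdom p q -> linear (ext p ^~ q).
Proof.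
move=> pq a u v; rewrite !extE.
by apply: dv_linear; apply: (cexp_dif si) => //; exact: cdom_center.
Qed.

Lemma tcoord_lin p q : cdom p q -> linear (fun w => tcoord p ((q, w) : TM M)).
Proof.
move=> pq a u v; rewrite !tcoordE.
by apply: dv_linear; apply: (cexp_dif si) => //; exact: cdom_center.
Qed.

Lemma tinv_center p v : tinv p (cmap p p, v) = (p, v).
Proof. by rewrite /tinv /= cmapK ?ext_center //; exact: cdom_center. Qed.

Lemma vcoord_ext p e x : ccod p x -> vcoord p (ext p e) x = e.
Proof. by move=> cx; rewrite /vcoord tcoord_ext //; exact: cinv_cdom. Qed.

Definition cset p U : set E := [set x | ccod p x /\ U (cinv p x)].

Lemma cset_open p U : open U -> open (cset p U).
Proof. exact: chart_open. Qed.

Lemma tr_slin p r : slin (cexp_dom (fun q : M => q) p r) (fun x e => dv (tr p r) x e).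
Proof.
split=> [x Dx|e]; last by apply: sm_dv; exact: cexp_smooth.
by apply: dv_linear; exact: sm_dif (@cexp_smooth _ _ _ _ _ si p r) Dx.
Qed.

Lemma tr_smooth p r U : U `<=` cdom r -> smooth_on (cset p U) (tr p r).
Proof. by move=> sU; apply: sm_sub (@cexp_smooth _ _ _ _ _ si p r) => x [cx /sU]. Qed.

(** Coordinates in another chart arise by composing with a transition map and applying the
    differential of its inverse, both of them smooth. *)
Lemma vf_smooth_chart p U (X : vfield M) : open U -> U `<=` cdom p ->
  smooth_on (cset p U) (vcoord p X) -> vf_smooth U X.
Proof.
move=> oU sU sX p'.
have oc := cset_open (p := p') oU; have ocp := cset_open (p := p) oU.
apply: (@sm_ext _ _ _ _ (fun x => dv (tr p p') (tr p' p x) (vcoord p X (tr p' p x)))) => //.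
  move=> x [cx Ux]; have dx := sU _ Ux; have cdx := cinv_cdom cx.
  rewrite /vcoord {3}/cexp cmapK // -[X in tcoord p' (_, X)](ext_tcoord _ dx) tcoord_trans //.
have st := tr_smooth p' sU.
have oD := cexp_open (p := p) (r := p') si.
apply: (sm_fam (fd_rV _) oc oD (tr_slin p p')) => //.
  by move=> x [cx Ux]; apply: cexp_center; [exact: sU|exact: cinv_cdom].
apply: (sm_comp (fd_rV _) oc ocp _ sX st) => x [cx Ux].
by split; [exact: cmap_ccod (sU _ Ux)|rewrite /cexp cmapK //; exact: sU].
Qed.

Lemma fun_smooth_chart p U (f : M -> R) : open U -> U `<=` cdom p ->
  smooth_on (cset p U) (fun x => f (cinv p x)) -> fun_smooth U f.
Proof.
move=> oU sU sX p'.
have oc := cset_open (p := p') oU; have ocp := cset_open (p := p) oU.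
apply: (@sm_ext _ _ _ _ (fun x => f (cinv p (tr p' p x)))) => //.
  by move=> x [cx Ux]; rewrite /cexp cmapK //; exact: sU.
apply: (sm_comp (fd_rV _) oc ocp _ sX (tr_smooth p' sU)) => x [cx Ux].
by split; [exact: cmap_ccod (sU _ Ux)|rewrite /cexp cmapK //; exact: sU].
Qed.

Lemma vf_smooth_sub U U' (X : vfield M) : U' `<=` U -> vf_smooth U X -> vf_smooth U' X.
Proof. by move=> s sX p; apply: sm_sub (sX p) => x [cx /s]. Qed.

Lemma vf_smooth_eq U (X Y : vfield M) : open U -> (forall q, U q -> X q = Y q) ->
  vf_smooth U X -> vf_smooth U Y.
Proof.
move=> oU XY sX p; apply: sm_ext (sX p); first exact: cset_open.
by move=> x [cx Ux]; rewrite /vcoord XY.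
Qed.

Lemma vf_ext_smooth p e : vf_smooth (cdom p) (ext p e).
Proof.
apply: (@vf_smooth_chart p) => //; first exact: cdom_open.
apply: sm_ext (sm_cst _ e); first by apply: cset_open; exact: cdom_open.
by move=> x [cx _]; rewrite vcoord_ext.
Qed.

Lemma vf_smooth_lc U (f : M -> R) (X Y : vfield M) : open U -> fun_smooth U f ->
  vf_smooth U X -> vf_smooth U Y -> vf_smooth U (fun q => f q *: X q + Y q).
Proof.
move=> oU sf sX sY p; have oc := cset_open (p := p) oU.
apply: sm_ext (sm_add oc (sm_scale oc (sf p) (sX p)) (sY p)) => // x [cx Ux].
by rewrite /vcoord (tcoord_lin (cinv_cdom cx)).
Qed.

Lemma vf_smooth0 U : open U -> vf_smooth U (fun _ : M => 0).
Proof.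
move=> oU p; apply: sm_ext (sm_cst _ 0); first exact: cset_open.
by move=> x [cx _]; rewrite /vcoord (lin_0 (tcoord_lin (cinv_cdom cx))).
Qed.

Lemma fdiff_chart p (f : M -> R) q w : cdom p q ->
  dif (fun x => f (cinv p x)) (cmap p q) ->
  fdiff f q w = dv (fun x => f (cinv p x)) (cmap p q) (tcoord p ((q, w) : TM M)).
Proof.
move=> pq df; rewrite tcoordE.
have dt := cexp_dif si (cdom_center q) pq.
rewrite -(cexp_cmap (fun q => q) p (cdom_center q)) in df *.
rewrite -(dv_comp w dt df) /fdiff -dvE.
have oD := cexp_open (p := q) (r := p) si.
apply: (dv_eq w oD (cexp_center (cdom_center q) pq)) => x [cx px].
by rewrite /cexp cmapK.
Qed.

Lemma fun_smooth_cst U (c : R) : fun_smooth U (fun _ : M => c).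
Proof. by move=> p; exact: sm_cst. Qed.

Lemma vcoord_dif p U (X : vfield M) x : vf_smooth U X -> ccod p x -> U (cinv p x) ->
  dif (vcoord p X) x.
Proof. by move=> sX cx Ux; exact: sm_dif (sX p) (conj cx Ux). Qed.

End Tangent.

Section MapTangent.
Context {m n : nat} {M : manifold R m} {N : manifold R n}.
Variable f : M -> N.
Hypothesis sf : smooth_map f.

Lemma mdiffE q w : mdiff f q w = dv (cexp f q (f q)) (cmap q q) w.
Proof. by rewrite dvE. Qed.

Lemma mdiff_ext (p q : M) (r : N) e : cdom p q -> cdom r (f q) ->
  mdiff f q (ext p e q) = ext r (dv (cexp f p r) (cmap p q) e) (f q).
Proof.
move=> pq rq; rewrite mdiffE !extE.
rewrite (cexp_comp e (smooth_id M) sf sf pq (cdom_center q) (cdom_center (f q))).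
by rewrite (cexp_comp e sf (smooth_id N) sf pq rq (cdom_center (f q))).
Qed.

Lemma tmap_tinv (p : M) (r : N) z : ccod p z.1 -> cdom r (f (cinv p z.1)) ->
  tmap f (tinv p z) = tinv r (cexp f p r z.1, dv (cexp f p r) z.1 z.2).
Proof.
move=> cz rz; rewrite /tmap /tinv /= (mdiff_ext _ (cinv_cdom cz) rz) (cinvK cz).
have E1 : cinv r (cexp f p r z.1) = f (cinv p z.1) by exact: cmapK.
by rewrite E1.
Qed.

Lemma mdiff_lin q : linear (mdiff f q).
Proof.
move=> a u v; rewrite !mdiffE; apply: dv_linear.
by apply: (cexp_dif sf); exact: cdom_center.
Qed.

End MapTangent.
End Charts.

(** Takes the place of a bump function: smoothness on U looks only at points of U, where the
    indicator is the constant 1, however it jumps outside. *)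
Definition indf {R : realType} {T : Type} (U : set T) (q : T) : R := if `[<U q>] then 1 else 0.

Lemma indf1 (R : realType) (T : Type) (U : set T) (q : T) : U q -> indf U q = 1 :> R.
Proof. by move=> Uq; rewrite /indf asboolT. Qed.

Lemma indf_eq (R : realType) (T : Type) (V : lmodType R) (U : set T) (X Y : T -> V) :
  (forall q, U q -> X q = Y q) -> (fun q => indf U q *: X q) = (fun q => indf U q *: Y q).
Proof.
move=> XY; apply/funext => q; rewrite /indf; case: asboolP => [/XY -> //|_].
by rewrite !scale0r.
Qed.

(** The Christoffel symbols of nb at z, bundled into a bilinear map. *)
Definition gam {R : realType} {n : nat} {M : manifold R n} (nb : operator M) (p : M)
    (z : 'rV[R]_n * 'rV[R]_n) (e h : 'rV[R]_n) : 'rV[R]_n :=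
  tcoord p (cinv p z.1, nb (ext p e) (ext p h) (tinv p z)).

(** * Anisotropic connections in charts *)

Section Connection.
Context {R : realType} {n : nat} {M : manifold R n}.
Variables (A : set (TM M)) (nb : operator M).
Hypothesis ac : aniso_connection A nb.
Implicit Types (p q : M) (U : set M) (E H X : vfield M) (v : TM M).

Lemma indf_smooth U : open U -> fun_smooth U (indf U : M -> R).
Proof.
move=> oU p; apply: sm_ext (sm_cst _ (1 : R)); first exact: cset_open.
by move=> x [_ Ux] /=; rewrite indf1.
Qed.

Lemma fdiff_indf U q w : open U -> U q -> fdiff (indf U : M -> R) q w = 0.
Proof.
move=> oU Uq; rewrite /fdiff -dvE -[RHS](dv_cst (1 : R) (cmap q q) w).
apply: (dv_eq w (cset_open (p := q) oU)).
  by split; [exact: cmap_ccod (cdom_center q)|rewrite cmapK //; exact: cdom_center].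
by move=> x [_ Ux] /=; rewrite indf1.
Qed.

Lemma nb_indr U E H v : open U -> vf_smooth U E -> vf_smooth U H -> A v -> U v.1 ->
  nb E (fun q => indf U q *: H q) v = nb E H v.
Proof.
move=> oU sE sH Av Uv; rewrite (ac_leibniz ac oU (indf_smooth oU) sE sH Av Uv).
by rewrite fdiff_indf // indf1 // scale0r scale1r add0r.
Qed.

(* Locality: multiplying by the indicator function of an open set makes fields
   that agree on it equal. *)
Lemma nb_eqr U E H H' v : open U -> vf_smooth U E -> vf_smooth U H ->
  (forall q, U q -> H q = H' q) -> A v -> U v.1 -> nb E H v = nb E H' v.
Proof.
move=> oU sE sH HH Av Uv; have sH' := vf_smooth_eq oU HH sH.
by rewrite -(nb_indr oU sE sH Av Uv) -(nb_indr oU sE sH' Av Uv) (indf_eq HH).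
Qed.

Lemma nb_0l U H v : open U -> vf_smooth U H -> A v -> U v.1 -> nb (fun=> 0) H v = 0.
Proof.
move=> oU sH Av Uv; have s0 := vf_smooth0 oU.
have := ac_linear ac oU (@fun_smooth_cst _ _ _ U 1) s0 s0 sH Av Uv.
have -> : (fun q : M => 1 *: (0 : 'rV[R]_n) + 0) = (fun=> 0).
  by apply/funext => q; rewrite scaler0 addr0.
by rewrite scale1r -[X in X = _ -> _]addr0 => /addrI.
Qed.

Lemma nb_0r U E v : open U -> vf_smooth U E -> A v -> U v.1 -> nb E (fun=> 0) v = 0.
Proof.
move=> oU sE Av Uv; have s0 := vf_smooth0 oU.
have := ac_additive ac oU sE s0 s0 Av Uv.
have -> : (fun q : M => (0 : 'rV[R]_n) + 0) = (fun=> 0).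
  by apply/funext => q; rewrite addr0.
by rewrite -[X in X = _ -> _]addr0 => /addrI.
Qed.

Lemma nb_eql U E E' H v : open U -> vf_smooth U E -> vf_smooth U H ->
  (forall q, U q -> E q = E' q) -> A v -> U v.1 -> nb E H v = nb E' H v.
Proof.
move=> oU sE sH EE Av Uv; have sE' := vf_smooth_eq oU EE sE.
have s0 := vf_smooth0 oU.
have L1 X : vf_smooth U X -> nb (fun q => indf U q *: X q + 0) H v = nb X H v.
  move=> sX; rewrite (ac_linear ac oU (indf_smooth oU) sX s0 sH Av Uv).
  by rewrite indf1 // scale1r (nb_0l oU sH Av Uv) addr0.
rewrite -(L1 _ sE) -(L1 _ sE'); congr (nb _ _ _).
by apply/funext => q; have /(congr1 (@^~ q)) /= -> := indf_eq EE.
Qed.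

Section Sums.
Variables (U : set M) (I : Type) (f : I -> M -> R) (X : I -> vfield M).
Hypotheses (oU : open U) (sf : forall i, fun_smooth U (f i)) (sX : forall i, vf_smooth U (X i)).

Lemma vf_smooth_sum (s : seq I) : vf_smooth U (fun q => \sum_(i <- s) f i q *: X i q).
Proof.
elim: s => [|i s IH].
  apply: (vf_smooth_eq oU _ (vf_smooth0 oU)) => q _.
  by rewrite big_nil.
apply: (vf_smooth_eq oU _ (vf_smooth_lc oU (sf i) (sX i) IH)) => q _.
by rewrite big_cons.
Qed.

Lemma nb_suml (s : seq I) H v : vf_smooth U H -> A v -> U v.1 ->
  nb (fun q => \sum_(i <- s) f i q *: X i q) H v = \sum_(i <- s) f i v.1 *: nb (X i) H v.
Proof.
move=> sH Av Uv; elim: s => [|i s IH].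
  under eq_fun do rewrite big_nil.
  by rewrite big_nil (nb_0l oU sH Av Uv).
under eq_fun do rewrite big_cons.
rewrite big_cons -IH.
exact: (ac_linear ac oU (sf i) (sX i) (vf_smooth_sum s) sH Av Uv).
Qed.

Lemma nb_sumr (s : seq I) E v : vf_smooth U E -> A v -> U v.1 ->
  nb E (fun q => \sum_(i <- s) f i q *: X i q) v =
  \sum_(i <- s) (fdiff (f i) v.1 (E v.1) *: X i v.1 + f i v.1 *: nb E (X i) v).
Proof.
move=> sE Av Uv; elim: s => [|i s IH].
  under eq_fun do rewrite big_nil.
  by rewrite big_nil (nb_0r oU sE Av Uv).
under eq_fun do rewrite big_cons.
have s0 := vf_smooth0 oU; have sS := vf_smooth_sum s.
have sX1 : vf_smooth U (fun q => f i q *: X i q).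
  apply: (vf_smooth_eq oU _ (vf_smooth_lc oU (sf i) (sX i) s0)) => q _.
  by rewrite addr0.
rewrite big_cons -IH (ac_additive ac oU sE sX1 sS Av Uv).
by rewrite (ac_leibniz ac oU (sf i) sE (sX i) Av Uv).
Qed.

End Sums.

Section Chart.
Variable p : M.
Local Notation "'e_ i" := (delta_mx 0 i : 'rV[R]_n).

Lemma field_frame E q : cdom p q ->
  E q = \sum_j (tcoord p ((q, E q) : TM M)) 0 j *: ext p ('e_ j) q.
Proof.
move=> pq; rewrite -{1}(ext_tcoord (E q) pq).
exact: lin_delta (ext_lin (p := p) pq).
Qed.

Lemma coef_smooth U E j : open U -> U `<=` cdom p -> vf_smooth U E ->
  fun_smooth U (fun q => (tcoord p ((q, E q) : TM M)) 0 j).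
Proof.
move=> oU sU sE; apply: (@fun_smooth_chart _ _ _ p) => //.
by apply: sm_entry; [exact: cset_open|exact: sE].
Qed.

(** By locality both fields may be expanded over the coordinate frame of p; the Leibniz rule in H
    gives the derivative term and linearity the rest. *)
Lemma nb_frame U E H z : open U -> vf_smooth U E -> vf_smooth U H ->
  ccod p z.1 -> A (tinv p z) -> U (cinv p z.1) ->
  tcoord p (cinv p z.1, nb E H (tinv p z)) =
  dv (vcoord p H) z.1 (vcoord p E z.1) +
  \sum_j \sum_i ((vcoord p H z.1) 0 j * (vcoord p E z.1) 0 i) *: gam nb p z ('e_ i) ('e_ j).
Proof.
move=> oU0 sE0 sH0 cz Av Uz0; set q := cinv p z.1; set v := tinv p z.
pose U1 := U `&` cdom p.
have oU : open U1 by apply: openI => //; exact: cdom_open.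
have sU : U1 `<=` cdom p by move=> ? [].
have pq : cdom p q := cinv_cdom cz.
have Uq : U1 q by split.
have sE : vf_smooth U1 E by apply: vf_smooth_sub sE0 => ? [].
have sH : vf_smooth U1 H by apply: vf_smooth_sub sH0 => ? [].
have sX j : vf_smooth U1 (ext p ('e_ j)) by exact: vf_smooth_sub sU (vf_ext_smooth _ _).
have lt := tcoord_lin (p := p) pq.
have FH : forall q, U1 q -> H q = \sum_j (tcoord p ((q, H q) : TM M)) 0 j *: ext p ('e_ j) q.
  by move=> q' [_ pq']; exact: field_frame.
have FE : forall q, U1 q -> E q = \sum_j (tcoord p ((q, E q) : TM M)) 0 j *: ext p ('e_ j) q.
  by move=> q' [_ pq']; exact: field_frame.
rewrite (nb_eqr oU sE sH FH Av Uq) (nb_sumr oU (fun j => coef_smooth j oU sU sH) sX _ sE Av Uq).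
rewrite (lin_sum _ _ _ lt).
under eq_bigr => j _.
  rewrite (nb_eql oU sE (sX j) FE Av Uq).
  rewrite (nb_suml oU (fun i => coef_smooth i oU sU sE) sX _ (sX j) Av Uq).
  rewrite lt tcoord_ext // (lin_Z lt) (lin_sum _ _ _ lt).
  under eq_bigr do rewrite (lin_Z lt).
  over.
rewrite big_split /=; congr (_ + _); last first.
  by apply: eq_bigr => j _; rewrite scaler_sumr; apply: eq_bigr => i _; rewrite scalerA.
rewrite [RHS]row_sum_delta; apply: eq_bigr => j _; congr (_ *: _).
have dH : dif (vcoord p H) z.1 by exact: vcoord_dif sH cz Uq.
rewrite (fdiff_chart (p := p)) ?cinvK //; last exact: dif_entry.
exact: dv_entry.
Qed.

Lemma gam_frame z e h : ccod p z.1 -> A (tinv p z) ->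
  gam nb p z e h = \sum_j \sum_i (h 0 j * e 0 i) *: gam nb p z ('e_ i) ('e_ j).
Proof.
move=> cz Av; have sX w : vf_smooth (cdom p) (ext p w) := vf_ext_smooth _ _.
rewrite {1}/gam (nb_frame (cdom_open p) (sX e) (sX h) cz Av (cinv_cdom cz)).
rewrite !vcoord_ext // (dv_eq _ (@ccod_open _ _ _ p) cz (g := fun=> h)).
  by rewrite dv_cst add0r.
by move=> x cx; rewrite vcoord_ext.
Qed.

Lemma nb_chart U E H z : open U -> vf_smooth U E -> vf_smooth U H ->
  ccod p z.1 -> A (tinv p z) -> U (cinv p z.1) ->
  tcoord p (cinv p z.1, nb E H (tinv p z)) =
  dv (vcoord p H) z.1 (vcoord p E z.1) + gam nb p z (vcoord p E z.1) (vcoord p H z.1).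
Proof.
move=> oU sE sH cz Av Uz; rewrite (nb_frame oU sE sH cz Av Uz).
by rewrite -gam_frame.
Qed.

Hypothesis oA : topen A.

Lemma gam_bil : sbil (tdom A p) (gam nb p).
Proof.
split.
- move=> z e [cz Az] a u w; rewrite !(gam_frame _ _ cz Az) scaler_sumr -big_split.
  apply: eq_bigr => j _; rewrite scaler_sumr -big_split; apply: eq_bigr => i _ /=.
  by rewrite scalerA -scalerDl !mxE; congr (_ *: _); ring.
- move=> z h [cz Az] a u w; rewrite !(gam_frame _ _ cz Az) scaler_sumr -big_split.
  apply: eq_bigr => j _; rewrite scaler_sumr -big_split; apply: eq_bigr => i _ /=.
  by rewrite scalerA -scalerDl !mxE; congr (_ *: _); ring.
- move=> e h; have sX w : vf_smooth (cdom p) (ext p w) := vf_ext_smooth _ _.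
  apply: sm_sub (ac_smooth ac (cdom_open p) (sX e) (sX h) p) => z [cz Az].
  by split=> //; split=> //; exact: cinv_cdom.
Qed.

End Chart.
End Connection.

(** * Tensors and covariant derivatives read in a chart *)

Lemma lin_dif (R : realType) n (W : normedModType R) (f : 'rV[R]_n -> W) x : linear f -> dif f x.
Proof.
move=> lf; have sf : slin setT (fun _ : 'rV[R]_n => f) by split=> [//|e]; exact: sm_cst.
exact: (dif_fam openT sf I (dif_cst 0 x) (dif_id x)).
Qed.

Lemma lin_dv (R : realType) n (W : normedModType R) (f : 'rV[R]_n -> W) x u :
  linear f -> dv f x u = f u.
Proof.
move=> lf; have sf : slin setT (fun _ : 'rV[R]_n => f) by split=> [//|e]; exact: sm_cst.
by rewrite (dv_fam u openT sf I (dif_cst 0 x) (dif_id x)) dv_cst add0r dv_id.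
Qed.

Lemma open_graph (R : realType) m n (D : set 'rV[R]_m) (f : 'rV[R]_m -> 'rV[R]_n)
    (Om : set ('rV[R]_m * 'rV[R]_n)) : open D -> (forall x, D x -> dif f x) -> open Om ->
  open [set x | D x /\ Om (x, f x)].
Proof.
move=> oD df oOm; rewrite openE => x [Dx Ox]; apply: filterI.
  by apply: open_nbhs_nbhs; split.
have d : dif (fun y => (y, f y)) x by apply: dif_pair; [exact: dif_id|exact: df].
rewrite difE in d; apply: (differentiable_continuous d).
exact: open_nbhs_nbhs.
Qed.

Lemma derive1_fiber (R : realType) n (W : normedModType R)
    (f : 'rV[R]_n * 'rV[R]_n -> W) y w :
  derive1 (fun t : R => f (y.1, y.2 + t *: w)) 0 = dv f y (0, w).
Proof.
rewrite dvE /derive1 /derive.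
have -> : (fun h : R => h^-1 *: (f (y.1, y.2 + (h + 0) *: w) - f (y.1, y.2 + 0 *: w))) =
    (fun h : R => h^-1 *: (f (h *: (0, w) + y) - f y)).
  apply/funext => t; congr (_ *: (f _ - f _)).
    by apply: injective_projections; rewrite /= ?addr0 ?scaler0 ?add0r // addrC.
  by apply: injective_projections; rewrite /= ?scale0r ?addr0.
by [].
Qed.

Definition afc {R : realType} {n : nat} {M : manifold R n} (p : M) (X : afield M)
    (z : 'rV[R]_n * 'rV[R]_n) : 'rV[R]_n := tcoord p (cinv p z.1, X (tinv p z)).

Definition tenc {R : realType} {n : nat} {M : manifold R n} (p : M)
    (Q : TM M -> 'rV[R]_n -> 'rV[R]_n -> 'rV[R]_n)
    (z : 'rV[R]_n * 'rV[R]_n) (e h : 'rV[R]_n) : 'rV[R]_n :=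
  afc p (fun v => Q v (ext p e v.1) (ext p h v.1)) z.

Section Chart.
Context {R : realType} {n : nat} {M : manifold R n}.
Variable p : M.
Local Notation E := 'rV[R]_n.
Local Notation th z e := (ext p e (cinv p z.1)).

Lemma th_lin (z : E * E) : ccod p z.1 -> linear (fun e => th z e).
Proof. by move=> cz; apply: ext_lin; exact: cinv_cdom. Qed.

Lemma vshift_tinv (z : E * E) e : ccod p z.1 ->
  vshift (tinv p z) (th z e) = tinv p (z.1, z.2 + e).
Proof. by move=> cz; rewrite /vshift /tinv /= (lin_D (th_lin cz)). Qed.

Lemma fundamental_chart (L : TM M -> R) z e h : ccod p z.1 ->
  fundamental L (tinv p z) (th z e) (th z h) = gf (fun z => L (tinv p z)) z e h.
Proof.
move=> cz; rewrite /fundamental /gf; congr (_ * _).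
rewrite -(derive1_fiber (fun y => dv (fun z => L (tinv p z)) y (0, h)) z e).
congr (derive1 _ 0); apply/funext => s; rewrite -derive1_fiber /=.
congr (derive1 _ 0); apply/funext => t.
have -> : s *: th z e + t *: th z h = th z (s *: e + t *: h).
  by rewrite (lin_D (th_lin cz)) !(lin_Z (th_lin cz)).
by rewrite (vshift_tinv _ cz) addrA.
Qed.

Lemma cartan_chart (L : TM M -> R) z b e h : ccod p z.1 ->
  dif (fun y => dv (fun x => dv (fun z => L (tinv p z)) x (0, h)) y (0, e)) z ->
  cartan L (tinv p z) (th z b) (th z e) (th z h) = cf (fun z => L (tinv p z)) z b e h.
Proof.
move=> cz d3; rewrite /cartan /cf /gf (dv_cmul _ _ d3) mulrA.
congr (_ * _); first by rewrite -invfM -natrM.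
set l := fun z => L (tinv p z).
rewrite -(derive1_fiber (fun y => dv (fun x => dv l x (0, h)) y (0, e)) z b).
congr (derive1 _ 0); apply/funext => r.
rewrite -(derive1_fiber (fun y => dv l y (0, h)) (z.1, z.2 + r *: b) e).
congr (derive1 _ 0); apply/funext => s; rewrite -derive1_fiber /=.
congr (derive1 _ 0); apply/funext => t.
have -> : r *: th z b + s *: th z e + t *: th z h = th z (r *: b + s *: e + t *: h).
  by rewrite !(lin_D (th_lin cz)) !(lin_Z (th_lin cz)).
by rewrite (vshift_tinv _ cz) !addrA.
Qed.

Lemma vdot_fun (f : TM M -> R) z w : ccod p z.1 ->
  vdot f (tinv p z) w = dv (fun y => f (tinv p y)) z (0, tcoord p (cinv p z.1, w)).
Proof.
move=> cz; rewrite -derive1_fiber; congr (derive1 _ 0); apply/funext => t.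
have pq := cinv_cdom cz.
have -> : t *: w = th z (t *: tcoord p (cinv p z.1, w)).
  by rewrite (lin_Z (th_lin cz)) ext_tcoord.
by rewrite (vshift_tinv _ cz).
Qed.

Lemma vdot_field (X : afield M) z w : ccod p z.1 -> dif (afc p X) z ->
  tcoord p (cinv p z.1, vdot X (tinv p z) w) =
  dv (afc p X) z (0, tcoord p (cinv p z.1, w)).
Proof.
move=> cz dX; have pq := cinv_cdom cz; have lth := th_lin cz.
set u := tcoord p (cinv p z.1, w).
have -> : vdot X (tinv p z) w = derive1 (fun t : R => th z (afc p X (z.1, z.2 + t *: u))) 0.
  congr (derive1 _ 0); apply/funext => t.
  have -> : t *: w = th z (t *: u) by rewrite (lin_Z lth) ext_tcoord.
  by rewrite (vshift_tinv _ cz) /afc /= ext_tcoord.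
rewrite (derive1_fiber (fun y => th z (afc p X y)) z u).
by rewrite (dv_comp _ dX (lin_dif _ lth)) (lin_dv _ _ lth) tcoord_ext.
Qed.

Variables (A : set (TM M)) (nb : operator M).
Hypothesis ac : aniso_connection A nb.
Local Notation Ga := (gam nb p).

(* The field that [nabla_fun] and [nabla_field] use to extend the vector at z. *)
Local Notation V z := (ext (cinv p z.1) (th z z.2)).
Local Notation Vh z := (vcoord p (V z)).

Lemma Vh_center z : ccod p z.1 -> Vh z z.1 = z.2.
Proof. by move=> cz; rewrite /vcoord ext_center tcoord_ext //; exact: cinv_cdom. Qed.

Lemma Vh_dif z : ccod p z.1 -> dif (Vh z) z.1.
Proof. by move=> cz; apply: (vcoord_dif (vf_ext_smooth _ _) cz); exact: cdom_center. Qed.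

Lemma V_tinv z x : ccod p x -> (cinv p x, V z (cinv p x)) = tinv p (x, Vh z x).
Proof. by move=> cx; rewrite /tinv /= /vcoord ext_tcoord //; exact: cinv_cdom. Qed.

Lemma nb_V U (X : vfield M) z : open U -> vf_smooth U X -> ccod p z.1 -> A (tinv p z) ->
  U (cinv p z.1) ->
  tcoord p (cinv p z.1, nb X (V z) (tinv p z)) =
  dv (Vh z) z.1 (vcoord p X z.1) + Ga z (vcoord p X z.1) z.2.
Proof.
move=> oU sX cz Az Uz; pose U1 := U `&` cdom (cinv p z.1).
have oU1 : open U1 by apply: openI => //; exact: cdom_open.
have s1 : vf_smooth U1 X by apply: vf_smooth_sub sX => ? [].
have s2 : vf_smooth U1 (V z).
  by apply: vf_smooth_sub (vf_ext_smooth _ _) => ? [].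
rewrite (nb_chart ac oU1 s1 s2 cz Az) ?Vh_center //.
by split=> //; exact: cdom_center.
Qed.

(** The derivative of the extension V along X enters both terms of [nabla_fun] and cancels, leaving
    the derivative of f along the horizontal lift. *)
Lemma nabla_fun_chart U (X : vfield M) (f : TM M -> R) z :
  open U -> vf_smooth U X -> ccod p z.1 -> A (tinv p z) -> U (cinv p z.1) ->
  dif (fun y => f (tinv p y)) z ->
  nabla_fun nb X f (tinv p z) =
  dv (fun y => f (tinv p y)) z (vcoord p X z.1, - Ga z (vcoord p X z.1) z.2).
Proof.
move=> oU sX cz Az Uz df; have pq := cinv_cdom cz.
rewrite /nabla_fun vdot_fun // (nb_V oU sX cz Az Uz) /tinv /=.
set a := vcoord p X z.1; set F := fun y => f (tinv p y) in df *.
have dV := Vh_dif cz.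
have dp : dif (fun x => (x, Vh z x)) z.1 := dif_pair (dif_id _) dV.
have E1 x : ccod p x -> F (x, Vh z x) = f (cinv p x, V z (cinv p x)).
  by move=> cx; rewrite V_tinv.
have ez : (z.1, Vh z z.1) = z by rewrite Vh_center // -surjective_pairing.
have dF : dif F (z.1, Vh z z.1) by rewrite ez.
have dc : dif (fun x => F (x, Vh z x)) z.1 := dif_comp dp dF.
rewrite (fdiff_chart (p := p)) // cinvK //; last exact: (dif_eq (@ccod_open _ _ _ p) cz E1 dc).
rewrite -(dv_eq _ (@ccod_open _ _ _ p) cz E1) (dv_comp _ dp dF) ez.
rewrite (dv_pair _ (dif_id _) dV) dv_id -/(vcoord p X z.1) -/a.
rewrite -(lin_B (dv_linear df)); congr (dv F z _).
by apply: injective_projections; rewrite /= ?subr0 // opprD addNKr.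
Qed.

Lemma nabla_field_chart Om U (X : vfield M) (Y : afield M) z :
  open Om -> (forall y, Om y -> ccod p y.1) -> smooth_on Om (afc p Y) ->
  open U -> vf_smooth U X -> A (tinv p z) -> U (cinv p z.1) -> Om z ->
  tcoord p (cinv p z.1, nabla_field nb X Y (tinv p z)) =
  cov Ga (afc p Y) z (vcoord p X z.1).
Proof.
move=> oOm cOm sY oU sX Az Uz Oz; have cz := cOm _ Oz; have pq := cinv_cdom cz.
set q := cinv p z.1 in Uz *.
(* The extension V need not stay in the domain where Y is smooth; on the open set D it does, so the
   field Y(V) is smooth there. *)
pose D : set E := [set x | cset p (cdom q) x /\ Om (x, Vh z x)].
have oq : open (cset p (cdom q)) by apply: cset_open; exact: cdom_open.
have sV : smooth_on (cset p (cdom q)) (Vh z) := vf_ext_smooth _ _ p.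
have oD : open D by apply: open_graph => // x Dx; exact: sm_dif sV Dx.
pose U1 := U `&` [set q' | cdom p q' /\ D (cmap p q')].
have oU1 : open U1 by apply: openI => //; exact: chart_pull_open.
pose Z : vfield M := fun q' => Y (q', V z q').
have sD : cset p U1 `<=` D by move=> x [cx [_ [_]]]; rewrite cinvK.
have EZ x : D x -> vcoord p Z x = afc p Y (x, Vh z x).
  by move=> [[cx _] _]; rewrite /vcoord /afc /Z -V_tinv.
have oc : open (cset p U1) := cset_open oU1.
have sZ : vf_smooth U1 Z.
  have sU1 : U1 `<=` cdom p by move=> ? [_ []].
  apply: (vf_smooth_chart oU1 sU1).
  have E2 x : cset p U1 x -> afc p Y (x, Vh z x) = vcoord p Z x by move=> /sD Dx; rewrite EZ.
  apply: (sm_ext oc E2); apply: (sm_comp (fd_Z _ _) oc oOm _ sY); first by move=> x /sD[].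
  apply: (sm_pair oc); first exact: sm_id.
  by apply: sm_sub sV => x /sD[].
have s1 : vf_smooth U1 X by apply: vf_smooth_sub sX => ? [].
have ez : (z.1, Vh z z.1) = z by rewrite Vh_center // -surjective_pairing.
have Dz : D z.1 by split; [split=> //; exact: cdom_center|rewrite ez].
have Uq : U1 q by split; [exact: Uz|split; [exact: pq|rewrite /q (cinvK cz); exact: Dz]].
have dY := sm_dif sY Oz.
rewrite /nabla_field -/Z (lin_B (tcoord_lin pq)) (vdot_field _ cz dY).
rewrite (nb_V oU sX cz Az Uz) (nb_chart ac oU1 s1 sZ cz Az Uq) (EZ _ Dz) ez.
rewrite (dv_eq _ oD Dz EZ).
have dV := Vh_dif cz.
have dp : dif (fun x => (x, Vh z x)) z.1 := dif_pair (dif_id _) dV.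
have dF : dif (afc p Y) (z.1, Vh z z.1) by rewrite ez.
rewrite (dv_comp _ dp dF) ez (dv_pair _ (dif_id _) dV) dv_id.
set a := vcoord p X z.1; rewrite cov.unlock.
have l := dv_linear dY.
have -> : ((a, dv (Vh z) z.1 a) : E * E) = (a, 0) + (0, dv (Vh z) z.1 a).
  by apply: injective_projections; rewrite /= ?addr0 ?add0r.
have -> : ((0, dv (Vh z) z.1 a + Ga z a z.2) : E * E) = (0, dv (Vh z) z.1 a) + (0, Ga z a z.2).
  by apply: injective_projections; rewrite /= ?addr0 ?add0r.
rewrite !(lin_D l); apply/rowP => j; rewrite !mxE; ring.
Qed.

(** The bracket is computed in the chart of q, where both of its terms are second derivatives of the
    transition map from p to q. *)
Lemma lie_ext e h q : cdom p q -> lie (ext p e) (ext p h) q = 0.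
Proof.
move=> pq; pose f := fun q : M => q; have si : smooth_map f := smooth_id M.
have oq : open (cexp_dom f q p) by exact: cexp_open.
have op : open (cexp_dom f p q) by exact: cexp_open.
have xq := cexp_center (f := f) (cdom_center q) pq.
have d2 u x : cexp_dom f p q x -> dif (fun y => dv (cexp f p q) y u) x.
  by apply: sm_dif; apply: sm_dv; exact: cexp_smooth.
have xp := cexp_center (f := f) pq (cdom_center q).
have E1 u w : 'D_(ext p w q) (vcoord q (ext p u)) (cmap q q) =
    dv (fun y => dv (cexp f p q) y u) (cmap p q) w.
  rewrite -dvE.
  have E2 y : cexp_dom f q p y -> vcoord q (ext p u) y = dv (cexp f p q) (cexp f q p y) u.
    by move=> [cy py]; rewrite /vcoord tcoord_trans //; exact: cinv_cdom.
  have d1 := cexp_dif si (cdom_center q) pq.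
  rewrite (dv_eq _ oq xq E2).
  have ec : cexp f q p (cmap q q) = cmap p q by apply: cexp_cmap; exact: cdom_center.
  have d3 : dif (fun y => dv (cexp f p q) y u) (cexp f q p (cmap q q)) by rewrite ec; exact: d2.
  rewrite (dv_comp _ d1 d3) ec; congr (dv _ _ _).
  by rewrite -[RHS](tcoord_ext w pq) tcoordE.
have E3 : lie (ext p e) (ext p h) q =
    dv (fun y => dv (cexp f p q) y h) (cmap p q) e - dv (fun y => dv (cexp f p q) y e) (cmap p q) h.
  exact: (f_equal2 (fun a b => a - b) (E1 h e) (E1 e h)).
have sf : smooth_on (cexp_dom f p q) (cexp f p q) by exact: cexp_smooth.
by rewrite E3 (dv_schwarz_rV e h op xp sf) subrr.
Qed.

(** The bracket vanishes on the whole chart domain, so locality applies; this removes the bracket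
    term from the curvature. *)
Lemma nb_lie_ext e h X z : vf_smooth (cdom p) X -> ccod p z.1 -> A (tinv p z) ->
  nb (lie (ext p e) (ext p h)) X (tinv p z) = 0.
Proof.
move=> sX cz Az; have op := cdom_open p; have pq := cinv_cdom cz.
rewrite -(nb_0l ac op sX Az pq); symmetry.
by apply: (nb_eql ac op (vf_smooth0 op) sX _ Az pq) => q' pq'; rewrite lie_ext.
Qed.

End Chart.

Section Finsler.
Context {R : realType} {n : nat} {M : manifold R n}.
Variables (A : set (TM M)) (L : TM M -> R) (nb : operator M).
Hypothesis pf : pseudo_finsler A L.
Hypothesis lcc : levi_civita_chern A L nb.
Let ac := lcc_connection lcc.
Variable p : M.
Local Notation E := 'rV[R]_n.
Local Notation Ga := (gam nb p).
Local Notation th z e := (ext p e (cinv p z.1)).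
Local Notation tc z w := (tcoord p (cinv p z.1, w)).

Definition lagr (z : E * E) : R := L (tinv p z).

Lemma gam_sym z e h : tdom A p z -> Ga z e h = Ga z h e.
Proof.
move=> [cz Az]; have pq := cinv_cdom cz.
have := lcc_torsion_free lcc (cdom_open p) (vf_ext_smooth p e) (vf_ext_smooth p h) Az pq.
rewrite (lie_ext (p := p) e h pq) => /(canRL (subrK _)); rewrite add0r => E1.
by rewrite /gam E1.
Qed.

Lemma gam_ext z e h : ccod p z.1 -> nb (ext p e) (ext p h) (tinv p z) = th z (Ga z e h).
Proof. by move=> cz; rewrite /gam ext_tcoord //; exact: cinv_cdom. Qed.

Lemma lagr_smooth : smooth_on (tdom A p) lagr. Proof. exact: (pf_smooth pf p). Qed.

Lemma gam_compat z h e e' : tdom A p z ->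
  dv (fun y => gf lagr y e e') z (h, - Ga z h z.2) = gf lagr z (Ga z h e) e' + gf lagr z e (Ga z h e').
Proof.
move=> Oz; have [cz Az] := Oz; have pq := cinv_cdom cz; have op := cdom_open p.
have sX w : vf_smooth (cdom p) (ext p w) := vf_ext_smooth p w.
have oO : open (tdom A p) by exact: (pf_open pf).
have := lcc_metric lcc op (sX h) (sX e) (sX e') Az pq.
rewrite /nabla_form !gam_ext //.
have gE y u w : ccod p y.1 -> fundamental L (tinv p y) (th y u) (th y w) = gf lagr y u w.
  exact: fundamental_chart.
have E1 y : tdom A p y -> gf lagr y e e' =
    fundamental L (tinv p y) (ext p e (tinv p y).1) (ext p e' (tinv p y).1).
  by move=> [cy _]; rewrite gE.
have dg := sm_dif (gf_smooth oO lagr_smooth e e') Oz.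
rewrite (nabla_fun_chart ac op (sX h) cz Az pq (dif_eq oO Oz E1 dg)).
rewrite -(dv_eq _ oO Oz E1) vcoord_ext // !gE // => /eqP.
by rewrite -addrA -opprD subr_eq0 => /eqP.
Qed.

Lemma chart_finsler : local_finsler (tdom A p) lagr Ga.
Proof.
split.
- exact: (pf_open pf).
- exact: lagr_smooth.
- move=> z k [cz Az] k0; rewrite /lagr -(pf_homogeneous pf Az k0); congr L.
  by rewrite /tinv /= (lin_Z (th_lin cz)).
- move=> z [cz Az] e e0; have pq := cinv_cdom cz.
  rewrite -(tcoord_ext e pq) (pf_nondegenerate pf Az (e := th z e)) ?(lin_0 (tcoord_lin pq)) //.
  by move=> h; rewrite -(ext_tcoord h pq) fundamental_chart.
- exact: (gam_bil ac p).
- by move=> z e h; exact: gam_sym.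
- by move=> z h e e'; exact: gam_compat.
Qed.

Lemma csf_chart z e h : tdom A p z ->
  cartan_sharp L (tinv p z) (th z e) (th z h) = th z (csf lagr z e h).
Proof.
move=> Oz; have [cz Az] := Oz; have pq := cinv_cdom cz.
have HF := chart_finsler; have oO := lf_open HF; have sl := lf_smooth HF.
have d3 : dif (fun y => dv (fun x => dv lagr x (0, h)) y (0, e)) z.
  by apply: (sm_dif _ Oz); do 2 apply: sm_dv; exact: sl.
pose P c := forall b, fundamental L (tinv p z) b c = cartan L (tinv p z) b (th z e) (th z h).
have PE c : (forall b, gf lagr z b c = cf lagr z b e h) <-> P (th z c).
  split=> Hc b; last by rewrite -(fundamental_chart L b c cz) -(cartan_chart b cz d3).
  by rewrite -(ext_tcoord b pq) (fundamental_chart L _ c cz) (cartan_chart _ cz d3).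
have Pc : P (th z (csf lagr z e h)) by apply/PE => b; exact: (csfP HF).
have : P (cartan_sharp L (tinv p z) (th z e) (th z h)).
  by apply: (@xgetPex _ 0 P); exists (th z (csf lagr z e h)).
rewrite -(ext_tcoord (cartan_sharp _ _ _ _) pq); move: (tcoord _ _) => c /PE Hc.
suff -> : c = csf lagr z e h by [].
by apply: (gf_inj HF Oz) => b; rewrite Hc (csfP HF b e h Oz).
Qed.

End Finsler.

(** * Tensors at the centre of a chart *)

Section Center.
Context {R : realType} {n : nat} {M : manifold R n}.
Variables (A : set (TM M)) (nb : operator M).
Hypothesis ac : aniso_connection A nb.
Hypothesis oA : topen A.
Variables (p : M) (v : 'rV[R]_n).
Hypothesis Av : A (p, v).
Local Notation E := 'rV[R]_n.
Local Notation Ga := (gam nb p).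
Local Notation z0 := ((cmap p p, v) : E * E).

Let cz0 : ccod p z0.1. Proof. by apply: cmap_ccod; exact: cdom_center. Qed.
Let iz0 : cinv p z0.1 = p. Proof. by rewrite /= cmapK //; exact: cdom_center. Qed.
Let Az0 : A (tinv p z0). Proof. by rewrite tinv_center. Qed.

Let oAp : open (tdom A p). Proof. exact: oA. Qed.

Lemma tdom_center : tdom A p z0. Proof. by []. Qed.

(** A tangent vector at p stores its components in the chart of p, so at z0 no change of coordinates
    intervenes. *)
Lemma afc_center X : afc p X z0 = X (p, v).
Proof. by rewrite /afc iz0 tinv_center tcoord_center. Qed.

Lemma gam_center e h : nb (ext p e) (ext p h) (p, v) = Ga z0 e h.
Proof. by rewrite /gam iz0 tinv_center tcoord_center. Qed.

Lemma tenc_center (Q : TM M -> E -> E -> E) e h : Q (p, v) e h = tenc p Q z0 e h.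
Proof. by rewrite /tenc afc_center /= !ext_center. Qed.

Lemma nabla_field_center Om (Y : afield M) e : open Om -> (forall y, Om y -> ccod p y.1) ->
  smooth_on Om (afc p Y) -> Om z0 ->
  nabla_field nb (ext p e) Y (p, v) = cov Ga (afc p Y) z0 e.
Proof.
move=> oOm cOm sY Oz; have Uz : cdom p (cinv p z0.1) by rewrite iz0; exact: cdom_center.
have := nabla_field_chart ac oOm cOm sY (cdom_open p) (vf_ext_smooth p e) Az0 Uz Oz.
by rewrite tinv_center iz0 tcoord_center vcoord_ext.
Qed.

Lemma vdot_center (X : afield M) w : dif (afc p X) z0 ->
  vdot X (p, v) w = dv (afc p X) z0 (0, w).
Proof. by move=> dX; have := vdot_field w cz0 dX; rewrite tinv_center iz0 !tcoord_center. Qed.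

Lemma curvature_center e h b : curvature nb (p, v) e h b = Rf Ga z0 e h b.
Proof.
have cO y : tdom A p y -> ccod p y.1 by case.
have [_ _ sG] := gam_bil ac p.
have sX : vf_smooth (cdom p) (ext p b) := vf_ext_smooth p b.
rewrite /curvature /curvature_field /= /Rf.
rewrite (nabla_field_center (Om := tdom A p) e oAp cO (sG h b) tdom_center).
rewrite (nabla_field_center (Om := tdom A p) h oAp cO (sG e b) tdom_center).
have := nb_lie_ext ac e h sX cz0 Az0; rewrite tinv_center => ->.
by rewrite subr0.
Qed.

Lemma Ptensor_center e h b : Ptensor nb (p, v) e h b = Pf Ga z0 e h b.
Proof.
have [_ _ sG] := gam_bil ac p.
by rewrite /Ptensor vdot_center //; exact: sm_dif (sG e h) tdom_center.
Qed.

Lemma nabla_tensor_center Om (Q : TM M -> E -> E -> E) x y w :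
  open Om -> (forall y, Om y -> ccod p y.1) ->
  (forall e h, smooth_on Om (fun z => tenc p Q z e h)) -> Om z0 ->
  nabla_tensor nb Q (p, v) x y w = covT Ga (tenc p Q) z0 x y w.
Proof.
move=> oOm cOm sQ Oz; rewrite /nabla_tensor /= /covT.
rewrite (nabla_field_center x oOm cOm (sQ y w) Oz) !gam_center.
by rewrite !tenc_center.
Qed.

End Center.

Lemma local_finsler_sub (R : realType) m (Om Om' : set ('rV[R]_m * 'rV[R]_m)) l Ga :
  local_finsler Om l Ga -> open Om' -> Om' `<=` Om -> local_finsler Om' l Ga.
Proof.
move=> H oO s; have [l1 l2 sG] := lf_bil H; split=> //.
- exact: sm_sub s (lf_smooth H).
- by move=> z k /s; exact: (lf_hom H).
- by move=> z /s; exact: (lf_nondeg H).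
- by split=> [z e /s|z h /s|e h]; [exact: l1|exact: l2|exact: sm_sub s (sG e h)].
- by move=> z e h /s; exact: (lf_sym H).
- by move=> z h e e' /s; exact: (lf_compat H).
Qed.

Lemma cov_eq (R : realType) m (Om : set ('rV[R]_m * 'rV[R]_m)) Ga X Y z h :
  open Om -> Om z -> (forall y, Om y -> X y = Y y) -> cov Ga X z h = cov Ga Y z h.
Proof. by move=> oO Oz XY; rewrite cov.unlock !(dv_eq _ oO Oz XY) XY. Qed.

Section CovTop.
Context {R : realType} {m n : nat}.
Local Notation E := 'rV[R]_m.
Variables (Om : set (E * E)) (l : E * E -> R) (Ga : E * E -> E -> E -> E).
Variables (U : set E) (sg : E -> 'rV[R]_n).
Hypothesis H : local_finsler Om l Ga.
Hypothesis S : local_submersion Om l U sg.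
Local Notation top := (topf l sg).
Local Notation K := (ktop l Ga sg).
Variables (X : E -> E) (z : E * E).
Hypotheses (Oz : Om z) (dX : dif X z.1).

Let dX1 : dif (fun y : E * E => X y.1) z. Proof. exact: dif_comp (dif_fst z) dX. Qed.
Let dT : dif (fun y : E * E => top y (X y.1)) z.
Proof. exact: (dif_fam (lf_open H) (top_slin H S) Oz (dif_id z) dX1). Qed.

Lemma cov_top h : cov Ga (fun y => top y (X y.1)) z h =
  K z h (X z.1) + top z (Ga z h (X z.1)) + top z (dv X z.1 h).
Proof.
have lt := top_lin H S Oz.
have E1 xi : dv (fun y : E * E => top y (X y.1)) z xi =
    dv (fun y => top y (X z.1)) z xi + top z (dv X z.1 xi.1).
  rewrite (dv_fam xi (lf_open H) (top_slin H S) Oz (dif_id z) dX1) dv_id.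
  by rewrite (dv_comp _ (dif_fst z) dX) dv_fst.
rewrite ktop.unlock cov.unlock !E1 /= (lin_0 (dv_linear dX)) (lin_0 lt) addr0.
apply/rowP => j; rewrite !mxE; ring.
Qed.

Lemma cov_bot h : cov Ga (fun y => X y.1 - top y (X y.1)) z h =
  Ga z h (X z.1) + dv X z.1 h - cov Ga (fun y => top y (X y.1)) z h.
Proof.
have lG := ga_lin2 H h Oz.
rewrite cov.unlock !(dv_sub _ dX1 dT) !(dv_comp _ (dif_fst z) dX) !dv_fst /=.
rewrite (lin_0 (dv_linear dX)) (lin_D lG) (lin_N lG).
apply/rowP => j; rewrite !mxE; ring.
Qed.

(** The right side is the defining formula of chi for an arbitrary extension X. The derivatives of X
    cancel, which is its tensoriality, and K - 2 top K remains. *)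
Lemma chif_cov h : chif l Ga sg z h (X z.1) =
  top z (cov Ga (fun y => X y.1 - top y (X y.1)) z h)
  + (cov Ga (fun y => top y (X y.1)) z h - top z (cov Ga (fun y => top y (X y.1)) z h)).
Proof.
have lt := top_lin H S Oz.
rewrite cov_bot cov_top chif.unlock !(lin_D lt) !(lin_N lt) !(lin_D lt) !(top_top H S _ Oz).
apply/rowP => j; rewrite !mxE; ring.
Qed.

End CovTop.

(* [Qhat] and [Qtilde] are natural in the underlying vector space. *)
Lemma Qhat_push (R : realType) (V W : lmodType R) (th : V -> W) (top T : V -> V) (C : V -> V -> V)
    (top' T' : W -> W) (C' : W -> W -> W) e h v : linear th ->
  (forall e, top' (th e) = th (top e)) -> (forall e, T' (th e) = th (T e)) ->
  (forall e h, C' (th e) (th h) = th (C e h)) ->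
  - top' (T' (C' (top' (th e)) (top' (th h))) + C' (T' (top' (th e))) (top' (th h))
    + C' (top' (th e)) (T' (top' (th h))) + C' (top' (C' (top' (th e)) (top' (th h)))) (T' (th v))
    - C' (top' (C' (top' (th e)) (T' (th v)))) (top' (th h))
    - C' (top' (th e)) (top' (C' (top' (th h)) (T' (th v))))) =
  th (- top (T (C (top e) (top h)) + C (T (top e)) (top h) + C (top e) (T (top h))
    + C (top (C (top e) (top h))) (T v)
    - C (top (C (top e) (T v))) (top h) - C (top e) (top (C (top h) (T v))))).
Proof.
move=> lt ht hT hC /=.
by rewrite !(ht, hT, hC) -!(lin_D lt) -!(lin_B lt) ht (lin_N lt).
Qed.

Lemma Qtilde_push (R : realType) (V W : lmodType R) (th : V -> W) (bot T : V -> V) (C : V -> V -> V)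
    (bot' T' : W -> W) (C' : W -> W -> W) e h : linear th ->
  (forall e, bot' (th e) = th (bot e)) -> (forall e, T' (th e) = th (T e)) ->
  (forall e h, C' (th e) (th h) = th (C e h)) ->
  bot' (T' (C' (bot' (th e)) (bot' (th h))) + C' (T' (bot' (th e))) (bot' (th h))
    + C' (bot' (th e)) (T' (bot' (th h)))) =
  th (bot (T (C (bot e) (bot h)) + C (T (bot e)) (bot h) + C (bot e) (T (bot h)))).
Proof.
move=> lt ht hT hC /=.
by rewrite !(ht, hT, hC) -!(lin_D lt) ht.
Qed.

(** * Submersions in charts *)

Section SubmersionChart.
Context {R : realType} {m n : nat} {M : manifold R m} {B : manifold R n}.
Variables (sigma : M -> B) (A : set (TM M)) (L : TM M -> R) (nb : operator M).
Hypothesis ssg : smooth_map sigma.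
Hypothesis sub : forall p (y : 'rV[R]_n), exists x, mdiff sigma p x = y.
Hypothesis pf : pseudo_finsler A L.
Hypothesis hver : vertical_nondegenerate sigma A L.
Hypothesis lcc : levi_civita_chern A L nb.
Let ac := lcc_connection lcc.
Variables (p : M) (r : B).
Local Notation E := 'rV[R]_m.
Local Notation Ga := (gam nb p).
Local Notation lag := (lagr L p).
Local Notation th z e := (ext p e (cinv p z.1)).
Local Notation U := (cexp_dom sigma p r).
Local Notation sg := (cexp sigma p r).

Definition sdom : set (E * E) := [set z | tdom A p z /\ U z.1].
Local Notation Om := sdom.
Local Notation top := (topf lag sg).
Local Notation K := (ktop lag Ga sg).
Local Notation chi' := (chif lag Ga sg).

Lemma sdom_open : open Om.
Proof.
apply: openI; first exact: (pf_open pf).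
by apply: open_comp => [z _|]; [exact: fst_continuous|exact: cexp_open].
Qed.

Lemma sub_finsler : local_finsler Om lag Ga.
Proof. by apply: local_finsler_sub (chart_finsler pf lcc p) sdom_open _ => z []. Qed.

Lemma mdiff_chart (z : E * E) w : U z.1 -> mdiff sigma (cinv p z.1) (th z w) = ext r (dv sg z.1 w) (sigma (cinv p z.1)).
Proof. by move=> [cz rz]; rewrite (mdiff_ext ssg w (cinv_cdom cz) rz) cinvK. Qed.

Lemma vertical_chart (z : E * E) w : U z.1 -> vertical sigma (cinv p z.1) (th z w) <-> dv sg z.1 w = 0.
Proof.
move=> Uz; have [cz rz] := Uz; rewrite /vertical /= mdiff_chart //; split=> [E0|->].
  by rewrite -(tcoord_ext (dv sg z.1 w) rz) E0 (lin_0 (tcoord_lin rz)).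
exact: (lin_0 (ext_lin rz)).
Qed.

Lemma sub_submersion : local_submersion Om lag U sg.
Proof.
split.
- exact: cexp_open.
- by move=> z [].
- exact: cexp_smooth.
- move=> x Ux y; have [cx rx] := Ux.
  have [w Ew] := sub (cinv p x) (ext r y (sigma (cinv p x))).
  exists (tcoord p (cinv p x, w)); rewrite -(tcoord_ext (dv sg x _) rx).
  rewrite -(mdiff_chart (z := (x, 0)) _ Ux) /= ext_tcoord ?Ew ?tcoord_ext //.
  exact: cinv_cdom.
- move=> z w [[cz Az] Uz] w0 hw; have pq := cinv_cdom cz.
  have w1 : vertical sigma (cinv p z.1) (th z w) by apply/vertical_chart.
  rewrite -(tcoord_ext w pq) (hver Az w1) ?(lin_0 (tcoord_lin pq)) // => u.
  rewrite /= -(ext_tcoord u pq) => /(vertical_chart _ Uz) u0.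
  by rewrite fundamental_chart //; apply: hw.
Qed.

Local Notation H := sub_finsler.
Local Notation S := sub_submersion.

Lemma ghorizontal_chart z x : Om z ->
  ghorizontal sigma L (tinv p z) (th z x) <-> top z x = 0.
Proof.
move=> Oz; have [[cz Az] Uz] := Oz; have pq := cinv_cdom cz.
have g1 h := gf_lin1 (lf_smooth H) h Oz.
split=> [hx|tx w].
  apply: (top_uniq H S Oz).
    by rewrite (lin_0 (dsg_lin S Oz)).
  move=> u u0; rewrite (lin_0 (g1 _)) -fundamental_chart // hx //.
  exact/vertical_chart.
rewrite /= -(ext_tcoord w pq) => /(vertical_chart _ Uz) w0.
rewrite fundamental_chart // -(top_orth H S x Oz w0) tx.
exact: (lin_0 (g1 _)).
Qed.

Lemma vtop_chart z e : Om z -> vtop sigma L (tinv p z) (th z e) = th z (top z e).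
Proof.
move=> Oz; have [[cz Az] Uz] := Oz; have pq := cinv_cdom cz.
have lth := ext_lin (p := p) pq; have lt := top_lin H S Oz.
pose P w := vertical sigma (cinv p z.1) w /\ ghorizontal sigma L (tinv p z) (th z e - w).
have PE w : P (th z w) <-> dv sg z.1 w = 0 /\ top z (e - w) = 0.
  rewrite /P -(lin_B lth); split=> -[h1 h2].
    by split; [apply/(vertical_chart _ Uz)|apply/(ghorizontal_chart _ Oz)].
  by split; [apply/(vertical_chart _ Uz)|apply/(ghorizontal_chart _ Oz)].
have Pt : P (th z (top z e)).
  apply/PE; split; first exact: (top_ver H S).
  by rewrite (lin_B lt) (top_top H S _ Oz) subrr.
have : P (vtop sigma L (tinv p z) (th z e)).
  by apply: (@xgetPex _ 0 P); exists (th z (top z e)).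
rewrite -(ext_tcoord (vtop _ _ _ _) pq); move: (tcoord _ _) => w /PE[w0 tw].
suff -> : w = top z e by [].
by move: tw; rewrite (lin_B lt) (top_id H S Oz w0) => /eqP; rewrite subr_eq0 => /eqP.
Qed.

Lemma vbot_chart z e : Om z -> vbot sigma L (tinv p z) (th z e) = th z (e - top z e).
Proof.
move=> Oz; have [[cz Az] Uz] := Oz; have pq := cinv_cdom cz.
have lth := ext_lin (p := p) pq.
by rewrite /vbot (vtop_chart _ Oz) (lin_B lth).
Qed.

Lemma chi_chart z h e : Om z ->
  chi sigma L nb (tinv p z) (th z h) (th z e) = th z (chi' z h e).
Proof.
move=> Oz; have [[cz Az] Uz] := Oz; have pq := cinv_cdom cz.
set q := cinv p z.1 in pq *; set v := tinv p z.
(* The extension used by [chi] is constant in the chart of its base point q, not in that of p; here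
   it becomes a field X with variable components, to which [chif_cov] applies. *)
pose X := vcoord p (ext q (th z e)).
have sX : smooth_on (cset p (cdom q)) X := vf_ext_smooth q (th z e) p.
have qz : cset p (cdom q) z.1 by split; [exact: cz|exact: cdom_center].
have dX := sm_dif sX qz.
have Xz : X z.1 = e by rewrite /X /vcoord ext_center tcoord_ext.
pose Om1 := Om `&` (fst @^-1` cset p (cdom q)).
have oO : open Om1.
  apply: openI; first exact: sdom_open.
  apply: open_comp => [y _|]; first exact: fst_continuous.
  by apply: cset_open; exact: cdom_open.
have Oz1 : Om1 z by split.
have c1 y : Om1 y -> ccod p y.1 by move=> [[[]]].
have EX y : Om1 y -> ext q (th z e) (cinv p y.1) = th y (X y.1).
  by move=> /c1 cy; rewrite /X /vcoord ext_tcoord //; exact: cinv_cdom.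
pose Yt : afield M := fun v' => vtop sigma L v' (ext q (th z e) v'.1).
pose Yb : afield M := fun v' => vbot sigma L v' (ext q (th z e) v'.1).
have Et y : Om1 y -> top y (X y.1) = afc p Yt y.
  move=> Oy; have [Oy' _] := Oy; have cy := c1 _ Oy.
  by rewrite /afc /Yt /= (EX _ Oy) (vtop_chart _ Oy') tcoord_ext //; exact: cinv_cdom.
have Eb y : Om1 y -> X y.1 - top y (X y.1) = afc p Yb y.
  move=> Oy; have [Oy' _] := Oy; have cy := c1 _ Oy.
  by rewrite /afc /Yb /= (EX _ Oy) (vbot_chart _ Oy') tcoord_ext //; exact: cinv_cdom.
have sX1 : smooth_on Om1 (fun y => X y.1).
  have oc : open (cset p (cdom q)) by apply: cset_open; exact: cdom_open.
  apply: (@sm_comp _ _ _ _ Om1 _ fst X (fd_rV _) oO oc _ sX (sm_fst _)).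
  by move=> y [].
have sT : smooth_on Om1 (fun y => top y (X y.1)).
  apply: (sm_fam (fd_Z _ _) oO sdom_open (top_slin H S) _ (@sm_id _ _ _) sX1).
  by move=> y [].
have st := sm_ext oO Et sT; have sb := sm_ext oO Eb (sm_sub2 oO sX1 sT).
have sh : vf_smooth (cdom q) (ext q (th z h)) := vf_ext_smooth _ _.
have qq := cdom_center q.
have Xh : vcoord p (ext q (th z h)) z.1 = h by rewrite /vcoord ext_center tcoord_ext.
have Nt := nabla_field_chart ac oO c1 st (cdom_open q) sh Az qq Oz1.
have Nb := nabla_field_chart ac oO c1 sb (cdom_open q) sh Az qq Oz1.
rewrite Xh -(cov_eq _ _ oO Oz1 Et) in Nt; rewrite Xh -(cov_eq _ _ oO Oz1 Eb) in Nb.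
have {}Nt := etrans (esym (ext_tcoord _ pq)) (congr1 (ext p ^~ q) Nt).
have {}Nb := etrans (esym (ext_tcoord _ pq)) (congr1 (ext p ^~ q) Nb).
have -> : chi sigma L nb v (th z h) (th z e) =
    vtop sigma L v (nabla_field nb (ext q (th z h)) Yb v)
    + vbot sigma L v (nabla_field nb (ext q (th z h)) Yt v) by [].
rewrite -[in RHS]Xz (chif_cov H S Oz dX) (lin_D (ext_lin (p := p) pq)) Nt Nb.
by congr (_ + _); [exact: vtop_chart|exact: vbot_chart].
Qed.

Lemma Qhat_chart z e h : Om z ->
  Qhat sigma L nb (tinv p z) (th z e) (th z h) = th z (Qhf lag Ga sg z e h).
Proof.
move=> Oz; have [[cz Az] Uz] := Oz; have pq := cinv_cdom cz.
have lth := ext_lin (p := p) pq.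
rewrite Qhf.unlock; cbv zeta beta.
have ht e' : vtop sigma L (tinv p z) (th z e') = th z (top z e') by exact: vtop_chart.
have hT e' : oneillT sigma L nb (tinv p z) (th z z.2) (th z e') = th z (chi' z (top z z.2) e').
  by rewrite /oneillT (vtop_chart _ Oz) (chi_chart _ _ Oz).
have hC e' h' : cartan_sharp L (tinv p z) (th z e') (th z h') = th z (csf lag z e' h').
  by apply: (csf_chart pf lcc); case: Oz.
exact: (Qhat_push e h z.2 lth ht hT hC).
Qed.

Lemma Qtilde_chart z e h : Om z ->
  Qtilde sigma L nb (tinv p z) (th z e) (th z h) = th z (Qtf lag Ga sg z e h).
Proof.
move=> Oz; have [[cz Az] Uz] := Oz; have pq := cinv_cdom cz.
have lth := ext_lin (p := p) pq.
rewrite Qtf.unlock; cbv zeta beta.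
have hb e' : vbot sigma L (tinv p z) (th z e') = th z (e' - top z e') by exact: vbot_chart.
have hT e' : oneillA sigma L nb (tinv p z) (th z z.2) (th z e') = th z (chi' z (z.2 - top z z.2) e').
  by rewrite /oneillA (vbot_chart _ Oz) (chi_chart _ _ Oz).
have hC e' h' : cartan_sharp L (tinv p z) (th z e') (th z h') = th z (csf lag z e' h').
  by apply: (csf_chart pf lcc); case: Oz.
exact: (Qtilde_push (bot := fun e => e - top z e) e h lth hb hT hC).
Qed.

End SubmersionChart.

Section SubmersionCenter.
Context {R : realType} {m n : nat} {M : manifold R m} {B : manifold R n}.
Variables (sigma : M -> B) (A : set (TM M)) (L : TM M -> R) (nb : operator M).
Hypothesis ssg : smooth_map sigma.
Hypothesis sub : forall p (y : 'rV[R]_n), exists x, mdiff sigma p x = y.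
Hypothesis pf : pseudo_finsler A L.
Hypothesis hver : vertical_nondegenerate sigma A L.
Hypothesis lcc : levi_civita_chern A L nb.
Variables (p : M) (r : B) (v : 'rV[R]_m).
Hypotheses (Av : A (p, v)) (rp : cdom r (sigma p)).
Local Notation E := 'rV[R]_m.
Local Notation Ga := (gam nb p).
Local Notation lag := (lagr L p).
Local Notation sg := (cexp sigma p r).
Local Notation z0 := ((cmap p p, v) : E * E).
Local Notation Om := (sdom sigma A p r).

Let iz0 : cinv p z0.1 = p. Proof. by rewrite /= cmapK //; exact: cdom_center. Qed.

Lemma sdom_center : Om z0.
Proof.
have cp := cmap_ccod (cdom_center p).
by split; [split; [exact: cp|rewrite tinv_center]|split; [exact: cp|rewrite iz0]].
Qed.

Lemma vtop_center e : vtop sigma L (p, v) e = topf lag sg z0 e.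
Proof.
have := vtop_chart ssg sub pf hver lcc e sdom_center.
by rewrite tinv_center iz0 !ext_center.
Qed.

Lemma chi_center h e : chi sigma L nb (p, v) h e = chif lag Ga sg z0 h e.
Proof.
have := chi_chart ssg sub pf hver lcc h e sdom_center.
by rewrite tinv_center iz0 !ext_center.
Qed.

Lemma csf_center e h : cartan_sharp L (p, v) e h = csf lag z0 e h.
Proof.
have [Oz _] := sdom_center; have := csf_chart pf lcc e h Oz.
by rewrite tinv_center iz0 !ext_center.
Qed.

Lemma Qhat_center e h : Qhat sigma L nb (p, v) e h = Qhf lag Ga sg z0 e h.
Proof.
have := Qhat_chart ssg sub pf hver lcc e h sdom_center.
by rewrite tinv_center iz0 !ext_center.
Qed.

Lemma Qtilde_center e h : Qtilde sigma L nb (p, v) e h = Qtf lag Ga sg z0 e h.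
Proof.
have := Qtilde_chart ssg sub pf hver lcc e h sdom_center.
by rewrite tinv_center iz0 !ext_center.
Qed.

Lemma vertical_center w : vertical sigma p w <-> dv sg (cmap p p) w = 0.
Proof.
have [_ Uz] := sdom_center; have := vertical_chart ssg w Uz.
by rewrite iz0 !ext_center.
Qed.

Lemma ghorizontal_center x : ghorizontal sigma L (p, v) x <-> topf lag sg z0 x = 0.
Proof.
have := ghorizontal_chart ssg sub pf hver lcc x sdom_center.
by rewrite tinv_center iz0 !ext_center.
Qed.

End SubmersionCenter.

Lemma covT_eq (R : realType) m (Om : set ('rV[R]_m * 'rV[R]_m)) Ga Q Q' z x y w :
  open Om -> Om z -> (forall z e h, Om z -> Q z e h = Q' z e h) ->
  covT Ga Q z x y w = covT Ga Q' z x y w.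
Proof.
move=> oO Oz QQ; rewrite /covT (cov_eq _ _ oO Oz (fun z' => QQ z' y w)).
by rewrite !QQ.
Qed.

Section RowMaps.
Context {R : realType}.

Definition lmx k m (f : 'rV[R]_k -> 'rV[R]_m) : 'M[R]_(k, m) := \matrix_i f (delta_mx 0 i).

Lemma lmxE k m (f : 'rV[R]_k -> 'rV[R]_m) u : linear f -> u *m lmx f = f u.
Proof.
move=> lf; rewrite [RHS](lin_delta u lf) mulmx_sum_row.
by apply: eq_bigr => i _; rewrite rowK.
Qed.

(** Dimension count: the image of f lies in the kernel of g, and both have rank m - n. *)
Lemma exact_range k m n (f : 'rV[R]_k -> 'rV[R]_m) (g : 'rV[R]_m -> 'rV[R]_n) w :
  linear f -> linear g -> k = (m - n)%N -> (forall u, f u = 0 -> u = 0) ->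
  (forall y, exists x, g x = y) -> (forall u, g (f u) = 0) -> g w = 0 ->
  exists u, f u = w.
Proof.
move=> lf lg km inj_f surj_g gf w0.
have rf : \rank (lmx f) = k.
  by apply/eqP; apply: inj_row_free => u; rewrite lmxE //; exact: inj_f.
have rg : \rank (lmx g) = n.
  apply/eqP; rewrite -/(row_full _) -sub1mx; apply/row_subP => i.
  have [x Ex] := surj_g (row i 1%:M).
  by rewrite -Ex -lmxE // submxMl.
have sub : (lmx f <= kermx (lmx g))%MS.
  apply/row_subP => i; rewrite sub_kermx lmxE // rowK.
  by rewrite gf.
have s2 : (kermx (lmx g) <= lmx f)%MS.
  by rewrite -(geq_leqif (mxrank_leqif_sup sub)) mxrank_ker rf rg km.
have : (w <= kermx (lmx g))%MS by rewrite sub_kermx lmxE // w0.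
move=> /submx_trans /(_ s2) /submxP[u Eu].
by exists u; rewrite -lmxE.
Qed.

(** If u J J^T = 0, then u J is a real vector whose squares sum to zero. *)
Lemma gram_unitmx k m (J : 'M[R]_(k, m)) : (forall u : 'rV_k, u *m J = 0 -> u = 0) ->
  J *m J^T \in unitmx.
Proof.
move=> inj; apply: mx_unit_inj => u u0; apply: inj.
have : (u *m J) *m (u *m J)^T = 0 by rewrite trmx_mul mulmxA -[u *m J *m _]mulmxA u0 mul0mx.
move=> /matrixP/(_ 0 0); rewrite !mxE => /eqP; rewrite psumr_eq0; last first.
  by move=> j _; rewrite [_^T _ _]mxE -expr2 sqr_ge0.
move=> /allP h; apply/rowP => j; have := h j; rewrite mem_index_enum => /(_ isT).
by rewrite [_^T _ _]mxE mulf_eq0 orbb => /eqP ->; rewrite mxE.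
Qed.

End RowMaps.

(** * The two equations on the manifold *)

Section FiberChart.
Context {R : realType} {m n : nat} {M : manifold R m} {B : manifold R n}.
Variables (sigma : M -> B) (A : set (TM M)) (L : TM M -> R) (nb : operator M).
Hypothesis ssg : smooth_map sigma.
Hypothesis sub : forall p (y : 'rV[R]_n), exists x, mdiff sigma p x = y.
Hypothesis pf : pseudo_finsler A L.
Hypothesis hver : vertical_nondegenerate sigma A L.
Hypothesis lcc : levi_civita_chern A L nb.
Variables (b : B) (F : manifold R (m - n)%N) (i : F -> M) (nbF : operator F).
Hypothesis fe : fiber_embedding (sigma @^-1` [set b]) i.
Hypothesis pfF : pseudo_finsler (tmap i @^-1` A) (L \o tmap i).
Hypothesis lccF : levi_civita_chern (tmap i @^-1` A) (L \o tmap i) nbF.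
Variable f : F.
Local Notation k := (m - n)%N.
Local Notation E := 'rV[R]_m.
Local Notation D := 'rV[R]_k.
Local Notation p := (i f).
Local Notation io := (cexp i f p).
Local Notation W := (cexp_dom i f p).
Local Notation Om := (sdom sigma A p b).
Local Notation sg := (cexp sigma p b).
Local Notation lag := (lagr L p).
Local Notation lagF := (lagr (L \o tmap i) f).
Local Notation Ga := (gam nb p).
Local Notation GaF := (gam nbF f).
Local Notation Qh := (Qhf lag Ga sg).

Lemma si : smooth_map i. Proof. by case: fe. Qed.

Lemma sigma_i y : sigma (i y) = b.
Proof.
have [_ _ ri _ _] := fe; have : range i (i y) by exists y.
by rewrite ri.
Qed.

Definition fdom : set (D * D) := [set q | tdom (tmap i @^-1` A) f q /\ W q.1].

Lemma fdom_open : open fdom.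
Proof.
apply: openI; first exact: (pf_open pfF).
apply: open_comp => [z _|]; first exact: fst_continuous.
exact: cexp_open si _ _.
Qed.

Lemma fiber_finsler : local_finsler fdom lagF GaF.
Proof. by apply: local_finsler_sub (chart_finsler pfF lccF f) fdom_open _ => z []. Qed.

Lemma tio_chart q : fdom q -> tmap i (tinv f q) = tinv p (tio io q).
Proof. by move=> [_ [cq pq]]; exact: (tmap_tinv si cq pq). Qed.

Lemma cinv_io y : W y -> cinv p (io y) = i (cinv f y).
Proof. by move=> [cy py]; exact: cmapK. Qed.

Lemma io_dom y : W y -> cexp_dom sigma p b (io y).
Proof.
move=> Wy; have [_ py] := Wy.
by split; [exact: cmap_ccod|rewrite cinv_io // sigma_i; exact: cdom_center].
Qed.

Lemma tio_sdom q : fdom q -> Om (tio io q).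
Proof.
move=> Oq; have [[cq Aq] Wq] := Oq; have [_ pq] := Wq.
by split; [split; [exact: cmap_ccod|rewrite -tio_chart]|exact: io_dom].
Qed.

Lemma io_dif y : W y -> dif io y.
Proof. exact: sm_dif (cexp_smooth si _ _). Qed.

Lemma io_lin y : W y -> linear (dv io y).
Proof. by move=> Wy; exact: dv_linear (io_dif Wy). Qed.

Lemma mdiff_io y a : W y -> mdiff i (cinv f y) (ext f a (cinv f y)) = ext p (dv io y a) (i (cinv f y)).
Proof. by move=> [cy py]; rewrite (mdiff_ext si a (cinv_cdom cy) py) cinvK. Qed.

Lemma io_inj y a : W y -> dv io y a = 0 -> a = 0.
Proof.
move=> Wy a0; have [cy py] := Wy; have fy := cinv_cdom cy.
have [_ _ _ im _] := fe.
have : ext f a (cinv f y) = 0.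
  by apply: (im (cinv f y)); rewrite (mdiff_io a Wy) a0 (lin_0 (ext_lin py)).
by move=> e0; rewrite -(tcoord_ext a fy) e0 (lin_0 (tcoord_lin fy)).
Qed.

Lemma sg_dif y : W y -> dif sg (io y).
Proof. by move=> /io_dom Uy; exact: sm_dif (cexp_smooth ssg _ _) Uy. Qed.

Lemma io_ver y a : W y -> dv sg (io y) (dv io y a) = 0.
Proof.
move=> Wy; rewrite -(dv_comp a (io_dif Wy) (sg_dif Wy)) -[RHS](dv_cst (cmap b b) y a).
have oW : open W by exact: cexp_open si _ _.
by apply: (dv_eq a oW Wy) => y' Wy'; rewrite {1}/cexp cinv_io // sigma_i.
Qed.

Lemma io_range y w : W y -> dv sg (io y) w = 0 -> exists a, dv io y a = w.
Proof.
move=> Wy; apply: (exact_range (io_lin Wy) (dv_linear (sg_dif Wy))) => // [u|y'|u].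
- exact: io_inj.
- exact: (ls_surj (sub_submersion ssg sub hver p b) (io_dom Wy)).
- exact: io_ver.
Qed.

Lemma fiber_chart : local_fiber Om lag sg fdom lagF W io.
Proof.
split.
- exact: cexp_open si _ _.
- exact: cexp_smooth si _ _.
- by move=> q Oq; split; [case: Oq|exact: tio_sdom].
- by move=> q Oq; rewrite /lagr /= tio_chart.
- by move=> q a [_ Wq]; exact: io_ver.
- by move=> q w [_ Wq]; exact: io_range.
Qed.

Lemma pullv_mdiff y c : pullv i y (mdiff i y c) = c.
Proof.
have [_ _ _ im _] := fe; apply: xget_unique => // c' /= Ec.
apply/eqP; rewrite -subr_eq0; apply/eqP; apply: (im y).
by rewrite (lin_B (mdiff_lin si y)) Ec subrr.
Qed.

(* The left inverse J^T (J J^T)^-1 of the differential J of the inclusion makes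
   the restriction of [Qhat] to the fibre visibly smooth. *)
Definition qfib (q : D * D) (a c : D) : D :=
  let J := lmx (dv io q.1) in
  Qh (tio io q) (dv io q.1 a) (dv io q.1 c) *m J^T *m invmx (J *m J^T).

Local Notation H := (sub_finsler ssg pf lcc p b).
Local Notation S := (sub_submersion ssg sub hver p b).

Lemma qfibE q a c : fdom q -> dv io q.1 (qfib q a c) = Qh (tio io q) (dv io q.1 a) (dv io q.1 c).
Proof.
move=> Oq; have [_ Wq] := Oq; have Oz := tio_sdom Oq.
have v0 : dv sg (io q.1) (Qh (tio io q) (dv io q.1 a) (dv io q.1 c)) = 0.
  exact: (ver_top H S Oz (Qhf_top H S _ _ Oz)).
have [u Eu] := fb_range fiber_chart Oq v0.
suff -> : qfib q a c = u by [].
rewrite /qfib -Eu -(lmxE u (io_lin Wq)) -[u *m _ *m _]mulmxA mulmxK //.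
by apply: gram_unitmx => w; rewrite lmxE; [exact: io_inj|exact: io_lin].
Qed.

Lemma qfib_smooth a c : smooth_on fdom (fun q => qfib q a c).
Proof.
have oF := fdom_open; have oW : open W by exact: cexp_open si _ _.
have sio : smooth_on W io := cexp_smooth si _ _.
have sJ w : smooth_on fdom (fun q : D * D => dv io q.1 w).
  apply: (@sm_comp _ _ _ _ fdom W fst (fun y => dv io y w) (fd_rV _) oF oW _ (sm_dv w sio) (sm_fst _)).
  by move=> q [].
have sI : smooth_on fdom (fun q : D * D => io q.1).
  apply: (@sm_comp _ _ _ _ fdom W fst io (fd_rV _) oF oW _ sio (sm_fst _)).
  by move=> q [].
have Jl : slin W (fun y w => dv io y w).
  by split=> [y Wy|w]; [exact: io_lin|exact: sm_dv].
have sV : smooth_on fdom (fun q : D * D => dv io q.1 q.2).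
  apply: (sm_fam (fd_rV _) oF oW Jl _ (sm_fst _) (sm_snd _)).
  by move=> q [].
have sM : smooth_on fdom (fun q : D * D => lmx (dv io q.1)).
  apply: (sm_mx oF) => j l; under eq_fun do rewrite mxE.
  by apply: (sm_entry _ _ oF).
have sMt := sm_trmx oF sM.
apply: (sm_mulmx oF); last first.
  apply: (sm_invmx oF); last exact: (sm_mulmx oF sM sMt).
  move=> q [_ Wq]; apply: gram_unitmx => w.
  by rewrite lmxE; [exact: io_inj|exact: io_lin].
apply: (sm_mulmx oF _ sMt).
have oS : open Om  by exact: (sdom_open ssg pf).
have sT : smooth_on fdom (tio io) := sm_pair oF sI sV.
exact: (sm_bil (fd_Z m m) oF oS (Qhf_bil H S) tio_sdom sT (sJ a) (sJ c)).
Qed.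

(** Identifies the restriction of Qhat, defined through the choice in [pullv], with the explicit
    [qfib]; its smoothness in the fibre chart follows. *)
Lemma pull_Qhat q a c : fdom q ->
  tenc f (pull_tensor i (Qhat sigma L nb)) q a c = qfib q a c.
Proof.
move=> Oq; have [_ Wq] := Oq; have [cq pq] := Wq; have Oz := tio_sdom Oq.
have fq := cinv_cdom cq.
have Eq : Qhat sigma L nb (tmap i (tinv f q)) (mdiff i (cinv f q.1) (ext f a (cinv f q.1)))
    (mdiff i (cinv f q.1) (ext f c (cinv f q.1))) = mdiff i (cinv f q.1) (ext f (qfib q a c) (cinv f q.1)).
  have E1 := f_equal3 (Qhat sigma L nb) (tio_chart Oq) (mdiff_io a Wq) (mdiff_io c Wq).
  have E2 := Qhat_chart ssg sub pf hver lcc (dv io q.1 a) (dv io q.1 c) Oz.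
  have E3 : cinv p (tio io q).1 = i (cinv f q.1) := cinv_io Wq.
  rewrite E3 in E2; have E4 := mdiff_io (qfib q a c) Wq.
  rewrite (qfibE a c Oq) in E4.
  exact: (etrans E1 (etrans E2 (esym E4))).
rewrite -[RHS](tcoord_ext _ fq) -[ext f (qfib _ _ _) _](pullv_mdiff (cinv f q.1)) -Eq.
by [].
Qed.

Let W0 : W (cmap f f).
Proof. by apply: cexp_center; exact: cdom_center. Qed.

Let io0 : io (cmap f f) = cmap p p.
Proof. by apply: cexp_cmap; exact: cdom_center. Qed.

Let p0 : cdom b (sigma p).
Proof. by rewrite sigma_i; exact: cdom_center. Qed.

Lemma mdiff_pullv w : vertical sigma p w -> mdiff i f (pullv i f w) = w.
Proof.
move=> vw.
have : dv sg (io (cmap f f)) w = 0.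
  have pp := cdom_center p; have := mdiff_ext ssg w pp p0.
  rewrite ext_center vw io0 => w0.
  by rewrite -(tcoord_ext (dv sg _ w) p0) -w0 (lin_0 (tcoord_lin p0)).
by move=> /(io_range W0)[c <-]; rewrite -mdiffE pullv_mdiff.
Qed.

Lemma gauss_fiber v s u w : A (p, v) -> vertical sigma p v -> vertical sigma p s ->
  vertical sigma p u -> vertical sigma p w ->
  let top := vtop sigma L (p, v) in
  let T := oneillT sigma L nb (p, v) in
  let Q := Qhat sigma L nb (p, v) in
  let C := cartan_sharp L (p, v) in
  let P := Ptensor nb (p, v) in
  let Rhat := fiber_curvature i nbF f v in
  let nablaQ := fiber_nabla i nbF (Qhat sigma L nb) f v in
  top (curvature nb (p, v) w u s) =
    Rhat w u s + T w (T u s) - T u (T w s)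
    + nablaQ w u s - nablaQ u w s + Q w (Q u s) - Q u (Q w s)
    - top (P u s (Q w v + T w v)) + top (P w s (Q u v + T u v))
    - 2%:R *: top (C (T u s) (Q w v + T w v))
    + 2%:R *: top (C (T w s) (Q u v + T u v)).
Proof.
move=> Av vv vs vu vw top T Q C P Rhat nablaQ.
pose z0 : E * E := (cmap p p, v); pose q0 : D * D := (cmap f f, pullv i f v).
have Aq : (tmap i @^-1` A) (f, pullv i f v) by rewrite /= /tmap /= mdiff_pullv.
have Oq : fdom q0 by split; [exact: (tdom_center Aq)|exact: W0].
have Jw x : vertical sigma p x -> dv io q0.1 (pullv i f x) = x.
  by move=> vx; rewrite -mdiffE mdiff_pullv.
have tq : tio io q0 = z0 by rewrite /tio (Jw _ vv) /= io0.
have Oz : Om z0 by rewrite -tq; exact: tio_sdom.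
have G := gauss_local H S fiber_finsler fiber_chart qfib_smooth qfibE
  (pullv i f u) (pullv i f s) (pullv i f w) Oq.
cbv zeta in G; rewrite tq (Jw _ vs) (Jw _ vu) (Jw _ vw) in G.
have hT x e : vertical sigma p x -> T x e = chif lag Ga sg z0 x e.
  move=> vx; rewrite /T /oneillT (vtop_center ssg sub pf hver lcc Av p0).
  rewrite (chi_center ssg sub pf hver lcc Av p0) (top_id H S Oz) //.
  by apply/(vertical_center ssg Av p0).
have hC e e' : C e e' = csf lag z0 e e' by exact: (csf_center pf lcc Av p0).
have ht e : top e = topf lag sg z0 e by exact: (vtop_center ssg sub pf hver lcc Av p0).
have hQ e e' : Q e e' = Qhf lag Ga sg z0 e e' by exact: (Qhat_center ssg sub pf hver lcc Av p0).
have acF := lcc_connection lccF; have ac := lcc_connection lcc.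
have hR : Rhat w u s = mdiff i f (Rf GaF q0 (pullv i f w) (pullv i f u) (pullv i f s)).
  by rewrite /Rhat /fiber_curvature (curvature_center acF (pf_open pfF) Aq).
have hN x y y' : nablaQ x y y' = mdiff i f (covT GaF qfib q0 (pullv i f x) (pullv i f y) (pullv i f y')).
  rewrite /nablaQ /fiber_nabla.
  have cf y0 : fdom y0 -> ccod f y0.1 by move=> [[]].
  have sQ e h : smooth_on fdom (fun q => tenc f (pull_tensor i (Qhat sigma L nb)) q e h).
    apply: (sm_ext fdom_open _ (qfib_smooth e h)) => q Oq'.
    by rewrite pull_Qhat.
  rewrite (nabla_tensor_center acF Aq _ _ _ fdom_open cf sQ Oq).
  by congr (mdiff i f _); apply: (covT_eq _ _ _ _ fdom_open Oq) => *; exact: pull_Qhat.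
have hP e h c : P e h c = Pf Ga z0 e h c by rewrite /P (Ptensor_center ac Av e h c).
have hK := curvature_center ac (pf_open pf) Av w u s.
have hM c : mdiff i f c = dv io q0.1 c := mdiffE i f c.
clearbody top T Q C P Rhat nablaQ.
have hTw e := hT w e vw; have hTu e := hT u e vu.
have hR' := etrans hR (hM _).
have hN' x y y' := etrans (hN x y y') (hM _).
rewrite hK hR' !hN'.
rewrite !ht.
rewrite !hTw.
rewrite !hTu !hC !hQ.
rewrite !hP.
exact: G.
Qed.

End FiberChart.

Section DualChart.
Context {R : realType} {m n : nat} {M : manifold R m} {B : manifold R n}.
Variables (sigma : M -> B) (A : set (TM M)) (L : TM M -> R) (nb : operator M).
Hypothesis ssg : smooth_map sigma.
Hypothesis sub : forall p (y : 'rV[R]_n), exists x, mdiff sigma p x = y.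
Hypothesis pf : pseudo_finsler A L.
Hypothesis hver : vertical_nondegenerate sigma A L.
Hypothesis lcc : levi_civita_chern A L nb.
Variables (At : set (TM B)) (Lt : TM B -> R) (nbB : operator B).
Hypothesis pfB : pseudo_finsler At Lt.
Hypothesis lccB : levi_civita_chern At Lt nbB.
Hypothesis iso : forall v, horizontal sigma A L v ->
  At (tmap sigma v) /\ L v = Lt (tmap sigma v).
Variable p : M.
Local Notation E := 'rV[R]_m.
Local Notation r := (sigma p).
Local Notation Ga := (gam nb p).
Local Notation lag := (lagr L p).
Local Notation sg := (cexp sigma p r).
Local Notation Om := (sdom sigma A p r).
Local Notation H := (sub_finsler ssg pf lcc p r).
Local Notation S := (sub_submersion ssg sub hver p r).
Local Notation ac := (lcc_connection lcc).

Let r0 : cdom r (sigma p). Proof. exact: cdom_center. Qed.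

Lemma iso_chart z : hor Om lag sg z -> tdom At r (tsg sg z) /\ lag z = lagr Lt r (tsg sg z).
Proof.
move=> [Oz tz]; have [[cz Az] [_ rz]] := Oz.
have hz : horizontal sigma A L (tinv p z).
  by split; [exact: Az|exact/(ghorizontal_chart ssg sub pf hver lcc z.2 Oz)].
have := iso hz; rewrite (tmap_tinv ssg cz rz) => -[h1 h2].
by split; [split; [exact: cmap_ccod|exact: h1]|exact: h2].
Qed.

(** Both sides are g_v-horizontal, so it suffices to compare their images under the differential of
    sigma, where [dual_local] applies. *)
Lemma dual_base v x y z : horizontal sigma A L (p, v) ->
  ghorizontal sigma L (p, v) x -> ghorizontal sigma L (p, v) y ->
  ghorizontal sigma L (p, v) z ->
  let top := vtop sigma L (p, v) in
  let bot := vbot sigma L (p, v) in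
  let a := oneillA sigma L nb (p, v) in
  let Q := Qtilde sigma L nb (p, v) in
  let C := cartan_sharp L (p, v) in
  let P := Ptensor nb (p, v) in
  let d := mdiff sigma p in
  let Rtilde := hlift sigma L (p, v)
    (curvature nbB (tmap sigma (p, v)) (d x) (d y) (d z)) in
  let nablaQ := nabla_tensor nb (Qtilde sigma L nb) (p, v) in
  let dotQ y z b :=
    vdot (fun v' => Qtilde sigma L nb v' y z) (p, v) b in
  bot (curvature nb (p, v) x y z) =
    Rtilde + a x (a y z) - a y (a x z) + a z (a y x) - a z (a x y)
    + 2%:R *: a z (top (C y (a x v))) + 2%:R *: a y (top (C z (a x v)))
    - 2%:R *: a z (top (C x (a y v))) - 2%:R *: a x (top (C z (a y v)))
    + bot (nablaQ x y z - nablaQ y x z) + Q y (Q x z) - Q x (Q y z)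
    + bot (dotQ y z (a x v)) - bot (dotQ x z (a y v))
    - bot (P y z (a x v)) + bot (P x z (a y v)).
Proof.
move=> hv hx hy hz top bot a Q C P d Rtilde nablaQ dotQ.
have [Av hvv] := hv; have [Atv _] := iso hv.
pose z0 : E * E := (cmap p p, v).
have Oz : Om z0 by exact: (sdom_center Av r0).
pose T := topf lag sg z0; pose X := chif lag Ga sg z0; pose Qt := Qtf lag Ga sg z0.
have hor0 e : ghorizontal sigma L (p, v) e <-> T e = 0.
  exact: (ghorizontal_center ssg sub pf hver lcc Av r0).
have tv : T v = 0 by apply/hor0.
have tx : T x = 0 by apply/hor0.
have ty : T y = 0 by apply/hor0.
have tz : T z = 0 by apply/hor0.
have hz0 : hor Om lag sg z0 by split.
have HB := chart_finsler pfB lccB r.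
have G := dual_local H S HB iso_chart hz0 tx ty tz.
cbv zeta in G.
have dE e : dv sg z0.1 e = d e by rewrite /d mdiffE.
have ht e : top e = T e by exact: (vtop_center ssg sub pf hver lcc Av r0).
have hb e : bot e = e - T e by rewrite /bot /vbot -/top ht.
have hA w e : T w = 0 -> a w e = X w e.
  move=> tw; rewrite /a /oneillA -/bot hb tw subr0.
  exact: (chi_center ssg sub pf hver lcc Av r0).
have hC e e' : C e e' = csf lag z0 e e' by exact: (csf_center pf lcc Av r0).
have hQ e e' : Q e e' = Qt e e' by exact: (Qtilde_center ssg sub pf hver lcc Av r0).
have hP e h c : P e h c = Pf Ga z0 e h c by rewrite /P (Ptensor_center ac Av e h c).
have cO y0 : Om y0 -> ccod p y0.1 by move=> [[]].
have oO : open Om by exact: (sdom_open ssg pf).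
have QE q e h : Om q -> tenc p (Qtilde sigma L nb) q e h = Qtf lag Ga sg q e h.
  move=> Oq; have [[cq _] _] := Oq.
  have E1 := Qtilde_chart ssg sub pf hver lcc e h Oq.
  exact: (etrans (congr1 (fun w => tcoord p (cinv p q.1, w)) E1) (tcoord_ext _ (cinv_cdom cq))).
have [_ _ sQt] := Qtf_bil H S.
have sQ e h : smooth_on Om (fun q => tenc p (Qtilde sigma L nb) q e h).
  by apply: (sm_ext oO _ (sQt e h)) => q Oq; rewrite QE.
have hN x' y' z' : nablaQ x' y' z' = covT Ga (Qtf lag Ga sg) z0 x' y' z'.
  rewrite /nablaQ (nabla_tensor_center ac Av x' y' z' oO cO sQ Oz).
  exact: (covT_eq _ _ _ _ oO Oz QE).
have hD y' z' b : dotQ y' z' b = dv (fun q => Qtf lag Ga sg q y' z') z0 (0, b).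
  (* A fibre derivative keeps the base point p, where the coordinate fields take the values y' and
     z'; the tensor may thus be evaluated on these fields, as [tenc] does. *)
  have -> : dotQ y' z' b = vdot (fun v' => Qtilde sigma L nb v' (ext p y' v'.1) (ext p z' v'.1)) (p, v) b.
    by rewrite /dotQ /vdot /= !ext_center.
  rewrite (vdot_center _ (sm_dif (sQ y' z') Oz)).
  by apply: (dv_eq _ oO Oz) => q Oq; exact: QE.
have tB : tsg sg z0 = (cmap r r, d v).
  by rewrite /tsg dE /= (cexp_cmap sigma r (cdom_center p)).
have hR : curvature nbB (tmap sigma (p, v)) (d x) (d y) (d z)
    = Rf (gam nbB r) (tsg sg z0) (d x) (d y) (d z).
  by rewrite tB; exact: (curvature_center (lcc_connection lccB) (pf_open pfB) Atv).
have lt : linear T := top_lin H S Oz.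
have ld : linear d := mdiff_lin ssg p.
have dT e : d (T e) = 0 by rewrite -dE; exact: (top_ver H S).
(* The choice in [hlift] is from a nonempty set: any preimage with its vertical part removed belongs
   to it. *)
have [hl dl] : T Rtilde = 0 /\ d Rtilde = curvature nbB (tmap sigma (p, v)) (d x) (d y) (d z).
  rewrite /Rtilde; move: (curvature _ _ _ _ _) => c.
  have [e Ee] := sub p c.
  pose Pc e' := ghorizontal sigma L (p, v) e' /\ mdiff sigma p e' = c.
  have : Pc (hlift sigma L (p, v) c).
    apply: (@xgetPex _ 0 Pc); exists (e - T e); split.
      by apply/hor0; rewrite (lin_B lt) [T (T e)](top_top H S _ Oz) subrr.
    by rewrite -/d (lin_B ld) dT subr0.
  by move=> [/hor0].
(* The difference is both vertical and horizontal. *)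
have inj e e' : T e = 0 -> T e' = 0 -> d e = d e' -> e = e'.
  move=> te te' de; apply/eqP; rewrite -subr_eq0; apply/eqP.
  have : T (e - e') = e - e'.
    by apply: (top_id H S Oz); rewrite dE (lin_B ld) de subrr.
  by rewrite (lin_B lt) te te' subrr => <-.
have TT e : T (T e) = T e := top_top H S e Oz.
have XT w e : T e = e -> T (X w e) = 0 := chi_ver_top H S w Oz.
have Xv w e : T e = 0 -> T (X w e) = X w e := chi_hor_top H S w Oz.
have XX w w' e : T e = 0 -> T (X w (X w' e)) = 0 by move=> te; apply: XT; exact: Xv.
have XTop w e : T (X w (T e)) = 0 by apply: XT; exact: TT.
have TQ e h : T (Qt e h) = 0 := Qtf_top H S e h Oz.
have tb e : T (bot e) = 0 by rewrite hb (lin_B lt) TT subrr.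
have db e : d (bot e) = d e by rewrite hb (lin_B ld) dT subr0.
have hK := curvature_center ac (pf_open pf) Av x y z.
rewrite !dE in G.
have G' : d (curvature nb (p, v) x y z) = d Rtilde + d (
    X x (X y z) - X y (X x z) + X z (X y x) - X z (X x y)
    + 2 *: X z (T (C y (X x v))) + 2 *: X y (T (C z (X x v)))
    - 2 *: X z (T (C x (X y v))) - 2 *: X x (T (C z (X y v)))
    + (nablaQ x y z - nablaQ y x z)
    + Qt y (Qt x z) - Qt x (Qt y z) + dotQ y z (X x v) - dotQ x z (X y v)
    - P y z (X x v) + P x z (X y v)).
  by rewrite hK dl hR !hN !hD !hP !hC; exact: G.
have hx' e := hA x e tx; have hy' e := hA y e ty; have hz' e := hA z e tz.
clear G hK hN hD hP hR dl; clearbody top bot a Q C P d Rtilde nablaQ dotQ X T Qt.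
apply: inj.
- exact: tb.
- rewrite !hx' !hy' !hz' !ht !hQ.
  rewrite !(lin_D lt) !(lin_N lt) !(lin_Z lt) hl !tb !TQ !XTop.
  rewrite !(XX _ _ _ tx) !(XX _ _ _ ty) !(XX _ _ _ tz).
  by rewrite !(scaler0, oppr0, addr0).
rewrite db G' !hx' !hy' !hz' !ht !hQ.
rewrite !(lin_D ld) !(lin_N ld) !db !(lin_D ld) !(lin_N ld).
by rewrite !addrA.
Qed.

End DualChart.

Theorem theorem2 (R : realType) (m n : nat)
    (M : manifold R m) (B : manifold R n) (sigma : M -> B)
    (F : B -> manifold R (m - n)%N) (i : forall b : B, F b -> M)
    (A : set (TM M)) (L : TM M -> R) (At : set (TM B)) (Lt : TM B -> R)
    (nb : operator M) (nbF : forall b : B, operator (F b)) (nbB : operator B)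
    (hsub : pseudo_finsler_submersion sigma i A L At Lt)
    (hver : vertical_nondegenerate sigma A L)
    (hnb : levi_civita_chern A L nb)
    (hnbF : forall b : B,
       levi_civita_chern (tmap (i b) @^-1` A) (L \o tmap (i b)) (nbF b))
    (hnbB : levi_civita_chern At Lt nbB) :
  (forall (b : B) (f : F b) (v s u w : 'rV[R]_m),
     let p := i b f in
     A (p, v) ->
     vertical sigma p v -> vertical sigma p s ->
     vertical sigma p u -> vertical sigma p w ->
     let top := vtop sigma L (p, v) in
     let T := oneillT sigma L nb (p, v) in
     let Q := Qhat sigma L nb (p, v) in
     let C := cartan_sharp L (p, v) in
     let P := Ptensor nb (p, v) in
     let Rhat := fiber_curvature (i b) (nbF b) f v in
     let nablaQ := fiber_nabla (i b) (nbF b) (Qhat sigma L nb) f v in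
     top (curvature nb (p, v) w u s) =
       Rhat w u s + T w (T u s) - T u (T w s)
       + nablaQ w u s - nablaQ u w s + Q w (Q u s) - Q u (Q w s)
       - top (P u s (Q w v + T w v)) + top (P w s (Q u v + T u v))
       - 2%:R *: top (C (T u s) (Q w v + T w v))
       + 2%:R *: top (C (T w s) (Q u v + T u v)))
  /\
  (forall (p : M) (v x y z : 'rV[R]_m),
     horizontal sigma A L (p, v) ->
     ghorizontal sigma L (p, v) x -> ghorizontal sigma L (p, v) y ->
     ghorizontal sigma L (p, v) z ->
     let top := vtop sigma L (p, v) in
     let bot := vbot sigma L (p, v) in
     let a := oneillA sigma L nb (p, v) in
     let Q := Qtilde sigma L nb (p, v) in
     let C := cartan_sharp L (p, v) in
     let P := Ptensor nb (p, v) in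
     let d := mdiff sigma p in
     let Rtilde := hlift sigma L (p, v)
       (curvature nbB (tmap sigma (p, v)) (d x) (d y) (d z)) in
     let nablaQ := nabla_tensor nb (Qtilde sigma L nb) (p, v) in
     let dotQ y z b :=
       vdot (fun v' => Qtilde sigma L nb v' y z) (p, v) b in
     bot (curvature nb (p, v) x y z) =
       Rtilde + a x (a y z) - a y (a x z) + a z (a y x) - a z (a x y)
       + 2%:R *: a z (top (C y (a x v))) + 2%:R *: a y (top (C z (a x v)))
       - 2%:R *: a z (top (C x (a y v))) - 2%:R *: a x (top (C z (a y v)))
       + bot (nablaQ x y z - nablaQ y x z) + Q y (Q x z) - Q x (Q y z)
       + bot (dotQ y z (a x v)) - bot (dotQ x z (a y v))
       - bot (P y z (a x v)) + bot (P x z (a y v))).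
Proof.
have [pf pfB ssg sur sub fib pfF iso] := hsub.
split=> [b f v s u w p|p v x y z].
  exact: (gauss_fiber ssg sub pf hver hnb (fib b) (pfF b) (hnbF b)).
exact: (dual_base ssg sub pf hver hnb pfB hnbB iso).
Qed.
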